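(* Let $\rho^{A_1\ldots A_m}=\mathrm{Tr}_E\,\psi^{A_1\ldots A_mE}$ where $|\psi\rangle^{A_1\ldots A_mE}$ is a purification. For each player $j\in[m]$ let $\mathcal{E}^{(j)}=\{\mathcal{E}^{(j)}_{x_j}\}_{x_j\in\mathcal{X}_j}$ be a pure instrument: $\mathcal{E}^{(j)}_{x_j}(\sigma)=E^{(j)}_{x_j}\sigma(E^{(j)}_{x_j})^\dagger$ with operators $E^{(j)}_{x_j}:A_j\to A_j'$ satisfying $\sum_{x_j}(E^{(j)}_{x_j})^\dagger E^{(j)}_{x_j}=\mathbb{1}_{A_j}$. Let $$\omega^{X_{[m]}A'_{[m]}E}=\sum_{x_{[m]}}|x_{[m]}\rangle\langle x_{[m]}|^{X_{[m]}}\otimes(\mathcal{E}^{(1)}_{x_1}\otimes\cdots\otimes\mathcal{E}^{(m)}_{x_m}\otimes\mathrm{id}_E)\psi.$$ Let $\mathcal{R}_{\mathrm{cq}}$ be the set of rate tuples $R_{[m]}$ with $\sum_{i\in J}R_i\ge S(X_J|X_{[m]\setminus J},A'_{j'})_\omega$ for all $j'\in[m]$ and all $J\subseteq[m]\setminus\{j'\}$, and $R^{\mathrm{cq}}_{\mathrm{CO}}=\min_{R_{[m]}\in\mathcal{R}_{\mathrm{cq}}}\sum_iR_i$. Then for every $j\in[m]$, $$D(\rho)\ \ge\ S(X_1\ldots X_m\,|\,E\,A'_{[m]\setminus\{j\}})_\omega-R^{\mathrm{cq}}_{\mathrm{CO}}.$$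
   Context: $[m]=\{1,\ldots,m\}$; $X_J=(X_i:i\in J)$, $A'_J=(A'_i:i\in J)$. $S(A|B)=S(AB)-S(B)$ with von Neumann entropy $S$; $\log$ base 2. GHZ distillation capacity: let $|\Gamma_m\rangle=\frac1{\sqrt2}(|0\rangle^{\otimes m}+|1\rangle^{\otimes m})$. An $(n,\varepsilon)$-protocol of rate $k/n$ is an $m$-partite channel $\Lambda$ on $A_1^n\ldots A_m^n$ implementable by local operations and classical communication (LOCC) with $F(|\Gamma_m\rangle\langle\Gamma_m|^{\otimes k},\Lambda(\rho^{\otimes n}))\ge1-\varepsilon$, where $F(\rho,\sigma)=\|\sqrt\rho\sqrt\sigma\|_1$ is the fidelity and the $i$-th qubit of each GHZ state is held by party $i$. $R$ is achievable if for every $n$ there are $(n,\varepsilon_n)$-protocols with $\varepsilon_n\to0$ and $k/n\to R$; $D(\rho)=\sup\{R:R\text{ achievable}\}$. *)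

(* Defs.v *)
From HB Require Import structures.
From mathcomp Require Import all_boot all_order all_algebra.
From mathcomp Require Import complex.
From mathcomp Require Import all_classical all_reals all_analysis.
Set Implicit Arguments. Unset Strict Implicit. Unset Printing Implicit Defensive.
Import Order.TTheory GRing.Theory Num.Theory.
Import numFieldNormedType.Exports.
Local Open Scope ring_scope.
Local Open Scope classical_set_scope.

Section Quantum.
Variable R : realType.
Local Notation C := (R[i]).
Local Notation "x %:C" := (real_complex R x).

(* an operator from (the Hilbert space with orthonormal basis) T to U *)
Definition op (U T : finType) := U -> T -> C.
Definition vec (T : finType) := T -> C.

Definition opmul (U V T : finType) (A : op U V) (B : op V T) : op U T :=
  fun u t => \sum_(v : V) A u v * B v t.
Definition adj (U T : finType) (A : op U T) : op T U :=
  fun t u => conjc (A u t).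
Definition idop (T : finType) : op T T := fun a b => (a == b)%:R.
Definition tr (T : finType) (A : op T T) : C := \sum_(a : T) A a a.
Definition proj (T : finType) (v : vec T) : op T T := fun a b => v a * conjc (v b).
Definition conj_by (U T : finType) (L : op U T) (rho : op T T) : op U U :=
  opmul (opmul L rho) (adj L).

Definition unitary (T : finType) (U : op T T) : Prop :=
  forall a b, opmul (adj U) U a b = @idop T a b.

Definition psd (T : finType) (A : op T T) : Prop :=
  (forall a b, A b a = conjc (A a b)) /\
  forall v : vec T, 0 <= \sum_(a : T) \sum_(b : T) conjc (v a) * A a b * v b.
Definition density (T : finType) (A : op T T) : Prop := psd A /\ tr A = 1.
Definition unit_vec (T : finType) (v : vec T) : Prop :=
  \sum_(a : T) conjc (v a) * v a = 1.

Definition eigdec (T : finType) (A : op T T) (U : op T T) (l : T -> R) : Prop :=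
  unitary U /\ forall a b, A a b = \sum_(c : T) U a c * (l c)%:C * conjc (U b c).

(* functional calculus f(A) for a Hermitian A (via a chosen spectral
   decomposition; the result does not depend on the choice) *)
Definition fcalc (T : finType) (f : R -> R) (A : op T T) : op T T :=
  match pselect (exists Ul : op T T * (T -> R), eigdec A Ul.1 Ul.2) with
  | left h => let Ul := projT1 (cid h) in
      fun a b => \sum_(c : T) Ul.1 a c * (f (Ul.2 c))%:C * conjc (Ul.1 b c)
  | right _ => fun _ _ => 0
  end.

Definition log2 (x : R) : R := ln x / ln 2.

Definition entropy (T : finType) (A : op T T) : R :=
  - complex.Re (tr (fcalc (fun x => if x == 0 then 0 else x * log2 x) A)).

Definition trnorm (U T : finType) (A : op U T) : R :=
  complex.Re (tr (fcalc Num.sqrt (opmul (adj A) A))).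
Definition fidelity (T : finType) (rho sigma : op T T) : R :=
  trnorm (opmul (fcalc Num.sqrt rho) (fcalc Num.sqrt sigma)).

(* Multipartite systems: slots S, local basis F s for each slot s       *)

Definition Jt (S : finType) (F : S -> finType) : finType := {dffun forall s : S, F s}.

Definition subsys (S : finType) (F : S -> finType) (P : {set S}) : finType :=
  {dffun forall s : {s : S | s \in P}, F (val s)}.

Definition marg (S : finType) (F : S -> finType) (P : {set S})
    (A : op (Jt F) (Jt F)) : op (subsys F P) (subsys F P) :=
  fun a b => \sum_(x : Jt F | [forall s : {s : S | s \in P}, x (val s) == a s])
             \sum_(y : Jt F | [forall s : {s : S | s \in P}, y (val s) == b s]
                              && [forall s : S, (s \notin P) ==> (x s == y s)])
             A x y.

Arguments marg {S F} P A.

Definition sent (S : finType) (F : S -> finType) (P : {set S}) (A : op (Jt F) (Jt F)) : R :=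
  entropy (marg P A).
Definition cent (S : finType) (F : S -> finType) (P Q : {set S}) (A : op (Jt F) (Jt F)) : R :=
  sent (P :|: Q) A - sent Q A.

Section LOCC.
Variable m : nat.

Definition chan (T U : 'I_m -> finType) := op (Jt T) (Jt T) -> op (Jt U) (Jt U).

Definition upd (T : 'I_m -> finType) (k : 'I_m) (V : finType) : 'I_m -> finType :=
  fun i => if i == k then V else T i.

(* equality of elements of (propositionally) equal finite types *)
Definition heq (A B : finType) (a : A) (b : B) : Prop :=
  existT (fun F : finType => (F : Type)) A a = existT (fun F : finType => (F : Type)) B b.

(* K acting on party k, tensored with the identity on the other parties *)
Definition liftK (T : 'I_m -> finType) (k : 'I_m) (V : finType) (K : op V (T k)) :
    op (Jt (upd T k V)) (Jt T) :=
  fun y x => if `[< forall i, i != k -> heq (y i) (x i) >]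
             then \sum_(v : V) (if `[< heq (y k) v >] then K v (x k) else 0)
             else 0.

(* LOCC channels: the identity, or a round in which some party k applies a
   local quantum instrument {sum_r K x r . K x r^dagger}_x (outcomes x,
   Kraus operators K x r), broadcasts x, and then an LOCC channel Psi x
   (depending on x) is applied; the classical outcomes are finally discarded. *)
Inductive LOCC : forall T U : 'I_m -> finType, chan T U -> Prop :=
| LOCC_id (T : 'I_m -> finType) : @LOCC T T (fun rho => rho)
| LOCC_round (T U : 'I_m -> finType) (k : 'I_m) (V Xo Rk : finType)
    (K : Xo -> Rk -> op V (T k)) (Psi : Xo -> chan (upd T k V) U) :
    (forall a b, \sum_(x : Xo) \sum_(r : Rk) opmul (adj (K x r)) (K x r) a b = @idop (T k) a b) ->
    (forall x, @LOCC (upd T k V) U (Psi x)) ->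
    @LOCC T U (fun rho => fun a b =>
       \sum_(x : Xo) Psi x (fun c d => \sum_(r : Rk) conj_by (liftK (K x r)) rho c d) a b).

Variable A : 'I_m -> finType.

Definition nsys (n : nat) : 'I_m -> finType := fun j => {ffun 'I_n -> A j}.
Definition qsys (k : nat) : 'I_m -> finType := fun _ => {ffun 'I_k -> bool}.

Definition ntensor (n : nat) (rho : op (Jt A) (Jt A)) : op (Jt (nsys n)) (Jt (nsys n)) :=
  fun x y => \prod_(t < n)
    rho (finfun (fun j => x j t) : Jt A) (finfun (fun j => y j t) : Jt A).

(* |Gamma_m>^{(x) k}, the i-th qubit of each GHZ state held by party i *)
Definition ghz_vec (k : nat) : vec (Jt (qsys k)) :=
  fun z => if [forall t : 'I_k, forall i : 'I_m, forall i' : 'I_m, z i t == z i' t]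
           then ((Num.sqrt (2 : R))^-1 ^+ k)%:C else 0.

Arguments ghz_vec : clear implicits.
Arguments ntensor : clear implicits.

Definition protocol (rho : op (Jt A) (Jt A)) (n k : nat) (eps : R) : Prop :=
  exists Lambda : chan (nsys n) (qsys k),
    @LOCC (nsys n) (qsys k) Lambda /\
    1 - eps <= fidelity (proj (ghz_vec k)) (Lambda (ntensor n rho)).

Definition achievable (rho : op (Jt A) (Jt A)) (r : R) : Prop :=
  exists (k : nat -> nat) (eps : nat -> R),
    (forall n, (0 < n)%N -> protocol rho n (k n) (eps n)) /\
    (eps n @[n --> \oo] --> (0 : R)) /\
    (((k n)%:R / n%:R : R) @[n --> \oo] --> r).

Definition ghz_capacity (rho : op (Jt A) (Jt A)) : \bar R :=
  ereal_sup [set (r%:E) | r in achievable rho].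

End LOCC.

Definition slot (m : nat) : finType := (('I_m + 'I_m) + unit)%type.

Definition omF (m : nat) (X A' : 'I_m -> finType) (E : finType) : slot m -> finType :=
  fun s => match s with
           | inl (inl j) => X j
           | inl (inr j) => A' j
           | inr _ => E
           end.

Definition Xslots (m : nat) (J : {set 'I_m}) : {set slot m} :=
  [set s : slot m | if s is inl (inl j) then j \in J else false].
Definition Aslots (m : nat) (J : {set 'I_m}) : {set slot m} :=
  [set s : slot m | if s is inl (inr j) then j \in J else false].
Definition Eslot (m : nat) : {set slot m} := [set inr tt].

Definition trE (m : nat) (A : 'I_m -> finType) (E : finType) (psi : vec (Jt A * E)%type) :
    op (Jt A) (Jt A) :=
  fun a b => \sum_(e : E) psi (a, e) * conjc (psi (b, e)).

Definition kraus_prod (m : nat) (X A A' : 'I_m -> finType)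
    (Ek : forall j, X j -> op (A' j) (A j)) (x : Jt X) : op (Jt A') (Jt A) :=
  fun a' a => \prod_(j < m) Ek j (x j) (a' j) (a j).

Definition omega (m : nat) (X A A' : 'I_m -> finType) (E : finType)
    (Ek : forall j, X j -> op (A' j) (A j)) (psi : vec (Jt A * E)%type) :
    op (Jt (omF X A' E)) (Jt (omF X A' E)) :=
  fun w w' =>
    let xw  := (finfun (fun j => w (inl (inl j))) : Jt X) in
    let xw' := (finfun (fun j => w' (inl (inl j))) : Jt X) in
    let aw  := (finfun (fun j => w (inl (inr j))) : Jt A') in
    let aw' := (finfun (fun j => w' (inl (inr j))) : Jt A') in
    (xw == xw')%:R *
    ((\sum_(a : Jt A) kraus_prod Ek xw aw a * psi (a, w (inr tt))) *
      conjc (\sum_(b : Jt A) kraus_prod Ek xw' aw' b * psi (b, w' (inr tt)))).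

(* the region R_cq (rate tuples R_[m]) and R^cq_CO = min_{R in R_cq} sum_i R_i
   (the minimum exists; it is written as an infimum) *)
Definition Rcq (m : nat) (F : slot m -> finType) (om : op (Jt F) (Jt F)) : set ('I_m -> R) :=
  [set r | forall (j' : 'I_m) (J : {set 'I_m}), j' \notin J ->
     cent (Xslots J) (Xslots (~: J) :|: Aslots [set j']) om <= \sum_(i in J) r i].

Definition RCO (m : nat) (F : slot m -> finType) (om : op (Jt F) (Jt F)) : R :=
  inf [set \sum_(i < m) r i | r in Rcq om].

End Quantum.

(* Main.v *)
(* The parties apply their instruments coherently.  Party i announces a random hash
   c_i = f_i(x_i) of n R_i bits, reconstructs the whole tuple x from c, x_i and A'_i by a
   coherent decoder, and keeps only a k-bit random function g(x) of it.  If (c, g(x)) is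
   nearly uniform and decoupled from E A'_([m] \ j) then, by Uhlmann's theorem, player j can
   rotate its system so that the parties share sum_kappa |kappa ... kappa>, i.e. k GHZ states.

   Decoder of party i.  An Uhlmann contraction, obtained from the Powers-Stormer
   inequality, recovers x up to Re tr H (M - N), with H a contraction and M - N the part of
   the state, as seen by the purifying systems, that couples distinct x, x' with the same
   hashes.  It is a sum over the set J of positions where x and x' may differ; the J-th
   term is smoothed separately and then bounded in Hilbert-Schmidt norm, which is small on
   average over the hashes as soon as sum_(i in J) R_i > S(X_J | X_(~J) A'_i).  A leftover
   hash bound of the same kind gives decoupling when sum_i R_i + k/n < S(X_[m] | E A'_([m] \ j)).

   The eigenvalues of n copies form an i.i.d. distribution, and Chebyshev's inequality
   provides the typical sets used in the smoothing; in both estimates the eigenvalues of a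
   state on one side of a bipartite pure state are those of the other side. *)

(* Two points shape the analysis of the protocol. The GHZ weight is quadratic in the amplitudes,
   whereas the average over random signs, which forces the decoded copies of x to agree, is linear.
   The amplitudes are therefore tested against a unit vector that does not see the signs
   ([target_amp]): the average is taken in the overlap, and Cauchy-Schwarz leads back to the weight.
   Moreover the decoders and Uhlmann rotations are known as contractions only; completing them to
   instruments adds nonnegative terms to the GHZ weight, so lower bounds survive.

   Given all outcomes, A'_j and E A'_([m] \ j) share a pure state, so S(X_[m] E A'_([m] \ j)) =
   S(X_[m] A'_j): one list of eigenvalues serves decoding and decoupling.

   Hashes need nonnegative rates, while [Rcq] imposes no sign. For m >= 2 the sign follows from the
   constraints with J a singleton, the conditional entropies being nonnegative because pinching does
   not lower the entropy; this also bounds from below the set whose infimum is [RCO]. *)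
From HB Require Import structures.
From mathcomp Require Import all_boot all_order all_algebra.
From mathcomp Require Import complex spectral.
From mathcomp Require Import all_classical all_reals all_analysis.
From mathcomp Require Import ring lra.
Import Order.TTheory GRing.Theory Num.Theory.
Import numFieldNormedType.Exports.
Require Import Defs.
Set Implicit Arguments. Unset Strict Implicit. Unset Printing Implicit Defensive.
Local Open Scope ring_scope.

(** * Vectors and operators *)

Section VectorCalculus.
Variable R : realType.
Local Notation C := R[i].
Local Notation "x %:C" := (real_complex R x).
Local Notation Re := (@complex.Re R).
Implicit Types (T U V I : finType) (z w : C).

Definition sqn z : R := Re (z * conjc z).

Lemma Re_sum (I : Type) (r : seq I) (P : pred I) (F : I -> C) :
  Re (\sum_(i <- r | P i) F i) = \sum_(i <- r | P i) Re (F i).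
Proof. exact: (big_morph _ (fun x y : C => raddfD (@complex.Re R : Rcomplex R -> R) x y)). Qed.

Lemma ReD z w : Re (z + w) = Re z + Re w. Proof. by case: z => a b; case: w. Qed.
Lemma ReN z : Re (- z) = - Re z. Proof. by case: z. Qed.
Lemma ReB z w : Re (z - w) = Re z - Re w. Proof. by rewrite ReD ReN. Qed.
Lemma ReC (a : R) : Re (a%:C) = a. Proof. by []. Qed.
Lemma Re_rM (a : R) z : Re (a%:C * z) = a * Re z.
Proof. by case: z => x y /=; rewrite mul0r subr0. Qed.
Lemma Re_conjc z : Re (conjc z) = Re z. Proof. by case: z. Qed.

Lemma rcM (a b : R) : (a * b)%:C = a%:C * b%:C.
Proof. exact: rmorphM. Qed.
Lemma rc_sum (I : Type) (r : seq I) (P : pred I) (F : I -> R) :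
  (\sum_(i <- r | P i) F i)%:C = \sum_(i <- r | P i) (F i)%:C.
Proof. exact: rmorph_sum. Qed.
Lemma rc_prod (I : Type) (r : seq I) (P : pred I) (F : I -> R) :
  (\prod_(i <- r | P i) F i)%:C = \prod_(i <- r | P i) (F i)%:C.
Proof. exact: rmorph_prod. Qed.

Lemma conjc_sum (I : Type) (r : seq I) (P : pred I) (F : I -> C) :
  conjc (\sum_(i <- r | P i) F i) = \sum_(i <- r | P i) conjc (F i).
Proof. exact: rmorph_sum. Qed.
Lemma conjc_prod (I : Type) (r : seq I) (P : pred I) (F : I -> C) :
  conjc (\prod_(i <- r | P i) F i) = \prod_(i <- r | P i) conjc (F i).
Proof. exact: rmorph_prod. Qed.
Lemma conjcM z w : conjc (z * w) = conjc z * conjc w. Proof. exact: rmorphM. Qed.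
Lemma conjcB z w : conjc (z - w) = conjc z - conjc w. Proof. exact: rmorphB. Qed.
Lemma conjc_rc (a : R) : conjc (a%:C) = a%:C. Proof. by rewrite /= oppr0. Qed.
Lemma conjc_natr (n : nat) : conjc (n%:R : C) = n%:R. Proof. exact: conjc_nat. Qed.
Lemma rc_nat (n : nat) : (n%:R : R)%:C = n%:R. Proof. exact: rmorph_nat. Qed.

Lemma sqnE z : z * conjc z = (sqn z)%:C.
Proof.
case: z => a b; rewrite /sqn; apply/eqP; rewrite eq_complex /= eqxx /=; apply/eqP; ring.
Qed.
Lemma sqnRI z : sqn z = Re z ^+ 2 + complex.Im z ^+ 2.
Proof. by case: z => a b; rewrite /sqn /=; ring. Qed.
Lemma sqn_ge0 z : 0 <= sqn z. Proof. by rewrite sqnRI addr_ge0 ?sqr_ge0. Qed.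
Lemma sqnM z w : sqn (z * w) = sqn z * sqn w.
Proof. by case: z => a b; case: w => c d; rewrite /sqn /=; ring. Qed.
Lemma sqnJ z : sqn (conjc z) = sqn z. Proof. by rewrite /sqn conjcK mulrC. Qed.
Lemma sqnC (a : R) : sqn a%:C = a ^+ 2. Proof. by rewrite sqnRI /=; ring. Qed.
Lemma sqn0 : sqn 0 = 0. Proof. by rewrite sqnRI /=; ring. Qed.
Lemma sqn_nat (n : nat) : sqn (n%:R : C) = n%:R ^+ 2.
Proof. by rewrite -rc_nat sqnC. Qed.
Definition inner T (u v : T -> C) : C := \sum_t conjc (u t) * v t.
Definition nrm2 T (v : T -> C) : R := \sum_t sqn (v t).
Definition ap U T (A : U -> T -> C) (v : T -> C) : U -> C := fun u => \sum_t A u t * v t.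
Definition contr U T (A : U -> T -> C) : Prop := forall v, nrm2 (ap A v) <= nrm2 v.
Definition orthonormal I T (u : I -> T -> C) : Prop :=
  forall a b, inner (u a) (u b) = (a == b)%:R.

Lemma nrm2_ge0 T (v : T -> C) : 0 <= nrm2 v.
Proof. by apply: sumr_ge0 => t _; apply: sqn_ge0. Qed.

Lemma inner_nrm2 T (v : T -> C) : inner v v = (nrm2 v)%:C.
Proof. by rewrite /inner /nrm2 rc_sum; apply: eq_bigr => t _; rewrite mulrC sqnE. Qed.

Lemma innerJ T (u v : T -> C) : conjc (inner u v) = inner v u.
Proof.
by rewrite /inner conjc_sum; apply: eq_bigr => t _; rewrite conjcM conjcK mulrC.
Qed.

Lemma eq_nrm2 T (u v : T -> C) : u =1 v -> nrm2 u = nrm2 v.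
Proof. by move=> e; apply: eq_bigr => t _; rewrite e. Qed.
Lemma eq_inner T (u v u' v' : T -> C) : u =1 u' -> v =1 v' -> inner u v = inner u' v'.
Proof. by move=> e e'; apply: eq_bigr => t _; rewrite e e'. Qed.
Lemma eq_ap U T (A B : U -> T -> C) (v w : T -> C) : (forall u t, A u t = B u t) -> v =1 w ->
  ap A v =1 ap B w.
Proof. by move=> e e' u; apply: eq_bigr => t _; rewrite e e'. Qed.

Lemma inner_adj U T (A : U -> T -> C) (u : U -> C) (v : T -> C) :
  inner u (ap A v) = inner (ap (adj A) u) v.
Proof.
rewrite /inner /ap; under eq_bigr do rewrite mulr_sumr.
rewrite exchange_big /=; apply: eq_bigr => t _.
rewrite conjc_sum mulr_suml; apply: eq_bigr => s _.
by rewrite conjcM /adj conjcK; ring.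
Qed.

Lemma nrm2D T (u v : T -> C) :
  nrm2 (fun t => u t + v t) = nrm2 u + nrm2 v + 2 * Re (inner u v).
Proof.
rewrite /nrm2 /inner Re_sum mulr_sumr -!big_split /=; apply: eq_bigr => t _.
by case: (u t) => a b; case: (v t) => c d; rewrite !sqnRI /=; ring.
Qed.
Lemma nrm2B T (u v : T -> C) :
  nrm2 (fun t => u t - v t) = nrm2 u + nrm2 v - 2 * Re (inner u v).
Proof.
rewrite /nrm2 /inner Re_sum mulr_sumr -!sumrN -!big_split /=; apply: eq_bigr => t _.
by case: (u t) => a b; case: (v t) => c d; rewrite !sqnRI /=; ring.
Qed.
Lemma nrm2Z T (a : C) (v : T -> C) : nrm2 (fun t => a * v t) = sqn a * nrm2 v.
Proof. by rewrite /nrm2 mulr_sumr; apply: eq_bigr => t _; rewrite sqnM. Qed.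

Lemma quad_disc (a b c : R) : 0 <= a ->
  (forall x : R, 0 <= a * x ^+ 2 - 2 * b * x + c) -> b ^+ 2 <= a * c.
Proof.
rewrite le_eqVlt => /orP[/eqP a0|a0] h.
  have [->|b0] := eqVneq b 0; first by rewrite -a0 expr2 !mul0r.
  (* With leading coefficient 0 the polynomial is affine, and at this point it takes the value
     -1. *)
  have := h ((c + 1) / (2 * b)); rewrite -a0.
  have -> : 0 * ((c + 1) / (2 * b)) ^+ 2 - 2 * b * ((c + 1) / (2 * b)) + c = -1.
    by field.
  by rewrite oppr_ge0 ler10.
have := h (b / a).
have -> : a * (b / a) ^+ 2 - 2 * b * (b / a) + c = (a * c - b ^+ 2) / a.
  by field; rewrite gt_eqF.
by rewrite pmulr_lge0 ?invr_gt0 // subr_ge0.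
Qed.

Lemma CS2 T (u v : T -> C) : (Re (inner u v)) ^+ 2 <= nrm2 u * nrm2 v.
Proof.
apply: quad_disc; first exact: nrm2_ge0.
move=> x.
have := nrm2_ge0 (fun t => (x%:C * u t) - v t).
rewrite nrm2B nrm2Z sqnC.
have -> : Re (inner (fun t => x%:C * u t) v) = x * Re (inner u v).
  rewrite -Re_rM /inner mulr_sumr; congr Re; apply: eq_bigr => t _.
  by rewrite conjcM conjc_rc mulrA.
by move=> h; apply: le_trans h _; rewrite le_eqVlt; apply/orP; left; apply/eqP; ring.
Qed.

Lemma CS T (u v : T -> C) : `|Re (inner u v)| <= Num.sqrt (nrm2 u) * Num.sqrt (nrm2 v).
Proof.
rewrite -sqrtrM ?nrm2_ge0 // -sqrtr_sqr ler_wsqrtr //; exact: CS2.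
Qed.

(** Scaling [u] by the inner product [z] itself makes the inner product real, so that [CS2] captures
    the modulus and not only the real part. *)
Lemma CS_sqn T (u v : T -> C) : sqn (inner u v) <= nrm2 u * nrm2 v.
Proof.
set z := inner u v.
have [z0|z0] := eqVneq (sqn z) 0; first by rewrite z0 mulr_ge0 ?nrm2_ge0.
have zp : 0 < sqn z by rewrite lt_def z0 sqn_ge0.
have := CS2 (fun t => z * u t) v.
rewrite nrm2Z.
have -> : inner (fun t => z * u t) v = (sqn z)%:C.
  rewrite -sqnE mulrC -[RHS]/(conjc z * inner u v) /inner mulr_sumr; apply: eq_bigr => t _.
  by rewrite conjcM mulrA.
by rewrite ReC expr2 -mulrA ler_pM2l.
Qed.

Lemma nrm2_triangle T (u v : T -> C) :
  Num.sqrt (nrm2 (fun t => u t + v t)) <= Num.sqrt (nrm2 u) + Num.sqrt (nrm2 v).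
Proof.
have h0 : 0 <= Num.sqrt (nrm2 u) + Num.sqrt (nrm2 v) by rewrite addr_ge0 ?sqrtr_ge0.
rewrite -(ger0_norm h0) -sqrtr_sqr ler_wsqrtr // nrm2D sqrrD !sqr_sqrtr ?nrm2_ge0 //.
have := le_trans (ler_norm _) (CS u v).
by rewrite -mulr_natl; lra.
Qed.

(** With w the adjoint applied to v, |w|^2 = <v, A w> <= |v| |A w| <= |v| |w|. *)
Lemma contr_adj U T (A : U -> T -> C) : contr A -> contr (adj A).
Proof.
move=> cA v; set w := ap (adj A) v.
have e : nrm2 w = Re (inner v (ap A w)) by rewrite inner_adj -/w inner_nrm2.
have h := CS2 v (ap A w); rewrite -e in h.
have := le_trans h (ler_wpM2l (nrm2_ge0 v) (cA w)).
have [->|w0] := eqVneq (nrm2 w) 0; first by rewrite nrm2_ge0.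
by rewrite expr2 ler_pM2r // lt_def w0 nrm2_ge0.
Qed.

Lemma nrm2J T (v : T -> C) : nrm2 (fun t => conjc (v t)) = nrm2 v.
Proof. by apply: eq_bigr => t _; rewrite sqnJ. Qed.

Lemma contr_conj U T (A : U -> T -> C) : contr A -> contr (fun u t => conjc (A u t)).
Proof.
move=> cA v; rewrite -[nrm2 v]nrm2J -nrm2J.
apply: le_trans (cA _); rewrite le_eqVlt; apply/orP; left; apply/eqP/eq_nrm2 => u.
by rewrite conjc_sum; apply: eq_bigr => t _; rewrite conjcM conjcK.
Qed.

Lemma contr_comp U V T (A : U -> V -> C) (B : V -> T -> C) :
  contr A -> contr B -> contr (fun u t => \sum_v A u v * B v t).
Proof.
move=> cA cB v; apply: le_trans (cB v); apply: le_trans (cA _).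
rewrite le_eqVlt; apply/orP; left; apply/eqP/eq_nrm2 => u; rewrite /ap.
under eq_bigr do rewrite mulr_suml.
rewrite exchange_big /=; apply: eq_bigr => s _; rewrite mulr_sumr.
by apply: eq_bigr => t _; rewrite mulrA.
Qed.

Lemma inner_sumr T I (P : pred I) (u : T -> C) (F : I -> T -> C) (a : I -> C) :
  inner u (fun t => \sum_(i | P i) a i * F i t) = \sum_(i | P i) a i * inner u (F i).
Proof.
rewrite /inner; under eq_bigr do rewrite mulr_sumr.
rewrite exchange_big /=; apply: eq_bigr => i _; rewrite mulr_sumr.
by apply: eq_bigr => t _; rewrite mulrCA.
Qed.

Lemma nrm2_comb I T (u : I -> T -> C) (P : pred I) (a : I -> C) : orthonormal u ->
  nrm2 (fun t => \sum_(i | P i) a i * u i t) = \sum_(i | P i) sqn (a i).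
Proof.
move=> ou; apply: (@complexI R); rewrite -inner_nrm2 inner_sumr rc_sum.
apply: eq_bigr => i Pi; rewrite -sqnE; congr (_ * _).
rewrite -innerJ inner_sumr; congr conjc.
rewrite (bigD1 i) //= ou eqxx mulr1 big1 ?addr0 // => k /andP[_ ki].
by rewrite ou eq_sym (negPf ki) mulr0.
Qed.

Lemma bessel I T (u : I -> T -> C) (P : pred I) (v : T -> C) : orthonormal u ->
  \sum_(i | P i) sqn (inner (u i) v) <= nrm2 v.
Proof.
move=> ou; set w := fun t => \sum_(i | P i) inner (u i) v * u i t.
have e : nrm2 w = \sum_(i | P i) sqn (inner (u i) v) by rewrite nrm2_comb.
have := nrm2_ge0 (fun t => v t - w t); rewrite nrm2B e.
have -> : Re (inner v w) = \sum_(i | P i) sqn (inner (u i) v).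
  rewrite inner_sumr Re_sum; apply: eq_bigr => i _.
  by rewrite -[inner v (u i)]innerJ sqnE.
by lra.
Qed.

End VectorCalculus.

(** * Spectral decompositions *)

Section Spectral.
Variable R : realType.
Local Notation C := R[i].
Local Notation "x %:C" := (real_complex R x).
Local Notation Re := (@complex.Re R).
Implicit Types (T U V I J : finType).

(** The index type [I] is free and the family [u] may be incomplete, the missing directions lying in
    the kernel. Pairs and sequences of indices can then label eigenvectors directly. *)
Definition spectral I T (A : op R T T) (u : I -> T -> C) (l : I -> R) : Prop :=
  orthonormal u /\ forall a b, A a b = \sum_c u c a * (l c)%:C * conjc (u c b).

(** For [N] read as the amplitudes of a bipartite vector this is the reduced state on [T];
    [gram (adj N)] is the complex conjugate of the reduced state on [U]. *)
Definition gram T U (N : T -> U -> C) : op R T T :=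
  fun a b => \sum_e N a e * conjc (N b e).

Lemma spectral_ap I T (A : op R T T) (u : I -> T -> C) (l : I -> R) v :
  spectral A u l -> ap A v =1 (fun a => \sum_c (l c)%:C * inner (u c) v * u c a).
Proof.
move=> [ou hA] a; rewrite /ap.
under eq_bigr do rewrite hA mulr_suml.
rewrite exchange_big /=; apply: eq_bigr => c _; rewrite /inner mulr_sumr mulr_suml.
by apply: eq_bigr => t _; ring.
Qed.

Lemma spectral_eig I T (A : op R T T) (u : I -> T -> C) (l : I -> R) c :
  spectral A u l -> ap A (u c) =1 (fun a => (l c)%:C * u c a).
Proof.
move=> hA a; rewrite (spectral_ap _ hA) (bigD1 c) //= hA.1 eqxx mulr1 big1 ?addr0 //.
by move=> d dc; rewrite hA.1 (negPf dc) mulr0 mul0r.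
Qed.

Lemma ap_gram T U (N : T -> U -> C) v : ap (gram N) v =1 ap N (ap (adj N) v).
Proof.
move=> a; rewrite /ap /gram; under eq_bigr do rewrite mulr_suml.
rewrite exchange_big /=; apply: eq_bigr => e _; rewrite mulr_sumr.
by apply: eq_bigr => t _; rewrite /adj mulrA.
Qed.

Lemma adjK T U (N : T -> U -> C) : adj (adj N) = N.
Proof. by apply/funext => a; apply/funext => b; rewrite /adj conjcK. Qed.

Lemma spectral_gram_eig I T U (N : T -> U -> C) (u : I -> T -> C) l c :
  spectral (gram N) u l -> l c = nrm2 (ap (adj N) (u c)).
Proof.
move=> hA; apply: (@complexI R); rewrite -inner_nrm2 -inner_adj.
rewrite -(eq_inner (fun _ => erefl) (@ap_gram _ _ N (u c))) (eq_inner (fun _ => erefl) (spectral_eig c hA)).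
rewrite /inner; under eq_bigr do rewrite mulrCA.
by rewrite -mulr_sumr -/(inner (u c) (u c)) hA.1 eqxx mulr1.
Qed.

Lemma spectral_gram_ge0 I T U (N : T -> U -> C) (u : I -> T -> C) l c :
  spectral (gram N) u l -> 0 <= l c.
Proof. by move=> h; rewrite (spectral_gram_eig c h) nrm2_ge0. Qed.

Lemma spectral_trace I T U (N : T -> U -> C) (u : I -> T -> C) l :
  spectral (gram N) u l -> \sum_c l c = \sum_t nrm2 (N t).
Proof.
move=> hA; apply: (@complexI R); rewrite !rc_sum.
transitivity (\sum_t gram N t t).
  under [RHS]eq_bigr do rewrite hA.2.
  rewrite exchange_big /=; apply: eq_bigr => c _.
  transitivity ((l c)%:C * inner (u c) (u c)); first by rewrite hA.1 eqxx mulr1.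
  by rewrite /inner mulr_sumr; apply: eq_bigr => t _; ring.
apply: eq_bigr => t _; rewrite -inner_nrm2 /gram /inner; apply: eq_bigr => e _.
by rewrite mulrC.
Qed.

Lemma inner_gram T U (N : T -> U -> C) w v :
  inner w (ap (gram N) v) = inner (ap (adj N) w) (ap (adj N) v).
Proof. by rewrite (eq_inner (fun _ => erefl) (ap_gram N v)) inner_adj. Qed.

Lemma innerZr T (a : C) (w v : T -> C) : inner w (fun t => a * v t) = a * inner w v.
Proof. by rewrite /inner mulr_sumr; apply: eq_bigr => t _; rewrite mulrCA. Qed.
Lemma innerZl T (a : C) (w v : T -> C) : inner (fun t => a * w t) v = conjc a * inner w v.
Proof. by rewrite -innerJ innerZr conjcM innerJ. Qed.
Lemma apZ T U (N : T -> U -> C) (a : C) v t : ap N (fun s => a * v s) t = a * ap N v t.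
Proof. by rewrite /ap mulr_sumr; apply: eq_bigr => s _; rewrite mulrCA. Qed.

Section Dual.
Variables (I J T U : finType) (N : T -> U -> C).
Variables (u : I -> T -> C) (l : I -> R) (v : J -> U -> C) (l' : J -> R).
Hypothesis hu : spectral (gram N) u l.
Hypothesis hv : spectral (gram (adj N)) v l'.
Let W a b : C := inner (ap (adj N) (u a)) (v b).

Lemma dual_eig a b : (l' b)%:C * W a b = (l a)%:C * W a b.
Proof.
set x := ap (adj N) (u a).
transitivity (inner x (ap (gram (adj N)) (v b))).
  by rewrite (eq_inner (fun _ => erefl) (spectral_eig b hv)) innerZr.
rewrite inner_gram adjK (eq_inner (fun t => esym (ap_gram N (u a) t)) (fun _ => erefl)).
by rewrite (eq_inner (spectral_eig a hu) (fun _ => erefl)) innerZl conjc_rc inner_adj.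
Qed.

(** Bessel alone gives an inequality, as [v] may be incomplete. For [l a != 0] the image of [u a] is
    an eigenvector of [gram (adj N)], hence is reached by the spectral expansion, which gives
    equality; for [l a = 0] Bessel suffices. *)
Lemma dual_sum a : \sum_b sqn (W a b) = l a.
Proof.
set x := ap (adj N) (u a).
have nx : nrm2 x = l a by rewrite (spectral_gram_eig a hu).
have Wx b : inner (v b) x = conjc (W a b) by rewrite innerJ.
have [la0|la0] := eqVneq (l a) 0.
  apply/eqP; rewrite eq_le; apply/andP; split; last first.
    by rewrite la0 sumr_ge0 // => b _; exact: sqn_ge0.
  rewrite -nx; under eq_bigr do rewrite -sqnJ -Wx.
  exact: (bessel _ _ hv.1).
apply: (mulfI la0); rewrite mulr_sumr -[X in _ = l a * X]nx; apply: (@complexI R).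
rewrite [RHS]rcM -inner_nrm2 rc_sum.
have gx : ap (gram (adj N)) x =1 (fun t => (l a)%:C * x t).
  move=> t; rewrite ap_gram adjK.
  rewrite (eq_ap (fun _ _ => erefl) (fun t => esym (ap_gram N (u a) t))).
  by rewrite (eq_ap (fun _ _ => erefl) (spectral_eig a hu)) apZ.
rewrite -[RHS](innerZr (l a)%:C x x) -(eq_inner (fun _ => erefl) gx).
rewrite (eq_inner (fun _ => erefl) (spectral_ap x hv)) inner_sumr.
apply: eq_bigr => b _; rewrite Wx -[inner x (v b)]/(W a b) rcM -sqnE mulrAC dual_eig.
by rewrite mulrA.
Qed.
End Dual.

(** The squared overlaps of the images of the [u a] with the [v b] couple the two spectra: their row
    and column sums are [l] and [l'], and they vanish unless [l a = l' b]. Eigenvectors need not be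
    matched, whatever the multiplicities. *)
Lemma dual_spectra I J T U (N : T -> U -> C) (u : I -> T -> C) l (v : J -> U -> C) l'
  (f : R -> R) : spectral (gram N) u l -> spectral (gram (adj N)) v l' ->
  \sum_a l a * f (l a) = \sum_b l' b * f (l' b).
Proof.
move=> hu hv.
have hu' : spectral (gram (adj (adj N))) u l by rewrite adjK.
under eq_bigr do rewrite -[X in X * _](dual_sum hu hv) mulr_suml.
rewrite exchange_big /=; apply: eq_bigr => b _.
rewrite -[X in X * _](dual_sum hv hu') mulr_suml; apply: eq_bigr => a _.
rewrite -inner_adj -sqnJ innerJ adjK; set w := inner (ap N (v b)) (u a).
have [w0|w0] := eqVneq w 0; first by rewrite w0 sqn0 !mul0r.
congr (_ * f _); apply: (@complexI R); apply: (mulIf w0).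
have h := dual_eig hv hu' b a; rewrite adjK in h. move: h; rewrite -/w. exact.
Qed.

End Spectral.

(** * Functional calculus, fidelity and entropy of Gram operators *)

Section FunctionalCalculus.
Variable R : realType.
Local Notation C := R[i].
Local Notation "x %:C" := (real_complex R x).
Local Notation Re := (@complex.Re R).
Implicit Types (T U V I J : finType).

Lemma conjCE (z : C) : Num.conj z = conjc z.
Proof. by []. Qed.

Lemma sum_enum_rank T (F : 'I_#|T| -> C) : \sum_i F i = \sum_t F (enum_rank t).
Proof.
rewrite (reindex_onto (@enum_rank T) (@enum_val T _)) /=; last by move=> i _; rewrite enum_valK.
by apply: eq_bigl => t; rewrite enum_rankK eqxx.
Qed.

Lemma hermitian_eigdec T (A : op R T T) : (forall a b, A b a = conjc (A a b)) ->
  exists Ul : op R T T * (T -> R), eigdec A Ul.1 Ul.2.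
Proof.
move=> hA; pose n := #|T|.
pose M : 'M[C]_n := \matrix_(i, j) A (enum_val i) (enum_val j).
have hM : M \is hermsymmx.
  apply/is_hermitianmxP; rewrite expr0 scale1r; apply/matrixP => i j.
  by rewrite !mxE hA.
have /orthomx_spectralP := hermitian_normalmx hM.
have uP := spectral_unitarymx M.
have rd := hermitian_spectral_diag_real hM.
rewrite invmx_unitary //.
set P := spectralmx M in uP *; set d := spectral_diag M in rd * => eM.
have uP' : map_mx Num.conj P^T *m P = 1%:M by rewrite -invmx_unitary // mulVmx // spectral_unit.
exists (fun a c => conjc (P (enum_rank c) (enum_rank a)), fun c => Re (d 0 (enum_rank c))).
split=> /= a b.
  have /matrixP /(_ (enum_rank a) (enum_rank b)) := unitarymxP uP.
  rewrite !mxE (inj_eq enum_rank_inj) /idop /opmul /adj => <-.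
  rewrite sum_enum_rank.
  by apply: eq_bigr => t _; rewrite !mxE conjcK conjCE.
have /matrixP /(_ (enum_rank a) (enum_rank b)) := eM.
rewrite !mxE !enum_rankK => ->.
rewrite sum_enum_rank.
apply: eq_bigr => t _; rewrite mul_mx_diag !mxE conjCE conjcK; congr (_ * _ * _).
by rewrite RRe_real //; move/mxOverP: rd; apply.
Qed.

Lemma eigdec_spectral T (A W : op R T T) l :
  eigdec A W l -> spectral A (fun c a => W a c) l.
Proof. by move=> [hU hA]; split=> // a b; have := hU a b; rewrite /opmul /adj /idop. Qed.

Lemma hermitian_spectral T (A : op R T T) : (forall a b, A b a = conjc (A a b)) ->
  exists (u : T -> T -> C) (l : T -> R), spectral A u l.
Proof.
by move=> /hermitian_eigdec [[U l] /eigdec_spectral h]; exists (fun c a => U a c), l.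
Qed.

(** [fcalc] fixes some decomposition by choice; it is handed out as it is, and the later arguments
    work for whichever one was chosen. *)
Lemma fcalcP T (A : op R T T) : (forall a b, A b a = conjc (A a b)) ->
  forall f, exists (u : T -> T -> C) (l : T -> R), spectral A u l /\
  fcalc f A = fun a b => \sum_c u c a * (f (l c))%:C * conjc (u c b).
Proof.
move=> /hermitian_eigdec hA f; rewrite /fcalc; case: pselect => // h.
case: (cid h) => -[U l] /= /eigdec_spectral hUl.
by exists (fun c a => U a c), l.
Qed.

Lemma gram_herm T U (N : T -> U -> C) a b : gram N b a = conjc (gram N a b).
Proof. by rewrite /gram conjc_sum; apply: eq_bigr => e _; rewrite conjcM conjcK mulrC. Qed.

Lemma tr_spectral I T (u : I -> T -> C) (l : I -> R) : orthonormal u ->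
  tr (fun a b => \sum_c u c a * (l c)%:C * conjc (u c b)) = (\sum_c l c)%:C.
Proof.
move=> ou; rewrite /tr exchange_big rc_sum /=; apply: eq_bigr => c _.
transitivity ((l c)%:C * inner (u c) (u c)); last by rewrite ou eqxx mulr1.
by rewrite /inner mulr_sumr; apply: eq_bigr => t _; ring.
Qed.

Lemma spectral_mul I T (u : I -> T -> C) (l l' : I -> R) a b : orthonormal u ->
  \sum_d (\sum_c u c a * (l c)%:C * conjc (u c d)) * (\sum_c u c d * (l' c)%:C * conjc (u c b))
  = \sum_c u c a * (l c * l' c)%:C * conjc (u c b).
Proof.
move=> ou.
under eq_bigr => d _. under eq_bigr do rewrite mulrC.
  rewrite mulr_suml; under eq_bigr do rewrite mulr_sumr. over.
rewrite exchange_big /=; apply: eq_bigr => c _.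
rewrite exchange_big (bigD1 c) //= [X in _ + X]big1 ?addr0.
  transitivity (u c a * (l c)%:C * ((l' c)%:C * conjc (u c b)) * inner (u c) (u c)).
    by rewrite /inner mulr_sumr; apply: eq_bigr => d _; ring.
  by rewrite ou eqxx mulr1 rcM; ring.
move=> e ec.
transitivity (u c a * (l c)%:C * ((l' e)%:C * conjc (u e b)) * inner (u c) (u e)).
  by rewrite /inner mulr_sumr; apply: eq_bigr => d _; ring.
by rewrite ou eq_sym (negPf ec) mulr0.
Qed.

Definition hs2 T U (A : T -> U -> C) : R := \sum_t nrm2 (A t).

Lemma hs2_ge0 T U (A : T -> U -> C) : 0 <= hs2 A.
Proof. by apply: sumr_ge0 => t _; exact: nrm2_ge0. Qed.

Lemma sqrt_sum_le I (P : pred I) (l : I -> R) : (forall i, 0 <= l i) ->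
  Num.sqrt (\sum_(i | P i) l i) <= \sum_(i | P i) Num.sqrt (l i).
Proof.
move=> l0; pose K (x y : R) := 0 <= x /\ Num.sqrt x <= y.
have: K (\sum_(i | P i) l i) (\sum_(i | P i) Num.sqrt (l i)).
  apply: (big_ind2 K); rewrite /K ?sqrtr0 //.
  move=> x1 x2 y1 y2 [h1 h2] [h3 h4]; split; first exact: addr_ge0.
  apply: le_trans (lerD h2 h4).
  have h0 : 0 <= Num.sqrt x1 + Num.sqrt y1 by rewrite addr_ge0 ?sqrtr_ge0.
  rewrite -(ger0_norm h0) -sqrtr_sqr ler_wsqrtr // sqrrD !sqr_sqrtr //.
  have : 0 <= Num.sqrt x1 * Num.sqrt y1 by rewrite mulr_ge0 ?sqrtr_ge0.
  rewrite -mulr_natl; lra.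
by case.
Qed.

(** The trace norm is the sum of the singular values, the Hilbert-Schmidt norm the root of the sum
    of their squares; subadditivity of the root compares the two. *)
Lemma trnorm_ge T U (A : op R U T) : Num.sqrt (hs2 A) <= trnorm A.
Proof.
rewrite /trnorm; set B := opmul (adj A) A.
have eB : B = gram (adj A).
  apply/funext => a; apply/funext => b; rewrite /B /opmul /gram; apply: eq_bigr => e _.
  by rewrite /adj conjcK.
have [|u [l [hl ->]]] := @fcalcP _ B _ Num.sqrt.
  by rewrite eB; exact: gram_herm.
rewrite tr_spectral ?hl.1 //; last exact: hl.1.
rewrite ReC; rewrite eB in hl.
have -> : hs2 A = \sum_c l c.
  rewrite (spectral_trace hl) /hs2 /nrm2 exchange_big /=; apply: eq_bigr => t _.
  by apply: eq_bigr => s _; rewrite /adj sqnJ.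
by apply: sqrt_sum_le => i; exact: spectral_gram_ge0 hl.
Qed.

Definition expval T (G : T -> C) (A : op R T T) : R := Re (inner G (ap A G)).

Lemma expval_gram T U (G : T -> C) (N : T -> U -> C) : expval G (gram N) = nrm2 (ap (adj N) G).
Proof. by rewrite /expval inner_gram inner_nrm2. Qed.

Lemma fcalc_sqrt_gram T V (M : T -> V -> C) :
  adj (fcalc Num.sqrt (gram M)) = fcalc Num.sqrt (gram M) /\
  gram (fcalc Num.sqrt (gram M)) = gram M.
Proof.
have [u [l [hl ->]]] := fcalcP (gram_herm M) Num.sqrt.
set s := fun a b => _.
have hs : adj s = s.
  apply/funext => a; apply/funext => b; rewrite /adj /s conjc_sum; apply: eq_bigr => c _.
  by rewrite !conjcM conjcK conjc_rc; ring.
split=> //; apply/funext => a; apply/funext => b; rewrite /gram.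
transitivity (\sum_e s a e * s e b); first by apply: eq_bigr => e _; congr (_ * _); rewrite -[in RHS]hs.
rewrite /s spectral_mul; last exact: hl.1.
rewrite -/(gram M a b) hl.2; apply: eq_bigr => c _; rewrite -expr2 sqr_sqrtr //.
exact: spectral_gram_ge0 hl.
Qed.

(** With [proj G] on one side, the product of the two roots has squared Hilbert-Schmidt norm <G,
    sigma G>. This expectation, unlike the fidelity, is additive over measurement outcomes, and
    protocols are evaluated through it. *)
Lemma fidelity_ge T U (G : T -> C) (N : T -> U -> C) :
  Num.sqrt (expval G (gram N)) <= fidelity (proj G) (gram N).
Proof.
rewrite /fidelity; apply: le_trans (trnorm_ge _); rewrite ler_wsqrtr //.
have eP : proj G = gram (fun a (_ : unit) => G a).
  apply/funext => a; apply/funext => b; rewrite /gram /proj /=.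
  by rewrite (big_pred1 tt) //; case.
rewrite eP; have [hs ss] := fcalc_sqrt_gram (fun a (_ : unit) => G a).
have [ht tt'] := fcalc_sqrt_gram N.
set s := fcalc _ _ in hs ss *; set t := fcalc _ _ in ht tt' *.
rewrite -tt' expval_gram le_eqVlt; apply/orP; left; apply/eqP.
rewrite /hs2 /nrm2 exchange_big /=; apply: eq_bigr => j _.
transitivity (nrm2 (ap (adj s) (fun e => t e j))); last by rewrite hs.
rewrite -expval_gram ss expval_gram /nrm2 (big_pred1 tt); last by case.
rewrite /ap -sqnJ conjc_sum; congr sqn; apply: eq_bigr => e _.
by rewrite conjcM /adj conjcK mulrC.
Qed.

(** The state whose entropy is taken lives on the other side of the bipartite vector [N];
    [dual_spectra] reads its entropy off a spectrum on [T]. *)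
Lemma entropy_gram I T U (N : T -> U -> C) (u : I -> T -> C) (l : I -> R) :
  spectral (gram N) u l ->
  entropy (fun a b => \sum_r N r a * conjc (N r b)) = - \sum_c l c * log2 (l c).
Proof.
move=> hu; pose B : op R U U := gram (fun a r => N r a).
rewrite -/(gram (fun a r => N r a)) -/B /entropy.
have [v [l' [hl' ->]]] := @fcalcP _ B (gram_herm _) (fun x => if x == 0 then 0 else x * log2 x).
rewrite tr_spectral; last exact: hl'.1.
rewrite ReC; congr (- _).
(* [gram (adj N)] is the transpose of [B], whence the conjugated eigenvectors. *)
pose v' c a := conjc (v c a).
have hv : spectral (gram (adj N)) v' l'.
  split=> a b.
    have := hl'.1 b a; rewrite /inner eq_sym => <-; apply: eq_bigr => t _.
    by rewrite /v' conjcK mulrC.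
  have := hl'.2 b a; rewrite /B => e.
  transitivity (gram (fun a r => N r a) b a).
    by apply: eq_bigr => r _; rewrite /adj conjcK mulrC.
  by rewrite e; apply: eq_bigr => c _; rewrite /v' conjcK; ring.
rewrite (dual_spectra (@log2 R) hu hv); apply: eq_bigr => b _.
by case: eqVneq => [->|]; rewrite ?mul0r.
Qed.
End FunctionalCalculus.

(** * Uhlmann's theorem *)

Section Uhlmann.
Variable R : realType.
Local Notation C := R[i].
Local Notation "x %:C" := (real_complex R x).
Local Notation Re := (@complex.Re R).
Implicit Types (T U V I J : finType).

Lemma nrm2_comb_weighted I T (u : I -> T -> C) (p : I -> R) (a : I -> C) :
  (forall i j, inner (u i) (u j) = (i == j)%:R * (p i)%:C) ->
  nrm2 (fun t => \sum_i a i * u i t) = \sum_i sqn (a i) * p i.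
Proof.
move=> ou; apply: (@complexI R); rewrite -inner_nrm2 inner_sumr rc_sum.
apply: eq_bigr => i _; rewrite rcM -sqnE -mulrA; congr (_ * _).
rewrite -innerJ inner_sumr.
rewrite (bigD1 i) //= ou eqxx mul1r big1 ?addr0; last first.
  by move=> k ki; rewrite ou eq_sym (negPf ki) mul0r mulr0.
by rewrite conjcM conjc_rc.
Qed.

Lemma inner_suml T I (P : pred I) (v : T -> C) (F : I -> T -> C) (a : I -> C) :
  inner (fun t => \sum_(i | P i) a i * F i t) v = \sum_(i | P i) conjc (a i) * inner (F i) v.
Proof.
rewrite -innerJ inner_sumr conjc_sum; apply: eq_bigr => i _.
by rewrite conjcM innerJ.
Qed.

Lemma inner_spectral I T (A : op R T T) (u : I -> T -> C) (l : I -> R) v w :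
  spectral A u l -> inner w (ap A v) = \sum_c (l c)%:C * inner (u c) v * inner w (u c).
Proof.
by move=> h; rewrite (eq_inner (fun _ => erefl) (spectral_ap v h)) inner_sumr.
Qed.

(** [s] is the root of [gram M] and [W] the partial isometry of the polar decomposition, arranged so
    that s is M times the adjoint of W. Both are assembled from the eigenvectors of [gram M]. *)
Lemma polar T U (M : T -> U -> C) : exists (s : op R T T) (W : op R T U),
  [/\ adj s = s, gram s = gram M, contr W, forall v, 0 <= Re (inner v (ap s v)) &
      forall r r', s r r' = \sum_q M r q * conjc (W r' q)].
Proof.
have [u [l hl]] := hermitian_spectral (gram_herm M).
have l0 c : 0 <= l c by exact: spectral_gram_ge0 hl.
pose s : op R T T := fun a b => \sum_c u c a * (Num.sqrt (l c))%:C * conjc (u c b).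
have hs : spectral s u (fun c => Num.sqrt (l c)) by split; [exact: hl.1|].
(* The inverse of 0 is 0, so kernel vectors drop out of [W], which stays a contraction. *)
pose k c := (Num.sqrt (l c))^-1.
pose om c q := (k c)%:C * \sum_r conjc (u c r) * M r q.
pose W r q := \sum_c u c r * om c q.
have omE c d : inner (fun q => conjc (om d q)) (fun q => conjc (om c q)) =
   (d == c)%:R * (k d * k d * l d)%:C.
  transitivity ((k d)%:C * (k c)%:C * inner (ap (adj M) (u d)) (ap (adj M) (u c))).
    rewrite /inner mulr_sumr; apply: eq_bigr => q _; rewrite conjcK /om.
    have e a : \sum_r conjc (u a r) * M r q = conjc (ap (adj M) (u a) q).
      by rewrite conjc_sum; apply: eq_bigr => r _; rewrite conjcM conjcK mulrC.
    by rewrite !e conjcM conjc_rc conjcK; ring.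
  rewrite -inner_gram (eq_inner (fun _ => erefl) (spectral_eig c hl)) innerZr hl.1.
  by case: eqVneq => [->|_]; rewrite ?mul0r ?mulr0 // !rcM; ring.
exists s, W; split.
- apply/funext => a; apply/funext => b; rewrite /adj /s conjc_sum; apply: eq_bigr => c _.
  by rewrite !conjcM conjcK conjc_rc; ring.
- apply/funext => a; apply/funext => b; rewrite hl.2 /gram.
  transitivity (\sum_d s a d * s d b).
    apply: eq_bigr => e _; congr (_ * _); rewrite /s conjc_sum; apply: eq_bigr => c _.
    by rewrite !conjcM conjcK conjc_rc; ring.
  rewrite /s spectral_mul; last exact: hl.1.
  by apply: eq_bigr => c _; rewrite -expr2 sqr_sqrtr.
- rewrite -[W]adjK; apply: contr_adj => y.
  have -> : nrm2 (ap (adj W) y) = \sum_c sqn (inner (u c) y) * (k c * k c * l c).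
    rewrite -(nrm2_comb_weighted _ (fun d c => omE c d)); apply: eq_nrm2 => q.
    rewrite /ap /adj /inner; under eq_bigr do rewrite conjc_sum mulr_suml.
    rewrite exchange_big /=; apply: eq_bigr => c _; rewrite mulr_suml.
    by apply: eq_bigr => r _; rewrite conjcM; ring.
  apply: le_trans (bessel xpredT y hl.1); apply: ler_sum => c _.
  apply: ler_piMr; first exact: sqn_ge0.
  rewrite /k -invfM -expr2 sqr_sqrtr //.
  by have [->|lc] := eqVneq (l c) 0; rewrite ?mulr0 // mulVf.
- move=> v; rewrite (inner_spectral _ _ hs) Re_sum; apply: sumr_ge0 => c _.
  by rewrite -mulrA -[inner v _]innerJ sqnE -rcM ReC mulr_ge0 ?sqrtr_ge0 ?sqn_ge0.
- move=> a b; rewrite /s /W.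
  under [RHS]eq_bigr do rewrite conjc_sum mulr_sumr.
  rewrite exchange_big /=; apply: eq_bigr => c _.
  transitivity ((k c)%:C * conjc (u c b) * ap (gram M) (u c) a); last first.
    rewrite ap_gram /ap !mulr_sumr; apply: eq_bigr => q _.
    rewrite /om !conjcM conjc_rc.
    have -> : conjc (\sum_r conjc (u c r) * M r q) = ap (adj M) (u c) q.
      by rewrite conjc_sum; apply: eq_bigr => r _; rewrite conjcM conjcK mulrC.
    by rewrite /ap; ring.
  rewrite (spectral_eig c hl).
  suff -> : Num.sqrt (l c) = k c * l c by rewrite rcM; ring.
  rewrite /k; have [->|lc] := eqVneq (l c) 0; first by rewrite sqrtr0 mulr0.
  by rewrite -{3}(sqr_sqrtr (l0 c)) expr2 mulrA mulVf ?mul1r // sqrtr_eq0 -ltNge lt_def lc l0.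
Qed.

Lemma hs2_gram T U V (M : T -> U -> C) (N : T -> V -> C) : gram M = gram N -> hs2 M = hs2 N.
Proof.
move=> e; apply: eq_bigr => t _; apply: (@complexI R); rewrite -!inner_nrm2.
transitivity (gram M t t); first by apply: eq_bigr => q _; rewrite mulrC.
by rewrite e; apply: eq_bigr => q _; rewrite mulrC.
Qed.

Lemma Re_innerC T (u v : T -> C) : Re (inner u v) = Re (inner v u).
Proof. by rewrite -innerJ Re_conjc. Qed.

Lemma hs2B T U (A B : T -> U -> C) :
  hs2 (fun t q => A t q - B t q) = hs2 A + hs2 B - 2 * Re (\sum_t inner (B t) (A t)).
Proof.
rewrite /hs2 Re_sum mulr_sumr -sumrN -!big_split /=; apply: eq_bigr => t _.
by rewrite nrm2B (Re_innerC (A t)).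
Qed.

Lemma hs2_spectral I T (A : op R T T) (u : I -> T -> C) (l : I -> R) :
  spectral A u l -> hs2 A = \sum_c l c ^+ 2.
Proof.
move=> h; rewrite /hs2.
transitivity (\sum_t \sum_c sqn (u c t) * l c ^+ 2).
  apply: eq_bigr => t _.
  have ou' : orthonormal (fun c q => conjc (u c q)).
    move=> a b; rewrite -conjc_natr -h.1 /inner conjc_sum; apply: eq_bigr => q _.
    by rewrite conjcM.
  transitivity (nrm2 (fun q => \sum_c u c t * (l c)%:C * conjc (u c q))).
    by apply: eq_nrm2 => q; rewrite h.2.
  by rewrite (nrm2_comb _ _ ou'); apply: eq_bigr => c _; rewrite sqnM sqnC.
rewrite exchange_big /=; apply: eq_bigr => c _; rewrite -mulr_suml.
suff -> : \sum_t sqn (u c t) = 1 by rewrite mul1r.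
by apply: (@complexI R); rewrite -[\sum_t _]/(nrm2 (u c)) -inner_nrm2 h.1 eqxx.
Qed.

(* Powers-Stormer: [tr sgn(s-t) (s^2-t^2) >= |s-t|_2^2], combined with the polar
   decompositions of [M] and [N]. *)
Lemma uhlmann T U V (M : T -> U -> C) (N : T -> V -> C) :
  exists (D : op R V U) (H : op R T T), [/\ contr D, contr H &
  (hs2 M + hs2 N - Re (\sum_r \sum_r' H r' r * (gram M r r' - gram N r r'))) / 2
    <= Re (\sum_r inner (N r) (ap D (M r)))].
Proof.
have [s [W [hs ss cW ps sW]]] := polar M.
have [t [W' [ht tt' cW' pt tW]]] := polar N.
(* By the polar identities for [M] and [N] this choice turns the overlap into tr(t s). *)
pose D q' q := \sum_r W' r q' * conjc (W r q).
have cD : contr D.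
  apply: (@contr_comp _ _ _ _ (fun q' r => W' r q') (fun r q => conjc (W r q))).
    have -> : (fun q' r => W' r q') = (fun q' r => conjc (adj W' q' r)).
      by apply/funext => q'; apply/funext => r; rewrite /adj conjcK.
    exact: contr_conj (contr_adj cW').
  exact: contr_conj.
pose S : op R T T := fun a b => s a b - t a b.
have hS a b : S b a = conjc (S a b) by rewrite /S conjcB -[in LHS]hs -[in LHS]ht.
have [w [mu hw]] := hermitian_spectral hS.
pose H a b := \sum_c w c a * (Num.sg (mu c))%:C * conjc (w c b).
have hH : spectral H w (fun c => Num.sg (mu c)) by split; [exact: hw.1|].
exists D, H; split=> //.
  move=> v; rewrite (eq_nrm2 (spectral_ap v hH)) (nrm2_comb _ _ hw.1).
  apply: le_trans (bessel xpredT v hw.1); apply: ler_sum => c _; rewrite sqnM sqnC.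
  apply: ler_piMl; first exact: sqn_ge0.
  by rewrite sqr_sg; case: (_ != _).
have cross : \sum_r inner (N r) (ap D (M r)) = \sum_r inner (t r) (s r).
  apply: eq_bigr => r _; rewrite /inner.
  transitivity (\sum_q' \sum_r' \sum_q conjc (N r q') * W' r' q' * (conjc (W r' q) * M r q)).
    apply: eq_bigr => q' _; rewrite /ap mulr_sumr /D exchange_big /=; apply: eq_bigr => q _.
    by rewrite mulr_suml mulr_sumr; apply: eq_bigr => r' _; ring.
  rewrite exchange_big /=; apply: eq_bigr => r' _.
  rewrite sW tW conjc_sum mulr_suml; apply: eq_bigr => q' _.
  by rewrite mulr_sumr; apply: eq_bigr => q _; rewrite conjcM conjcK; ring.
rewrite cross -(hs2_gram ss) -(hs2_gram tt') -ss -tt'.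
(* Since |s - t|^2 = |s|^2 + |t|^2 - 2 Re tr(t s), a lower bound on the overlap is an upper bound on
   |s - t|^2, that is, on the sum of the squared [mu c]. *)
have := hs2B s t; rewrite -/S (hs2_spectral hw) => e.
suff : \sum_c mu c ^+ 2 <= Re (\sum_r \sum_r' H r' r * (gram s r r' - gram t r r')) by lra.
have -> : \sum_r \sum_r' H r' r * (gram s r r' - gram t r r') =
   \sum_c (Num.sg (mu c))%:C * (inner (w c) (ap (gram s) (w c)) - inner (w c) (ap (gram t) (w c))).
  under eq_bigr => r _. under eq_bigr do rewrite mulr_suml. rewrite exchange_big /=. over.
  rewrite exchange_big /=; apply: eq_bigr => c _.
  rewrite /inner /ap -sumrB mulr_sumr; apply: eq_bigr => r _.
  rewrite -mulrBr -sumrB !mulr_sumr; apply: eq_bigr => r' _.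
  ring.
rewrite Re_sum; apply: ler_sum => c _; rewrite Re_rM !inner_gram hs ht !inner_nrm2 ReB !ReC.
have sE : ap s (w c) =1 (fun r => ap t (w c) r + (mu c)%:C * w c r).
  move=> r; rewrite -(spectral_eig c hw) /ap -big_split /=; apply: eq_bigr => q _.
  by rewrite /S; ring.
have n1 : nrm2 (w c) = 1 by apply: (@complexI R); rewrite -inner_nrm2 hw.1 eqxx.
have e1 : inner (w c) (ap s (w c)) = inner (w c) (ap t (w c)) + (mu c)%:C.
  rewrite (eq_inner (fun _ => erefl) sE).
  transitivity (inner (w c) (ap t (w c)) + inner (w c) (fun r => (mu c)%:C * w c r)).
    2: by rewrite innerZr hw.1 eqxx mulr1.
  by rewrite /inner -big_split /=; apply: eq_bigr => r _; rewrite mulrDr.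
have := ps (w c); rewrite e1 ReD ReC.
have := pt (w c); set x := Re (inner _ _) => x0 xm.
rewrite (eq_nrm2 sE) nrm2D nrm2Z sqnC n1 innerZr Re_rM.
rewrite (Re_innerC _ (w c)) -/x.
(* The difference of squared norms is 2 mu x + mu^2 with x = <w, t w>. Positivity of [t] settles mu
   > 0; positivity of [s], in the form x + mu >= 0, settles mu < 0. *)
have [m0|m0|->] := ltrgt0P (mu c); last by rewrite sgr0; lra.
- by rewrite gtr0_sg //; nra.
- by rewrite ltr0_sg //; nra.
Qed.
End Uhlmann.

(** * Smoothing *)

Section Smoothing.
Variable R : realType.
Local Notation C := R[i].
Local Notation "x %:C" := (real_complex R x).
Local Notation Re := (@complex.Re R).
Implicit Types (T U V I J K : finType).

Lemma real_CS I (P : pred I) (a b : I -> R) :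
  \sum_(i | P i) a i * b i <=
  Num.sqrt (\sum_(i | P i) a i ^+ 2) * Num.sqrt (\sum_(i | P i) b i ^+ 2).
Proof.
pose u (c : I -> R) i := ((if P i then c i else 0)%:C).
have nu c : nrm2 (u c) = \sum_(i | P i) c i ^+ 2.
  rewrite /nrm2 [RHS]big_mkcond; apply: eq_bigr => i _; rewrite /u sqnC.
  by case: ifP => _ //; rewrite expr0n.
rewrite -!nu; apply: le_trans (CS (u a) (u b)); apply: le_trans (ler_norm _).
rewrite /inner Re_sum [leLHS]big_mkcond; apply: ler_sum => i _.
by rewrite /u conjc_rc -rcM ReC; case: ifP => _; rewrite ?mul0r.
Qed.

(** Jensen's inequality for the square, obtained from Cauchy-Schwarz by splitting each weight into
    two roots. *)
Lemma avg_le_sqrt I (P : pred I) (l x : I -> R) : (forall i, 0 <= l i) ->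
  \sum_(i | P i) l i <= 1 -> \sum_(i | P i) l i * x i <= Num.sqrt (\sum_(i | P i) l i * x i ^+ 2).
Proof.
move=> l0 l1.
have -> : \sum_(i | P i) l i * x i = \sum_(i | P i) Num.sqrt (l i) * (Num.sqrt (l i) * x i).
  by apply: eq_bigr => i _; rewrite mulrA -expr2 sqr_sqrtr.
apply: le_trans (real_CS _ _ _) _.
under eq_bigr do rewrite sqr_sqrtr //.
under [X in Num.sqrt _ * Num.sqrt X]eq_bigr do rewrite exprMn sqr_sqrtr //.
rewrite -[leRHS]mul1r ler_wpM2r ?sqrtr_ge0 //.
by rewrite -(sqrtr1 R) ler_wsqrtr.
Qed.

Lemma nrm2_pair I T (F : I -> T -> C) : nrm2 (fun p : I * T => F p.1 p.2) = \sum_i nrm2 (F i).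
Proof. by rewrite /nrm2 pair_big. Qed.

Lemma nrm2_curry I T (v : I * T -> C) : nrm2 v = \sum_i nrm2 (fun t => v (i, t)).
Proof. by rewrite /nrm2 pair_big; apply: eq_bigr => -[]. Qed.
Lemma inner_curry I T (u v : I * T -> C) :
  inner u v = \sum_i inner (fun t => u (i, t)) (fun t => v (i, t)).
Proof. by rewrite /inner pair_big; apply: eq_bigr => -[]. Qed.

(** A trace against a contraction is at most the root of the rank times the Hilbert-Schmidt norm.
    The rank is counted by the vectors [w s] with [s] in [P], whose span contains the columns of
    [Z]. *)
Lemma hs_bound I T (H Z : op R T T) (w : I -> T -> C) (P : pred I) :
  contr H -> orthonormal w ->
  (forall r r', Z r r' = \sum_(s | P s) inner (w s) (Z ^~ r') * w s r) ->
  Re (\sum_r \sum_r' H r' r * Z r r') <= Num.sqrt (#|P|%:R * hs2 Z).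
Proof.
move=> cH ow hZ.
pose a (p : I * T) : C := if P p.1 then conjc (ap H (w p.1) p.2) else 0.
pose b (p : I * T) : C := if P p.1 then inner (w p.1) (Z ^~ p.2) else 0.
have -> : \sum_r \sum_r' H r' r * Z r r' = inner a b.
  rewrite /inner -(pair_bigA _ (fun s r' => conjc (a (s, r')) * b (s, r'))) /=.
  transitivity (\sum_r \sum_r' \sum_(s | P s) H r' r * w s r * inner (w s) (Z ^~ r')).
    apply: eq_bigr => r _; apply: eq_bigr => r' _; rewrite hZ mulr_sumr.
    by apply: eq_bigr => s _; ring.
  under [LHS]eq_bigr do rewrite exchange_big /=.
  rewrite exchange_big /= big_mkcond; apply: eq_bigr => s _.
  rewrite /a /b /=; case: ifP => Ps; last first.
    by rewrite big1 // => r' _; rewrite mulr0.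
  rewrite exchange_big /=; apply: eq_bigr => r' _; rewrite conjcK /ap mulr_suml.
  by apply: eq_bigr => r _.
apply: le_trans (ler_norm _) _; apply: le_trans (CS a b) _.
rewrite sqrtrM ?ler0n //; apply: ler_pM; rewrite ?sqrtr_ge0 //; apply: ler_wsqrtr.
  have -> : nrm2 a = \sum_(s | P s) nrm2 (ap H (w s)).
    rewrite (nrm2_pair (fun s r => a (s, r))) [RHS]big_mkcond; apply: eq_bigr => s _.
    rewrite /a /=; case: ifP => _; last by rewrite /nrm2 big1 // => t _; rewrite sqn0.
    by rewrite nrm2J.
  rewrite -sum1_card natr_sum; apply: ler_sum => s _; apply: le_trans (cH _) _.
  by rewrite -lecR -inner_nrm2 ow eqxx.
have -> : hs2 Z = \sum_r' nrm2 (Z ^~ r') by rewrite /hs2 /nrm2 exchange_big.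
rewrite (nrm2_pair (fun s r => b (s, r))) {1}/nrm2 exchange_big /=.
apply: ler_sum => r' _; apply: le_trans (bessel P (Z ^~ r') ow).
rewrite [leRHS]big_mkcond; apply: ler_sum => s _; rewrite /b /=.
by case: ifP; rewrite ?sqn0.
Qed.

(** The difference is <u - v, F u> + <v, F (u - v)>, and each term is at most k |u - v|. *)
Lemma form_diff T (F : op R T T) (k : R) (u v : T -> C) : 0 <= k ->
  (forall v, nrm2 (ap F v) <= k ^+ 2 * nrm2 v) -> nrm2 u <= 1 -> nrm2 v <= 1 ->
  Re (inner u (ap F u) - inner v (ap F v)) <= 2 * k * Num.sqrt (nrm2 (fun t => u t - v t)).
Proof.
move=> k0 hF u1 v1; set d := fun t => u t - v t.
have -> : inner u (ap F u) - inner v (ap F v) = inner d (ap F u) + inner v (ap F d).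
  rewrite !inner_adj /inner /d -sumrB -big_split /=.
  have e t : ap (adj F) (fun t => u t - v t) t = ap (adj F) u t - ap (adj F) v t.
    by rewrite /ap -sumrB; apply: eq_bigr => s _; rewrite mulrBr.
  by apply: eq_bigr => t _; rewrite e conjcB; ring.
have sF w : Num.sqrt (nrm2 (ap F w)) <= k * Num.sqrt (nrm2 w).
  rewrite -(ger0_norm k0) -sqrtr_sqr -sqrtrM ?sqr_ge0 //; exact: ler_wsqrtr.
have s1 (w : T -> C) : nrm2 w <= 1 -> Num.sqrt (nrm2 w) <= 1.
  by move=> h; rewrite -[leRHS]sqrtr1 ler_wsqrtr.
rewrite ReD mulrAC mulr_natl mulr2n mulrDl; apply: lerD.
  apply: le_trans (ler_norm _) _; apply: le_trans (CS _ _) _.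
  rewrite ler_wpM2l ?sqrtr_ge0 //; apply: le_trans (sF _) _.
  by apply: ler_piMr => //; apply: s1.
apply: le_trans (ler_norm _) _; apply: le_trans (CS _ _) _.
rewrite -[leRHS]mul1r; apply: ler_pM; rewrite ?sqrtr_ge0 //; first exact: s1.
by rewrite mulrC.
Qed.

Lemma smooth_diff I T (F : I -> op R T T) (k : R) (l : I -> R) (u v : I -> T -> C) : 0 <= k ->
  (forall c v, nrm2 (ap (F c) v) <= k ^+ 2 * nrm2 v) ->
  (forall c, nrm2 (u c) <= 1) -> (forall c, nrm2 (v c) <= 1) ->
  (forall c, 0 <= l c) -> \sum_c l c <= 1 ->
  Re (\sum_c (l c)%:C * (inner (u c) (ap (F c) (u c)) - inner (v c) (ap (F c) (v c)))) <=
  2 * k * Num.sqrt (\sum_c l c * nrm2 (fun t => u c t - v c t)).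
Proof.
move=> k0 hF u1 v1 l0 l1; rewrite Re_sum.
apply: (@le_trans _ _ (\sum_c 2 * k * (l c * Num.sqrt (nrm2 (fun t => u c t - v c t))))).
  apply: ler_sum => c _; rewrite Re_rM mulrCA ler_wpM2l //; exact: form_diff (hF c) _ _.
rewrite -mulr_sumr ler_wpM2l ?mulr_ge0 //.
apply: le_trans (avg_le_sqrt _ l0 l1) _; apply: ler_wsqrtr.
by apply: ler_sum => c _; rewrite sqr_sqrtr ?nrm2_ge0.
Qed.

Definition prj K T (w : K -> T -> C) (P : pred K) (v : T -> C) : T -> C :=
  fun t => \sum_(k | P k) inner (w k) v * w k t.

Lemma inner_prj K T (w : K -> T -> C) (P : pred K) u v :
  inner u (prj w P v) = inner (prj w P u) v.
Proof.
rewrite /prj inner_sumr inner_suml; apply: eq_bigr => k _.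
by rewrite innerJ mulrC.
Qed.

Lemma nrm2_prj K T (w : K -> T -> C) (P : pred K) v : orthonormal w ->
  nrm2 (prj w P v) = \sum_(k | P k) sqn (inner (w k) v).
Proof. by move=> ow; rewrite (nrm2_comb P _ ow). Qed.

Lemma prj_idem K T (w : K -> T -> C) (P : pred K) v : orthonormal w ->
  prj w P (prj w P v) =1 prj w P v.
Proof.
move=> ow t; apply: eq_bigr => k Pk; rewrite inner_sumr (bigD1 k) //= ow eqxx mulr1.
rewrite big1 ?addr0 // => j /andP[_ jk]; by rewrite ow eq_sym (negPf jk) mulr0.
Qed.

Lemma nrm2_prj_le K T (w : K -> T -> C) (P : pred K) v : orthonormal w ->
  nrm2 (prj w P v) <= nrm2 v.
Proof. by move=> ow; rewrite nrm2_prj // bessel. Qed.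

Lemma nrm2_prjC K T (w : K -> T -> C) (P : pred K) v : orthonormal w ->
  nrm2 (fun t => v t - prj w P v t) = nrm2 v - nrm2 (prj w P v).
Proof.
move=> ow; rewrite nrm2B.
have -> : Re (inner v (prj w P v)) = nrm2 (prj w P v).
  rewrite -[RHS]ReC -inner_nrm2; congr Re; rewrite -inner_prj.
  by apply: eq_inner => // t; rewrite prj_idem.
ring.
Qed.

(** The vectors are a parameter because they will be eigenvectors already compressed by a
    projection, no longer orthonormal. *)
Definition trunc I T (S : pred I) (l : I -> R) (v : I -> T -> C) : op R T T :=
  fun r r' => \sum_(c | S c) (l c)%:C * (v c r * conjc (v c r')).

Lemma hs2_trunc I T (S : pred I) (l : I -> R) (v : I -> T -> C) :
  hs2 (trunc S l v) = \sum_(c | S c) \sum_(d | S d) l c * l d * sqn (inner (v c) (v d)).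
Proof.
apply: (@complexI R); rewrite /hs2 !rc_sum.
transitivity (\sum_r \sum_r' \sum_(c | S c) \sum_(d | S d)
  (l c * l d)%:C * ((v c r * conjc (v c r')) * conjc (v d r * conjc (v d r')))).
  apply: eq_bigr => r _; rewrite /nrm2 rc_sum; apply: eq_bigr => r' _.
  rewrite -sqnE /trunc conjc_sum mulr_suml; apply: eq_bigr => c _.
  rewrite mulr_sumr; apply: eq_bigr => d _; rewrite [conjc (_ * (_ * _))]conjcM conjc_rc rcM.
  by ring.
under eq_bigr do rewrite exchange_big /=.
rewrite exchange_big /=; apply: eq_bigr => c _; rewrite rc_sum.
under eq_bigr do rewrite exchange_big /=.
rewrite exchange_big /=; apply: eq_bigr => d _; rewrite [RHS]rcM -sqnE innerJ.
rewrite /inner mulr_suml mulr_sumr exchange_big /=; apply: eq_bigr => r _.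
rewrite mulr_sumr mulr_sumr; apply: eq_bigr => r' _.
by rewrite conjcM conjcK; ring.
Qed.

(** Purity is at most the largest eigenvalue times the trace: one of the two eigenvalues in
    [hs2_trunc] is bounded by [lam], and the squared overlaps with the orthonormal [u d] sum to at
    most 1 by Bessel, even after compression. *)
Lemma hs2_trunc_prj I K T (S : pred I) (l : I -> R) (u : I -> T -> C) (w : K -> T -> C)
    (P : pred K) (lam : R) : orthonormal u -> orthonormal w ->
  (forall c, 0 <= l c) -> (forall c, S c -> l c <= lam) ->
  hs2 (trunc S l (fun c => prj w P (u c))) <= lam * \sum_(c | S c) l c.
Proof.
move=> ou ow l0 hl; rewrite hs2_trunc mulr_sumr; apply: ler_sum => c Sc.
apply: (@le_trans _ _ (\sum_(d | S d) lam * l c * sqn (inner (u d) (prj w P (u c))))).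
  apply: ler_sum => d Sd; rewrite inner_prj.
  have -> : sqn (inner (prj w P (prj w P (u c))) (u d)) = sqn (inner (u d) (prj w P (u c))).
    rewrite -sqnJ innerJ; congr sqn; apply: eq_inner => // t; exact: prj_idem.
  rewrite ler_wpM2r ?sqn_ge0 // mulrC ler_wpM2r //; exact: hl.
have lam0 : 0 <= lam by apply: le_trans (l0 c) (hl c Sc).
rewrite -mulr_sumr -[leRHS]mulr1 ler_wpM2l ?mulr_ge0 //.
apply: le_trans (bessel _ _ ou) _; apply: le_trans (nrm2_prj_le _ _ ow) _.
by rewrite -lecR -inner_nrm2 ou eqxx.
Qed.

Lemma form_trunc I T (F : op R T T) (l : I -> R) (S : pred I) (v : I -> T -> C) :
  \sum_r \sum_r' F r' r * trunc S l v r r' =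
  \sum_(c | S c) (l c)%:C * inner (v c) (ap F (v c)).
Proof.
transitivity (\sum_r \sum_r' \sum_(c | S c) (l c)%:C * (conjc (v c r') * (F r' r * v c r))).
  apply: eq_bigr => r _; apply: eq_bigr => r' _; rewrite mulr_sumr.
  by apply: eq_bigr => c _; ring.
under eq_bigr do rewrite exchange_big /=.
rewrite exchange_big /=; apply: eq_bigr => c _; rewrite exchange_big /=.
rewrite /inner /ap mulr_sumr; apply: eq_bigr => r' _.
by rewrite !mulr_sumr; apply: eq_bigr => r _.
Qed.

End Smoothing.

(** * Decoding with side information *)

Section Pinching.
Variable R : realType.
Local Notation C := R[i].
Local Notation "x %:C" := (real_complex R x).
Local Notation Re := (@complex.Re R).
Implicit Types (T U V I J K : finType).

Definition bounded T U (k : R) (F : T -> U -> C) : Prop :=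
  forall v, nrm2 (ap F v) <= k ^+ 2 * nrm2 v.

Lemma nrm2_fiber T (L : finType) (lab : T -> L) (v : T -> C) :
  nrm2 v = \sum_(L0 : L) nrm2 (fun t => (lab t == L0)%:R * v t).
Proof.
rewrite /nrm2 exchange_big /=; apply: eq_bigr => t _.
rewrite (bigD1 (lab t)) //= eqxx mul1r big1 ?addr0 // => L0 h.
by rewrite eq_sym (negPf h) mul0r sqn0.
Qed.

(** The operator is block diagonal for the fibers of [lab], so its blocks govern its norm. Each
    block may come from a different [F L0], which allows one operator per class of outcomes to be
    glued into a single one. *)
Lemma bounded_pinch T (L : finType) (lab : T -> L) (F : L -> op R T T) k :
  (forall L0, bounded k (F L0)) ->
  bounded k (fun a b => (lab a == lab b)%:R * F (lab b) a b).
Proof.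
move=> hF v; rewrite (nrm2_fiber lab v) mulr_sumr.
rewrite [leLHS](nrm2_fiber lab); apply: ler_sum => L0 _.
apply: le_trans (hF L0 _); apply: ler_sum => t _.
have -> : (lab t == L0)%:R * ap (fun a b => (lab a == lab b)%:R * F (lab b) a b) v t =
   (lab t == L0)%:R * ap (F L0) (fun t => (lab t == L0)%:R * v t) t.
  case: eqVneq => [e|]; rewrite ?mul0r // !mul1r /ap; apply: eq_bigr => s _.
  rewrite e eq_sym; case: eqVneq => [->|]; last by rewrite !mul0r mulr0.
  by rewrite !mul1r.
rewrite sqnM sqn_nat; case: eqP; rewrite ?expr1n ?mul1r // expr0n mul0r => _; exact: sqn_ge0.
Qed.

Lemma contr_bounded T U (F : T -> U -> C) : contr F -> bounded 1 F.
Proof. by move=> h v; rewrite expr1n mul1r. Qed.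

Lemma boundedB T U (F G : T -> U -> C) k : bounded k F -> bounded k G ->
  bounded (2 * k) (fun a b => F a b - G a b).
Proof.
move=> hF hG v.
have -> : nrm2 (ap (fun a b => F a b - G a b) v) = nrm2 (fun t => ap F v t - ap G v t).
  by apply: eq_nrm2 => t; rewrite /ap -sumrB; apply: eq_bigr => s _; rewrite mulrBl.
(* Parallelogram law: |a - b|^2 <= 2 |a|^2 + 2 |b|^2, hence the factor 2 in norm. *)
have := nrm2_ge0 (fun t => ap F v t + ap G v t).
rewrite nrm2B nrm2D => h; rewrite exprMn.
have := hF v; have := hG v; lra.
Qed.

Lemma eq_bounded T U (F G : T -> U -> C) k : (forall a b, F a b = G a b) ->
  bounded k F -> bounded k G.
Proof.
by move=> e h v; apply: le_trans (h v); rewrite (eq_nrm2 (eq_ap (fun a b => esym (e a b)) (fun _ => erefl))).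
Qed.

End Pinching.

Section Decode.
Variable R : realType.
Local Notation C := R[i].
Local Notation "x %:C" := (real_complex R x).
Local Notation Re := (@complex.Re R).
Variables (m : nat) (X Cc : 'I_m -> finType) (G Q : finType).
Variables (Phi : Jt X -> G -> Q -> C) (i0 : 'I_m) (f : forall l, X l -> Cc l).
Local Notation T := (Jt X * G)%type.

Definition code (x : Jt X) : Jt Cc := finfun (fun l => f (x l)).
Definition eqon (S : {set 'I_m}) (x x' : Jt X) : bool := [forall l, (l \in S) ==> (x l == x' l)].
(** The reduced state, on outcomes and [G], of the vector sum_x |x> |x_S> |Phi x>: a copy of the
    registers in [S] is on the other side, with [Q]. Its nonzero spectrum is that of the
    classical-quantum state of X_S and [Q]. *)
Definition tau (S : {set 'I_m}) : op R T T := fun r r' =>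
  (eqon S r.1 r'.1)%:R * \sum_q Phi r.1 r.2 q * conjc (Phi r'.1 r'.2 q).
Definition cmask (J : seq 'I_m) (x x' : Jt X) : R :=
  \prod_(l <- J) ((f (x l) == f (x' l))%:R - (x l == x' l)%:R).
(* The factors are differences, not indicators of [x l <> x' l]: in [mask_total] what is left
   outside [J] is then the single state [tau (~: J)], so that each [J] can be smoothed
   on its own and no simultaneous smoothing is needed. *)
Definition mask (J : {set 'I_m}) (x x' : Jt X) : R :=
  \prod_(l in J) ((f (x l) == f (x' l))%:R - (x l == x' l)%:R).

(** What party [i0] knows classically: its own outcome and all the hashes. Only the tuples of one
    class remain to be told apart. *)
Definition cls (x : Jt X) : X i0 * Jt Cc := (x i0, code x).

Lemma code_eq x x' : (code x == code x') = [forall l, f (x l) == f (x' l)].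
Proof.
apply/eqP/forallP => [e l|h]; last first.
  by apply/ffunP => l; rewrite !ffunE; apply/eqP.
by have /ffunP /(_ l) := e; rewrite !ffunE => ->.
Qed.

Lemma Jt_eq (x x' : Jt X) : (x == x') = [forall l, x l == x' l].
Proof.
apply/eqP/forallP => [->//|h].
by apply/ffunP => l; apply/eqP.
Qed.

Lemma prod_bool (P : pred 'I_m) (b : 'I_m -> bool) :
  \prod_(l | P l) (b l)%:R = [forall l, P l ==> b l]%:R :> R.
Proof.
case: forallP => [h|/forallP]; last first.
  rewrite negb_forall => /existsP [l]; rewrite negb_imply => /andP [Pl bl].
  by rewrite (bigD1 l) //= (negPf bl) mul0r.
by apply: big1 => l Pl; have := h l; rewrite Pl /= => ->.
Qed.

(** Expand prod_l (d_l + b_l), where b_l compares outcomes and d_l is hash equality minus b_l, set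
    to 0 at [i0]. The sets containing [i0] vanish, and the empty set contributes exactly
    [x = x']. *)
Lemma mask_total x x' :
  (cls x == cls x')%:R - (x == x')%:R =
  \sum_(J : {set 'I_m} | (i0 \notin J) && (J != finset.set0)) mask J x x' * (eqon (~: J) x x')%:R :> R.
Proof.
pose b l : R := (x l == x' l)%:R.
pose d l : R := if l == i0 then 0 else (f (x l) == f (x' l))%:R - b l.
have h1 : \prod_l (d l + b l) = (cls x == cls x')%:R.
  transitivity (\prod_l ((if l == i0 then x l == x' l else f (x l) == f (x' l)) : bool)%:R : R).
    by apply: eq_bigr => l _; rewrite /d /b; case: eqP => _; rewrite ?add0r // subrK.
  rewrite prod_bool; congr (nat_of_bool _)%:R; rewrite xpair_eqE code_eq.
  apply/forallP/andP => [h|[/eqP e /forallP h] l].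
    split; first by have := h i0; rewrite eqxx.
    apply/forallP => l; have := h l => /=; case: eqP => // -> /eqP ->; exact: eqxx.
  by case: eqP => [->|_] /=; rewrite ?e ?eqxx.
rewrite -h1 bigA_distr (bigID (fun J : {set 'I_m} => (i0 \notin J) && (J != finset.set0))) /=.
have -> : \sum_(J : {set 'I_m} | (i0 \notin J) && (J != finset.set0)) \prod_l (if l \in J then d l else b l) =
   \sum_(J : {set 'I_m} | (i0 \notin J) && (J != finset.set0)) mask J x x' * (eqon (~: J) x x')%:R.
  apply: eq_bigr => J /andP [iJ _].
  rewrite (bigID (mem J)) /=; congr (_ * _).
    apply: eq_bigr => l lJ; rewrite lJ /d; case: eqP => // e.
    by rewrite e (negPf iJ) in lJ.
  transitivity (\prod_(l | l \in ~: J) b l).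
    by apply: eq_big => [l|l /negPf ->] //; rewrite finset.in_setC.
  by rewrite prod_bool.
rewrite [X in _ + X - _](bigD1 finset.set0) /=; last by rewrite eqxx andbF.
rewrite [X in _ + (_ + X) - _]big1 ?addr0; last first.
  move=> J /andP [h J0]; have iJ : i0 \in J by move: h; rewrite J0 andbT negbK.
  by rewrite (bigD1 i0) //= iJ /d eqxx mul0r.
have -> : \prod_l (if l \in finset.set0 then d l else b l) = (x == x')%:R.
  transitivity (\prod_l b l); first by apply: eq_bigr => l _; rewrite finset.in_set0.
  by rewrite prod_bool Jt_eq.
by rewrite addrK.
Qed.

(** Multiplying the entries by one factor of the mask is a difference of two pinchings, by hash and
    by outcome, and so at most doubles the norm; there are at most [m] factors. *)
Lemma bounded_mask J (H : op R T T) : contr H ->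
  bounded (2 ^+ m) (fun r' r => (mask J r.1 r'.1)%:C * H r' r).
Proof.
move=> cH.
have h (s : seq 'I_m) : bounded (2 ^+ size s) (fun r' r => (cmask s r.1 r'.1)%:C * H r' r).
  elim: s => [|l s IH].
    apply: (eq_bounded _ (contr_bounded cH)) => a b.
    by rewrite /cmask big_nil mul1r.
  pose F r' r := (cmask s r.1 r'.1)%:C * H r' r.
  have ha := bounded_pinch (fun r : T => f (r.1 l)) (fun _ => IH).
  have hb := bounded_pinch (fun r : T => r.1 l) (fun _ => IH).
  rewrite /= exprS; apply: (eq_bounded _ (boundedB ha hb)) => a b.
  rewrite /cmask big_cons rcM [(_ - _)%:C]rmorphB /= !rc_nat.
  by rewrite [f (b.1 l) == _]eq_sym [b.1 l == _]eq_sym; ring.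
have := h (enum J).
move=> hJ v; apply: le_trans (le_trans (hJ v) _).
  rewrite le_eqVlt; apply/orP; left; apply/eqP/eq_nrm2/eq_ap => // r' r.
  by rewrite /mask /cmask big_enum.
rewrite ler_wpM2r ?nrm2_ge0 // -!exprM ler_weXn2l ?ler1n // leq_mul2r.
by rewrite -cardE (leq_trans (max_card _)) ?card_ord.
Qed.

(** In each class [L], [M L] is the part of the state in that class and [N L] the same with a copy
    of x written on the receiver's side. Their reduced states on [T] differ only in entries with
    distinct x and x'. Uhlmann's contraction writes the copy, and [D x] is its component at x. *)
Lemma decode_uhlmann : exists (D : Jt X -> op R Q Q) (H : op R T T),
  [/\ forall L v, \sum_(x | cls x == L) nrm2 (ap (D x) v) <= nrm2 v, contr H &
   \sum_x hs2 (Phi x) -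
   Re (\sum_r \sum_r' H r' r * (((cls r.1 == cls r'.1)%:R - (r.1 == r'.1)%:R)
        * \sum_q Phi r.1 r.2 q * conjc (Phi r'.1 r'.2 q))) / 2
   <= Re (\sum_x \sum_g inner (Phi x g) (ap (D x) (Phi x g)))].
Proof.
pose M (L : X i0 * Jt Cc) (r : T) q := (cls r.1 == L)%:R * Phi r.1 r.2 q.
pose N (L : X i0 * Jt Cc) (r : T) (yq : Jt X * Q) :=
  (r.1 == yq.1)%:R * ((cls r.1 == L)%:R * Phi r.1 r.2 yq.2).
have /choice [D /choice [H hDH]] := fun L => uhlmann (M L) (N L).
pose D' x q' q := D (cls x) (x, q') q.
pose H' (r' r : T) := (cls r'.1 == cls r.1)%:R * H (cls r.1) r' r.
exists D', H'; split.
- move=> L v; have [cD _ _] := hDH L; apply: le_trans (cD v).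
  rewrite nrm2_curry big_mkcond /=.
  apply: ler_sum => x _; case: eqP => [e|_]; last exact: nrm2_ge0.
  rewrite le_eqVlt; apply/orP; left; apply/eqP/eq_nrm2 => q'.
  by rewrite /ap /D' e.
- have hb := @bounded_pinch _ _ _ (fun r : T => cls r.1) H 1
    (fun L => contr_bounded (let: And3 _ h _ := hDH L in h)).
  by move=> v; have := hb v; rewrite expr1n mul1r.
have sumM : \sum_L hs2 (M L) = \sum_x hs2 (Phi x).
  rewrite /hs2 exchange_big [RHS]pair_big /=; apply: eq_bigr => -[x g] _ /=.
  rewrite (bigD1 (cls x)) //= big1 ?addr0; first by apply: eq_nrm2 => q; rewrite /M /= eqxx mul1r.
  move=> L hL; rewrite -[RHS](mul0r (nrm2 (Phi x g))) -(sqn0 R) -nrm2Z.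
  by apply: eq_nrm2 => q; rewrite /M /= eq_sym (negPf hL).
have sumN : \sum_L hs2 (N L) = \sum_x hs2 (Phi x).
  rewrite -sumM; apply: eq_bigr => L _; apply: eq_bigr => r _.
  rewrite nrm2_curry (bigD1 r.1) //=.
  rewrite [X in _ + X]big1 ?addr0; last first.
    by move=> y hy; rewrite /nrm2 big1 // => q _; rewrite /N /= eq_sym (negPf hy) mul0r sqn0.
  by apply: eq_bigr => q _; rewrite /N eqxx mul1r.
have sumI : \sum_L (\sum_r inner (N L r) (ap (D L) (M L r))) =
   \sum_x \sum_g inner (Phi x g) (ap (D' x) (Phi x g)).
  rewrite exchange_big [RHS]pair_big /=; apply: eq_bigr => -[x g] _ /=.
  rewrite (bigD1 (cls x)) //= [X in _ + X]big1 ?addr0; last first.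
    move=> L hL; rewrite /inner big1 // => yq _.
    by rewrite /N /= [cls x == _]eq_sym (negPf hL) mul0r mulr0 conjc0 mul0r.
  rewrite inner_curry.
  rewrite (bigD1 x) //= [X in _ + X]big1 ?addr0; last first.
    by move=> y hy; rewrite /inner big1 // => q _; rewrite /N /= eq_sym (negPf hy) mul0r conjc0 mul0r.
  apply: eq_bigr => q' _; rewrite /N /= !eqxx !mul1r; congr (_ * _).
  by apply: eq_bigr => q _; rewrite /M /= eqxx mul1r.
have gN L r r' : gram (N L) r r' = (r.1 == r'.1)%:R * gram (M L) r r'.
  have -> : gram (N L) r r' = \sum_y \sum_q N L r (y, q) * conjc (N L r' (y, q)).
    by rewrite pair_big; apply: eq_bigr => -[].
  rewrite (bigD1 r.1) //= [X in _ + X]big1 ?addr0; last first.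
    by move=> y hy; rewrite big1 // => q _; rewrite /N /= eq_sym (negPf hy) !mul0r.
  rewrite mulr_sumr; apply: eq_bigr => q _; rewrite /N /= eqxx mul1r.
  by rewrite [r.1 == _]eq_sym conjcM conjc_natr /M /=; ring.
have sumH : \sum_L (\sum_r \sum_r' H L r' r * (gram (M L) r r' - gram (N L) r r')) =
  \sum_r \sum_r' H' r' r * (((cls r.1 == cls r'.1)%:R - (r.1 == r'.1)%:R)
        * \sum_q Phi r.1 r.2 q * conjc (Phi r'.1 r'.2 q)).
  rewrite exchange_big /=; apply: eq_bigr => r _; rewrite exchange_big /=; apply: eq_bigr => r' _.
  rewrite (bigD1 (cls r.1)) //= [X in _ + X]big1 ?addr0; last first.
    move=> L hL; rewrite gN /gram big1 ?mulr0 ?subr0 ?mulr0 // => q _.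
    by rewrite /M eq_sym (negPf hL) !mul0r.
  have -> : gram (M (cls r.1)) r r' = (cls r.1 == cls r'.1)%:R *
       \sum_q Phi r.1 r.2 q * conjc (Phi r'.1 r'.2 q).
    rewrite /gram mulr_sumr; apply: eq_bigr => q _; rewrite /M eqxx mul1r.
    by rewrite [cls r'.1 == _]eq_sym conjcM conjc_natr mulrCA.
  rewrite gN.
  have -> : gram (M (cls r.1)) r r' = (cls r.1 == cls r'.1)%:R *
       \sum_q Phi r.1 r.2 q * conjc (Phi r'.1 r'.2 q).
    rewrite /gram mulr_sumr; apply: eq_bigr => q _; rewrite /M eqxx mul1r.
    by rewrite [cls r'.1 == _]eq_sym conjcM conjc_natr mulrCA.
  rewrite /H' [cls r'.1 == _]eq_sym; case: eqVneq => [e|h]; rewrite ?mul0r ?mulr0 ?subr0 ?mulr0 //.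
    by rewrite !mul1r -[true%:R]/(1 : C); ring.
have h3 L : (hs2 (M L) + hs2 (N L) -
         Re (\sum_r \sum_r' H L r' r * (gram (M L) r r' - gram (N L) r r'))) /
        2 <= Re (\sum_r inner (N L r) (ap (D L) (M L r))) by case: (hDH L).
have := @ler_sum _ _ (index_enum _) xpredT _ _ (fun L _ => h3 L).
rewrite -Re_sum sumI => h; apply: le_trans h.
rewrite -mulr_suml sumrB big_split /= sumM sumN -Re_sum sumH le_eqVlt; apply/orP; left; apply/eqP.
by field.
Qed.
End Decode.

(** * One-shot decoding error, each set [J] of ambiguous positions smoothed separately *)

Section DecodeSmooth.
Variable R : realType.
Local Notation C := R[i].
Local Notation "x %:C" := (real_complex R x).
Local Notation Re := (@complex.Re R).
Variables (m : nat) (X Cc : 'I_m -> finType) (G Q : finType).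
Variables (Phi : Jt X -> G -> Q -> C) (i0 : 'I_m).
Variables (I K : finType).
Local Notation T := (Jt X * G)%type.
Variables (w : Jt X -> K -> G -> C) (l' : Jt X -> K -> R) (Sz : pred (Jt X * K)).
Hypothesis hw : forall x, spectral (gram (Phi x)) (w x) (l' x).

Definition block_basis (xk : Jt X * K) (r : T) : C := (r.1 == xk.1)%:R * w xk.1 xk.2 r.2.

Lemma inner_block x k (v : T -> C) :
  inner (block_basis (x, k)) v = inner (w x k) (fun g => v (x, g)).
Proof.
rewrite inner_curry (bigD1 x) //= [X in _ + X]big1 ?addr0.
  by apply: eq_inner => // g; rewrite /block_basis /= eqxx mul1r.
move=> y yx; rewrite /inner big1 // => g _.
by rewrite /block_basis /= (negPf yx) mul0r conjc0 mul0r.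
Qed.

Lemma block_orthonormal : orthonormal block_basis.
Proof.
move=> [x k] [y j]; rewrite inner_block xpair_eqE /block_basis /=.
case: eqVneq => [<-|h].
  have := (hw x).1 k j; rewrite /= => <-; apply: eq_inner => // g.
  by rewrite mul1r.
by rewrite /inner big1 // => g _; rewrite mul0r mulr0.
Qed.

(** The blocks of [tau S] on the diagonal in x do not depend on [S], so one projection on typical
    block eigenvectors serves all [S]. *)
Lemma tau_eigenvalue S x k :
  inner (block_basis (x, k)) (ap (tau Phi S) (block_basis (x, k))) = (l' x k)%:C.
Proof.
rewrite inner_block -[RHS]mulr1 -[1]/(true%:R) -(eqxx k) -((hw x).1 k k) -innerZr.
apply: eq_inner => // g; rewrite -(spectral_eig k (hw x)) /ap.
transitivity (\sum_y \sum_g' tau Phi S (x, g) (y, g') * block_basis (x, k) (y, g')).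
  by rewrite pair_big; apply: eq_bigr => -[].
rewrite (bigD1 x) //= [X in _ + X]big1 ?addr0; last first.
  by move=> y yx; rewrite big1 // => g' _; rewrite /block_basis /= (negPf yx) mul0r mulr0.
apply: eq_bigr => g' _; rewrite /block_basis /tau /= eqxx mul1r.
have -> : eqon S x x by apply/forallP => i; apply/implyP.
by rewrite mul1r.
Qed.

Section OnePattern.
Variables (f : forall l, X l -> Cc l) (J : {set 'I_m}) (H : op R T T).
Variables (u : I -> T -> C) (l : I -> R) (SJ : pred I).
Hypothesis hu : spectral (tau Phi (~: J)) u l.
Hypotheses (l0 : forall c, 0 <= l c) (l1 : \sum_c l c = 1).

(* The typical part of [tau (~: J)], compressed to the typical eigenvectors of its
   block-diagonal part. *)
Definition smoothed : op R T T := trunc SJ l (fun c => prj block_basis Sz (u c)).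

Lemma nrm2_u c : nrm2 (u c) = 1.
Proof. by apply: (@complexI R); rewrite -inner_nrm2 hu.1 eqxx. Qed.

(** By [tau_eigenvalue] the compression keeps, in [tau (~: J)], exactly the weight of the typical
    block eigenvectors; Pythagoras turns the lost weight into a mean squared distance. An atypical
    [c] is dropped and costs its full weight. *)
Lemma smoothing_loss :
  \sum_c l c * nrm2 (fun t => u c t - (if SJ c then prj block_basis Sz (u c) t else 0)) <=
  (1 - \sum_(c | SJ c) l c) + (1 - \sum_(xk | Sz xk) l' xk.1 xk.2).
Proof.
have ow := block_orthonormal.
have e : \sum_(xk | Sz xk) l' xk.1 xk.2 = \sum_c l c * nrm2 (prj block_basis Sz (u c)).
  under [RHS]eq_bigr do rewrite nrm2_prj // mulr_sumr.
  rewrite exchange_big /=; apply: eq_bigr => -[x k] _; apply: (@complexI R) => /=.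
  rewrite -(tau_eigenvalue (~: J) x k) (inner_spectral _ _ hu) rc_sum.
  apply: eq_bigr => c _; rewrite rcM -mulrA -sqnE; congr (_ * _).
  by rewrite mulrC innerJ.
rewrite e [\sum_(c | SJ c) _]big_mkcond -l1 -!sumrB -big_split /=; apply: ler_sum => c _.
have p1 : nrm2 (prj block_basis Sz (u c)) <= 1 by rewrite -(nrm2_u c) nrm2_prj_le.
case: ifP => _.
  have -> : nrm2 (fun t => u c t - prj block_basis Sz (u c) t) =
     1 - nrm2 (prj block_basis Sz (u c)) by rewrite nrm2_prjC // nrm2_u.
  by rewrite subrr add0r mulrBr mulr1.
have -> : nrm2 (fun t => u c t - 0) = 1.
  by rewrite -(nrm2_u c); apply: eq_nrm2 => t; rewrite subr0.
have := ler_wpM2l (l0 c) p1; lra.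
Qed.

(** The mask depends on the outcomes only and each block vector is supported on one outcome, so
    masking the entries stays in the span of the typical block vectors. Their number thus bounds the
    rank. *)
Lemma smoothed_block r r' :
  (mask R f J r.1 r'.1)%:C * smoothed r r' =
  \sum_(s | Sz s) inner (block_basis s) (fun r => (mask R f J r.1 r'.1)%:C * smoothed r r')
    * block_basis s r.
Proof.
have ow := block_orthonormal.
have e : smoothed r r' = \sum_(s | Sz s) inner (block_basis s) (smoothed ^~ r') * block_basis s r.
  pose p c := prj block_basis Sz (u c).
  pose a c := (l c)%:C * conjc (p c r').
  have es t : smoothed t r' = \sum_(c | SJ c) a c * p c t.
    by apply: eq_bigr => c _; rewrite /a mulrAC -mulrA.
  under [RHS]eq_bigr do rewrite (eq_inner (fun _ => erefl) es) inner_sumr mulr_suml.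
  rewrite exchange_big es /=; apply: eq_bigr => c _.
  rewrite {1}/p -(prj_idem Sz _ ow) -/(p c) {1}/prj mulr_sumr.
  by apply: eq_bigr => s _; rewrite mulrA.
rewrite {1}e mulr_sumr; apply: eq_bigr => -[x k] _; rewrite mulrA.
rewrite /block_basis /=; case: eqVneq => [rx|]; last by rewrite !mul0r !mulr0.
rewrite -!/(block_basis _ _) !inner_block -innerZr /= !mul1r rx.
by [].
Qed.

(** The mask is moved onto [H], whose norm becomes at most [2 ^+ m], to pay for the smoothing; it is
    left on the smoothed state for the Hilbert-Schmidt bound. *)
Lemma decode_pattern : contr H ->
  Re (\sum_r \sum_r' H r' r * ((mask R f J r.1 r'.1)%:C * tau Phi (~: J) r r')) <=
  2 * 2 ^+ m * Num.sqrt ((1 - \sum_(c | SJ c) l c) + (1 - \sum_(xk | Sz xk) l' xk.1 xk.2))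
  + Num.sqrt (#|Sz|%:R * hs2 (fun r r' => (mask R f J r.1 r'.1)%:C * smoothed r r')).
Proof.
move=> cH; have ow := block_orthonormal.
pose F (r' r : T) := (mask R f J r.1 r'.1)%:C * H r' r.
have bF : bounded (2 ^+ m) F by exact: bounded_mask.
pose v c t := if SJ c then prj block_basis Sz (u c) t else 0.
have -> : \sum_r \sum_r' H r' r * ((mask R f J r.1 r'.1)%:C * tau Phi (~: J) r r') =
  \sum_c (l c)%:C * (inner (u c) (ap F (u c)) - inner (v c) (ap F (v c))) +
  \sum_r \sum_r' H r' r * ((mask R f J r.1 r'.1)%:C * smoothed r r').
  transitivity (\sum_c (l c)%:C * inner (u c) (ap F (u c))).
    rewrite -[RHS]form_trunc; apply: eq_bigr => r _; apply: eq_bigr => r' _.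
    rewrite hu.2 /F mulrCA mulrA; congr (_ * _); apply: eq_bigr => c _; ring.
  have -> : \sum_r \sum_r' H r' r * ((mask R f J r.1 r'.1)%:C * smoothed r r') =
     \sum_(c | SJ c) (l c)%:C * inner (v c) (ap F (v c)).
    rewrite -[RHS]form_trunc; apply: eq_bigr => r _; apply: eq_bigr => r' _.
    rewrite /F mulrCA mulrA; congr (_ * _); apply: eq_bigr => c Sc.
    by rewrite /v Sc.
  rewrite [X in _ = _ + X]big_mkcond -big_split /=; apply: eq_bigr => c _.
  case: ifP => Sc; first by rewrite -mulrDr subrK.
  rewrite addr0; have -> : inner (v c) (ap F (v c)) = 0.
    by rewrite /inner big1 // => t _; rewrite /v Sc conjc0 mul0r.
  by rewrite subr0.
rewrite ReD; apply: lerD; last exact: hs_bound ow smoothed_block.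
have hv c : nrm2 (v c) <= 1.
  case Sc: (SJ c).
    rewrite -(nrm2_u c); apply: le_trans (nrm2_prj_le Sz (u c) ow).
    by rewrite (@eq_nrm2 _ _ (v c) (prj block_basis Sz (u c))) // => t; rewrite /v Sc.
  by rewrite /nrm2 big1 // => t _; rewrite /v Sc sqn0.
have k0 : 0 <= 2 ^+ m :> R by rewrite exprn_ge0.
apply: le_trans (smooth_diff k0 (fun _ => bF) _ hv l0 _) _.
- by move=> c; rewrite nrm2_u.
- by rewrite l1.
by rewrite ler_wpM2l ?mulr_ge0 // ler_wsqrtr // smoothing_loss.
Qed.
End OnePattern.

Lemma decode_oneshot (f : forall l, X l -> Cc l)
  (u : {set 'I_m} -> I -> T -> C) (l : {set 'I_m} -> I -> R) (SJ : {set 'I_m} -> pred I) :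
  (forall J : {set 'I_m}, i0 \notin J -> spectral (tau Phi (~: J)) (u J) (l J)) ->
  (forall (J : {set 'I_m}) c, 0 <= l J c) -> (forall J : {set 'I_m}, \sum_c l J c = 1) ->
  exists D : Jt X -> op R Q Q,
    (forall L v, \sum_(x | cls i0 f x == L) nrm2 (ap (D x) v) <= nrm2 v) /\
    \sum_x hs2 (Phi x) -
    (\sum_(J : {set 'I_m} | (i0 \notin J) && (J != finset.set0))
      (2 * 2 ^+ m * Num.sqrt ((1 - \sum_(c | SJ J c) l J c) + (1 - \sum_(xk | Sz xk) l' xk.1 xk.2))
       + Num.sqrt (#|Sz|%:R * hs2 (fun r r' => (mask R f J r.1 r'.1)%:C * smoothed (u J) (l J) (SJ J) r r')))) / 2
    <= Re (\sum_x \sum_g inner (Phi x g) (ap (D x) (Phi x g))).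
Proof.
move=> hu l0 l1; have [D [H [hD cH h]]] := decode_uhlmann Phi i0 f.
exists D; split=> //; apply: le_trans h.
rewrite lerD2l lerN2 ler_wpM2r ?invr_ge0 //.
have -> : \sum_r \sum_r' H r' r * (((cls i0 f r.1 == cls i0 f r'.1)%:R - (r.1 == r'.1)%:R)
        * \sum_q Phi r.1 r.2 q * conjc (Phi r'.1 r'.2 q)) =
  \sum_(J : {set 'I_m} | (i0 \notin J) && (J != finset.set0))
    \sum_r \sum_r' H r' r * ((mask R f J r.1 r'.1)%:C * tau Phi (~: J) r r').
  rewrite [RHS]exchange_big /=; apply: eq_bigr => r _.
  rewrite [RHS]exchange_big /=; apply: eq_bigr => r' _; rewrite -mulr_sumr; congr (_ * _).
  have -> : (cls i0 f r.1 == cls i0 f r'.1)%:R - (r.1 == r'.1)%:R =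
    ((cls i0 f r.1 == cls i0 f r'.1)%:R - (r.1 == r'.1)%:R : R)%:C.
    by rewrite rmorphB /= !rc_nat.
  rewrite mask_total rc_sum mulr_suml; apply: eq_bigr => J _.
  by rewrite rcM rc_nat /tau -mulrA.
rewrite Re_sum; apply: ler_sum => J /andP [iJ _].
exact: decode_pattern (hu J iJ) (l0 J) (l1 J) cH.
Qed.
End DecodeSmooth.

(** * Sums over dependent products, and averages over random functions *)

Section Dffun.
Variables (I : finType) (T : I -> finType).
Implicit Types (x : Jt T).

Lemma sum_prod_dffun (S : comPzSemiRingType) (F : forall i, T i -> S) :
  \sum_(x : Jt T) \prod_i F i (x i) = \prod_i \sum_(t : T i) F i t.
Proof.
pose P_ i : {ffun T i -> S} := [ffun t => F i t].
transitivity (\sum_(x : fprod T) \prod_(i in I) P_ i (x i)).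
  rewrite (reindex (@dffun_of_fprod I T)) /=; last exact/onW_bij/dffun_of_fprod_bij.
  by apply: eq_bigr => x _; apply: eq_bigr => i _; rewrite !ffunE.
rewrite big_fprod.
transitivity (\prod_i \sum_(j in tagged_with T i) untag 0 (P_ i) j).
  by rewrite bigA_distr_big_dep.
apply: eq_bigr => i _; rewrite -(big_tag (fun i t => P_ i t)).
by apply: eq_bigr => t _; rewrite ffunE.
Qed.

Lemma card_Jt : #|Jt T| = (\prod_i #|T i|)%N.
Proof.
by rewrite card_dep_ffun foldrE big_map big_enum.
Qed.

Definition setc x i (v : T i) : Jt T := finfun (@eqtype.dfwith I (fun i => T i : Type) x i v).

Lemma setc_in x i (v : T i) : setc x v i = v.
Proof. by rewrite ffunE dfwith_in. Qed.
Lemma setc_out x i (v : T i) j : i != j -> setc x v j = x j.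
Proof. by move=> h; rewrite ffunE dfwith_out. Qed.
Lemma setc_id x i : setc x (x i) = x.
Proof.
apply/ffunP => j; case: (eqVneq i j) => [<-|h]; by rewrite ?setc_in ?setc_out.
Qed.
Lemma setcC x i (v v' : T i) : setc (setc x v) v' = setc x v'.
Proof.
apply/ffunP => j; case: (eqVneq i j) => [<-|h]; by rewrite ?setc_in ?setc_out.
Qed.

Lemma sum_setc (S : nmodType) i (t0 : T i) (F : Jt T -> S) :
  \sum_x F x = \sum_(x : Jt T | x i == t0) \sum_(t : T i) F (setc x t).
Proof.
rewrite (partition_big (fun x : Jt T => x i) xpredT) //= [RHS]exchange_big /=.
apply: eq_bigr => t _.
rewrite (reindex_onto (fun x : Jt T => setc x t) (fun x : Jt T => setc x t0)) /=; last first.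
  by move=> x /eqP <-; rewrite setcC setc_id.
apply: eq_bigl => x; rewrite setc_in eqxx setcC /=.
by apply/eqP/eqP => [<-|<-]; rewrite ?setc_in ?setc_id.
Qed.
End Dffun.

Section Averages.
Variable R : realType.
Local Notation C := R[i].
Local Notation "x %:C" := (real_complex R x).

Lemma card_ffun_gt0 (A B : finType) : (0 < #|B|)%N -> (0 < #|{ffun A -> B}|)%N.
Proof. by move=> h; rewrite card_ffun expn_gt0 h. Qed.

(** The values of a uniformly random function at two distinct points are independent and uniform:
    each pair of values is taken by |B|^(|A| - 2) functions. *)
Lemma sum_ffun2 (A B : finType) (a a' : A) (F : B -> B -> R) : a != a' -> (0 < #|B|)%N ->
  \sum_(g : {ffun A -> B}) F (g a) (g a') =
  #|{ffun A -> B}|%:R * (#|B|%:R ^+ 2)^-1 * \sum_b \sum_b' F b b'.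
Proof.
move=> aa' B0.
have B0' : #|B|%:R != 0 :> R by rewrite pnatr_eq0 -lt0n.
transitivity (\sum_b \sum_b' F b b' * \sum_(g : {ffun A -> B}) ((g a == b) && (g a' == b'))%:R).
  under [RHS]eq_bigr do under eq_bigr do rewrite mulr_sumr.
  under [RHS]eq_bigr do rewrite exchange_big /=.
  rewrite [RHS]exchange_big /=; apply: eq_bigr => g _.
  rewrite (bigD1 (g a)) //= [X in _ + X]big1 ?addr0; last first.
    by move=> b hb; rewrite big1 // => b' _; rewrite eq_sym (negPf hb) mulr0.
  rewrite (bigD1 (g a')) //= [X in _ + X]big1 ?addr0 ?eqxx ?mulr1 //.
  by move=> b hb; rewrite [g a' == _]eq_sym (negPf hb) andbF mulr0.
rewrite mulr_sumr; apply: eq_bigr => b _; rewrite mulr_sumr; apply: eq_bigr => b' _.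
rewrite mulrC; congr (_ * _).
pose P c d := (if c == a then d == b else true) && (if c == a' then d == b' else true).
transitivity (\sum_(g : {ffun A -> B}) \prod_c ((P c (g c))%:R : R)).
  apply: eq_bigr => g _.
  case hg: ((g a == b) && (g a' == b')).
    rewrite big1 // => c _; rewrite /P; move/andP: hg => [h1 h2].
    by case: eqP => [->|_]; rewrite ?h1; case: eqP => [->|_]; rewrite ?h2.
  move/negbT: hg; rewrite negb_and => /orP [h|h].
    by rewrite (bigD1 a) //= /P eqxx (negPf h) mul0r.
  by rewrite (bigD1 a') //= /P eqxx (negPf h) andbF mul0r.
have -> : \sum_(g : {ffun A -> B}) \prod_c ((P c (g c))%:R : R) = \prod_c \sum_(d : B) (P c d)%:R.
  by rewrite bigA_distr_bigA.
have single (d0 : B) : \sum_(d : B) ((d == d0)%:R : R) = 1.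
  by rewrite (bigD1 d0) //= eqxx big1 ?addr0 // => d /negPf ->.
have hP c : \sum_(d : B) (P c d)%:R = (if (c == a) || (c == a') then 1 else #|B|%:R) :> R.
  rewrite /P; case: eqP => [->|_] /=.
    by rewrite (negPf aa'); under eq_bigr do rewrite andbT.
  case: eqP => _ //=.
  by rewrite sumr_const.
rewrite (eq_bigr _ (fun c _ => hP c)).
rewrite (bigD1 a) //= (bigD1 a') //= ?eqxx ?orbT ?mul1r; last by rewrite eq_sym.
rewrite (eq_bigr (fun=> #|B|%:R)); last by move=> c /andP [/negPf -> /negPf ->].
rewrite prodr_const card_ffun natrX.
have -> : #|[pred i : A | (i != a) && (i != a')]| = (#|A| - 2)%N.
  have := cardC (pred2 a a'); rewrite card2 aa' => e.
  by rewrite -e /= addKn; apply: eq_card => c; rewrite !inE negb_or.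
have A2 : (2 <= #|A|)%N by have := max_card (pred2 a a'); rewrite card2 aa'.
by rewrite -{2}(subnK A2) exprD -mulrA mulfV ?mulr1 // expf_neq0.
Qed.

Lemma avg_collision (A B : finType) (a a' : A) : a != a' -> (0 < #|B|)%N ->
  \sum_(g : {ffun A -> B}) ((g a == g a')%:R : R) = #|{ffun A -> B}|%:R * #|B|%:R^-1.
Proof.
move=> aa' B0; rewrite (sum_ffun2 (fun b b' => (b == b')%:R) aa' B0) -mulrA; congr (_ * _).
have -> : \sum_(b : B) \sum_(b' : B) ((b == b')%:R : R) = #|B|%:R.
  rewrite (eq_bigr (fun=> 1)); last first.
    by move=> b _; rewrite (bigD1 b) //= eqxx big1 ?addr0 // => d; rewrite eq_sym => /negPf ->.
  by rewrite sumr_const.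
by rewrite expr2 invfM -mulrA mulVf ?mulr1 // pnatr_eq0 -lt0n.
Qed.

Section RandomCode.
Variables (m : nat) (X Cc : 'I_m -> finType).
Hypothesis Cc0 : forall l, (0 < #|Cc l|)%N.
Definition codes : finType := Jt (fun l => {ffun X l -> Cc l} : finType).

Lemma codes_gt0 : (0 < #|codes|)%N.
Proof. by rewrite card_Jt prodn_gt0 // => l; exact: card_ffun_gt0. Qed.

(** The hashes at different positions are independent. A factor vanishes if the outcomes agree
    there; otherwise its square is the indicator of a collision, of probability 1 / |Cc l|. *)
Lemma avg_mask (J : {set 'I_m}) (x x' : Jt X) :
  \sum_(f : codes) mask R (fun l => f l) J x x' ^+ 2 <=
  #|codes|%:R * \prod_(l in J) (#|Cc l|%:R^-1).
Proof.
pose g l (h : {ffun X l -> Cc l}) : R := if l \in J then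
  ((h (x l) == h (x' l))%:R - (x l == x' l)%:R) ^+ 2 else 1.
have -> : \sum_(f : codes) mask R (fun l => f l) J x x' ^+ 2 = \prod_l \sum_(h : {ffun X l -> Cc l}) g l h.
  rewrite -(sum_prod_dffun (fun l (h : {ffun X l -> Cc l} : finType) => g l h)).
  apply: eq_bigr => f _; rewrite /mask -prodrXl big_mkcond; apply: eq_bigr => l _.
  by rewrite /g.
rewrite card_Jt natr_prod [\prod_(l in J) _]big_mkcond -big_split /=.
apply: ler_prod => l _; apply/andP; split.
  by apply: sumr_ge0 => h _; rewrite /g; case: ifP => _ //; rewrite sqr_ge0.
rewrite /g; case: ifP => _; last by rewrite sumr_const mulr1.
case: (eqVneq (x l) (x' l)) => [->|h].
  rewrite big1; first by rewrite mulr_ge0 ?invr_ge0.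
  by move=> h _; rewrite !eqxx subrr expr0n.
rewrite -(avg_collision h (Cc0 l)); apply: ler_sum => g' _.
by rewrite subr0; case: eqP; rewrite ?expr1n ?expr0n.
Qed.

Lemma avg_hs2_mask (G : finType) (J : {set 'I_m}) (Y : op R (Jt X * G)%type (Jt X * G)%type) :
  \sum_(f : codes) hs2 (fun r r' => (mask R (fun l => f l) J r.1 r'.1)%:C * Y r r') <=
  #|codes|%:R * (\prod_(l in J) (#|Cc l|%:R^-1)) * hs2 Y.
Proof.
rewrite /hs2 /nrm2 exchange_big mulr_sumr; apply: ler_sum => r _.
rewrite exchange_big mulr_sumr; apply: ler_sum => r' _.
under eq_bigr do rewrite sqnM sqnC.
by rewrite -mulr_suml ler_wpM2r ?sqn_ge0 // avg_mask.
Qed.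
End RandomCode.

End Averages.

(** * Privacy amplification *)

Section Privacy.
Variable R : realType.
Local Notation C := R[i].
Local Notation "x %:C" := (real_complex R x).
Local Notation Re := (@complex.Re R).
Variables (X G Q K A Cc Kt : finType) (Phi : X -> G -> Q -> C).
Variables (w : X -> K -> G -> C) (l' : X -> K -> R) (Sz : pred (X * K)).
Hypothesis hw : forall x, spectral (gram (Phi x)) (w x) (l' x).
Hypothesis l1 : \sum_xk l' xk.1 xk.2 = 1.
Variables (v : A -> G -> C) (p : A -> R) (SB : pred A).
Hypothesis hv : spectral (fun b b' => \sum_x gram (Phi x) b b') v p.
Hypothesis Kt0 : (0 < #|Kt|)%N.
Variable f : X -> Cc.

Let l0 x k : 0 <= l' x k. Proof. exact: spectral_gram_ge0 (hw x). Qed.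
Let w1 x k : nrm2 (w x k) = 1.
Proof. by apply: (@complexI R); rewrite -inner_nrm2 (hw x).1 eqxx. Qed.

Definition smoothed_block_state x : op R G G :=
  trunc (fun k => Sz (x, k)) (l' x) (fun k => prj v SB (w x k)).

Section Fixed.
Variable g : X -> Kt.
(** The indicator of key [kap] minus its mean, on the outcomes of hash [c]: centred, so that
    distinct outcomes are uncorrelated under a random [g]. *)
Definition key_coef c kap x : R := (f x == c)%:R * ((g x == kap)%:R - (#|Kt|%:R)^-1).
Definition key_dev c kap : op R G G :=
  fun b b' => \sum_x (key_coef c kap x)%:C * smoothed_block_state x b b'.

(** The amplitudes at hash [c] and key [kap]; [key_target] has the ideal ones, with a uniform key of
    which [G] knows nothing. In both, everything besides [G] sits in [X * Q], where the contraction
    acts. *)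
Definition key_state c kap b (xq : X * Q) : C :=
  (f xq.1 == c)%:R * ((g xq.1 == kap)%:R * Phi xq.1 b xq.2).
Definition key_target c b (xq : X * Q) : C :=
  (Num.sqrt (#|Kt|%:R^-1))%:C * ((f xq.1 == c)%:R * Phi xq.1 b xq.2).

Lemma privacy_loss :
  \sum_xk l' xk.1 xk.2 * nrm2 (fun t => w xk.1 xk.2 t - (if Sz xk then prj v SB (w xk.1 xk.2) t else 0)) <=
  (1 - \sum_(xk | Sz xk) l' xk.1 xk.2) + (1 - \sum_(a | SB a) p a).
Proof.
have ov := hv.1.
have e : \sum_(a | SB a) p a = \sum_xk l' xk.1 xk.2 * nrm2 (prj v SB (w xk.1 xk.2)).
  under [RHS]eq_bigr do rewrite nrm2_prj // mulr_sumr.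
  rewrite [RHS]exchange_big /=; apply: eq_bigr => a _; apply: (@complexI R) => /=.
  have -> : (p a)%:C = inner (v a) (ap (fun b b' => \sum_x gram (Phi x) b b') (v a)).
    by rewrite (eq_inner (fun _ => erefl) (spectral_eig a hv)) innerZr ov eqxx mulr1.
  have -> : inner (v a) (ap (fun b b' => \sum_x gram (Phi x) b b') (v a)) =
    \sum_x inner (v a) (ap (gram (Phi x)) (v a)).
    rewrite /inner exchange_big /=; apply: eq_bigr => b _; rewrite -mulr_sumr; congr (_ * _).
    by rewrite /ap exchange_big /=; apply: eq_bigr => b' _; rewrite mulr_suml.
  rewrite rc_sum; transitivity (\sum_x \sum_k (l' x k * sqn (inner (v a) (w x k)))%:C); last first.
    by rewrite pair_big; apply: eq_bigr => -[].
  apply: eq_bigr => x _; rewrite (inner_spectral _ _ (hw x)); apply: eq_bigr => k _.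
  by rewrite rcM -sqnE innerJ; ring.
rewrite e [\sum_(c | Sz c) _]big_mkcond -{1 2}l1 -!sumrB -big_split /=; apply: ler_sum => -[x k] _ /=.
have p1 : nrm2 (prj v SB (w x k)) <= 1 by rewrite -(w1 x k) nrm2_prj_le.
case: ifP => _.
  have -> : nrm2 (fun t => w x k t - prj v SB (w x k) t) = 1 - nrm2 (prj v SB (w x k)).
    by rewrite nrm2_prjC // w1.
  by rewrite subrr add0r mulrBr mulr1.
have -> : nrm2 (fun t => w x k t - 0) = 1.
  by rewrite -(w1 x k); apply: eq_nrm2 => t; rewrite subr0.
have := ler_wpM2l (l0 x k) p1; lra.
Qed.

Lemma key_dev_prj c kap r r' :
  key_dev c kap r r' = \sum_(a | SB a) inner (v a) (key_dev c kap ^~ r') * v a r.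
Proof.
have ov := hv.1.
pose a_ (xk : X * K) := if Sz xk then (key_coef c kap xk.1)%:C * ((l' xk.1 xk.2)%:C
   * conjc (prj v SB (w xk.1 xk.2) r')) else 0.
have es t : key_dev c kap t r' = \sum_xk a_ xk * prj v SB (w xk.1 xk.2) t.
  transitivity (\sum_x \sum_k a_ (x, k) * prj v SB (w x k) t); last first.
    by rewrite pair_big; apply: eq_bigr => -[].
  apply: eq_bigr => x _; rewrite /smoothed_block_state /trunc mulr_sumr big_mkcond /=.
  apply: eq_bigr => k _; rewrite /a_ /=; case: ifP => _; last by rewrite mul0r.
  by ring.
under [RHS]eq_bigr do rewrite (eq_inner (fun _ => erefl) es) inner_sumr mulr_suml.
rewrite exchange_big es /=; apply: eq_bigr => xk _.
rewrite -(prj_idem SB _ ov) {1}/prj mulr_sumr.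
by apply: eq_bigr => s _; rewrite mulrA.
Qed.

(** Uhlmann is applied for every hash and key separately. The reduced states differ by a sum
    weighted with [key_coef]; after smoothing, what is left is [key_dev], of rank at most |SB|. *)
Lemma privacy_oneshot : exists U : Cc -> Kt -> op R (X * Q)%type (X * Q)%type,
  (forall c kap, contr (U c kap)) /\
  1 - (4 * Num.sqrt ((1 - \sum_(xk | Sz xk) l' xk.1 xk.2) + (1 - \sum_(a | SB a) p a))
       + Num.sqrt (#|SB|%:R * (#|Cc| * #|Kt|)%:R * \sum_c \sum_kap hs2 (key_dev c kap))) / 2
  <= Re (\sum_c \sum_kap \sum_b inner (key_target c b) (ap (U c kap) (key_state c kap b))).
Proof.
have ov := hv.1.
have /choice [U' /choice [H' hU]] := fun ck : Cc * Kt => uhlmann (key_state ck.1 ck.2) (key_target ck.1).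
pose H c kap := H' (c, kap).
exists (fun c kap => U' (c, kap)); split; first by move=> c kap; case: (hU (c, kap)).
have cH c kap : contr (H c kap) by case: (hU (c, kap)).
have Kn0 : #|Kt|%:R != 0 :> R by rewrite pnatr_eq0 -lt0n.
have sPhi : \sum_x hs2 (Phi x) = 1.
  rewrite -l1 -(pair_bigA _ (fun x k => l' x k)) /=; apply: eq_bigr => x _.
  by rewrite (spectral_trace (hw x)).
have sumM : \sum_c \sum_kap hs2 (key_state c kap) = 1.
  rewrite -sPhi.
  transitivity (\sum_b \sum_x \sum_q \sum_c \sum_kap sqn (key_state c kap b (x, q))).
    rewrite pair_big; under eq_bigr do rewrite /hs2; rewrite exchange_big /=.
    apply: eq_bigr => b _; under eq_bigr do rewrite nrm2_curry.
    rewrite exchange_big /=; apply: eq_bigr => x _; rewrite exchange_big /=.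
    by apply: eq_bigr => q _; rewrite pair_big.
  rewrite exchange_big /=; apply: eq_bigr => x _; apply: eq_bigr => b _; apply: eq_bigr => q _.
  rewrite (bigD1 (f x)) //= [X in _ + X]big1 ?addr0; last first.
    by move=> c hc; rewrite big1 // => kap _; rewrite /key_state /= eq_sym (negPf hc) mul0r sqn0.
  rewrite (bigD1 (g x)) //= [X in _ + X]big1 ?addr0; last first.
    by move=> kap hk; rewrite /key_state /= [g x == _]eq_sym (negPf hk) mul0r mulr0 sqn0.
  by rewrite /key_state /= !eqxx !mul1r.
have sumN : \sum_(c : Cc) \sum_(kap : Kt) hs2 (key_target c) = 1.
  rewrite -sPhi.
  transitivity (\sum_b \sum_x \sum_q \sum_c \sum_(kap : Kt) sqn (key_target c b (x, q))).
    rewrite pair_big; under eq_bigr do rewrite /hs2; rewrite exchange_big /=.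
    apply: eq_bigr => b _; under eq_bigr do rewrite nrm2_curry.
    rewrite exchange_big /=; apply: eq_bigr => x _; rewrite exchange_big /=.
    by apply: eq_bigr => q _; rewrite pair_big.
  rewrite exchange_big /=; apply: eq_bigr => x _; apply: eq_bigr => b _; apply: eq_bigr => q _.
  rewrite (bigD1 (f x)) //= [X in _ + X]big1 ?addr0; last first.
    by move=> c hc; rewrite big1 // => kap _; rewrite /key_target /= eq_sym (negPf hc) mul0r mulr0 sqn0.
  rewrite sumr_const /key_target /= eqxx mul1r sqnM sqnC sqr_sqrtr ?invr_ge0 //.
  by rewrite -[LHS]mulr_natl mulrA mulfV ?mul1r.
have gM c kap b b' : gram (key_state c kap) b b' - gram (key_target c) b b' =
  \sum_x (key_coef c kap x)%:C * gram (Phi x) b b'.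
  rewrite /gram.
  have -> : \sum_e key_state c kap b e * conjc (key_state c kap b' e) =
    \sum_x \sum_q key_state c kap b (x, q) * conjc (key_state c kap b' (x, q)).
    by rewrite pair_big; apply: eq_bigr => -[].
  have -> : \sum_e key_target c b e * conjc (key_target c b' e) =
    \sum_x \sum_q key_target c b (x, q) * conjc (key_target c b' (x, q)).
    by rewrite pair_big; apply: eq_bigr => -[].
  rewrite -sumrB; apply: eq_bigr => x _; rewrite -sumrB mulr_sumr; apply: eq_bigr => q _.
  rewrite /key_state /key_target /key_coef /= !conjcM !conjc_natr conjc_rc.
  rewrite rcM [((g x == kap)%:R - _)%:C]rmorphB /= !rc_nat.
  have -> : (#|Kt|%:R^-1)%:C = (Num.sqrt (#|Kt|%:R^-1))%:C * (Num.sqrt (#|Kt|%:R^-1))%:C.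
    by rewrite -rcM -expr2 sqr_sqrtr ?invr_ge0.
  by case: (f x == c); case: (g x == kap); rewrite /= ?mul0r ?mulr0 ?mul1r; ring.
have h3 c kap : (hs2 (key_state c kap) + hs2 (key_target c) -
   Re (\sum_r \sum_r' H c kap r' r * (gram (key_state c kap) r r' - gram (key_target c) r r'))) / 2
   <= Re (\sum_r inner (key_target c r) (ap (U' (c, kap)) (key_state c kap r))).
  by case: (hU (c, kap)).
have h4 := @ler_sum _ _ (index_enum _) xpredT _ _
  (fun c _ => @ler_sum _ _ (index_enum _) xpredT _ _ (fun kap _ => h3 c kap)).
have e4 : \sum_c \sum_kap (hs2 (key_state c kap) + hs2 (key_target c) -
   Re (\sum_r \sum_r' H c kap r' r * (gram (key_state c kap) r r' - gram (key_target c) r r'))) / 2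
  = 1 - (\sum_c \sum_kap Re (\sum_r \sum_r' H c kap r' r *
      (gram (key_state c kap) r r' - gram (key_target c) r r'))) / 2.
  transitivity ((1 + 1 - (\sum_c \sum_kap Re (\sum_r \sum_r' H c kap r' r *
      (gram (key_state c kap) r r' - gram (key_target c) r r')))) / 2); last by field.
  rewrite -[X in X + 1]sumM -[X in _ + X - _]sumN -big_split -sumrB mulr_suml; apply: eq_bigr => c _.
  by rewrite -big_split -sumrB mulr_suml.
rewrite e4 in h4; rewrite Re_sum; under [leRHS]eq_bigr do rewrite Re_sum.
apply: le_trans h4; rewrite lerD2l lerN2 ler_wpM2r ?invr_ge0 //.
pose F x b' b := \sum_c \sum_kap (key_coef c kap x)%:C * H c kap b' b.
pose vt (xk : X * K) t := if Sz xk then prj v SB (w xk.1 xk.2) t else 0.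
(* [F x] is [H] at the hash and key of [x] minus the average of [H] over all keys: a contraction
   minus a mean of contractions. The 4 of the statement is 2 times this 2. *)
have bF x : bounded 2 (F x).
  have bs : bounded 1 (fun b' b => \sum_kap (#|Kt|%:R^-1)%:C * H (f x) kap b' b).
    move=> z; rewrite expr1n mul1r.
    have -> : nrm2 (ap (fun b' b => \sum_kap (#|Kt|%:R^-1)%:C * H (f x) kap b' b) z) =
       nrm2 (fun b' => \sum_kap (#|Kt|%:R^-1)%:C * ap (H (f x) kap) z b').
      apply: eq_nrm2 => b'; rewrite /ap.
      under eq_bigr do rewrite mulr_suml.
      rewrite exchange_big /=; apply: eq_bigr => kap _; rewrite mulr_sumr.
      by apply: eq_bigr => b _; rewrite mulrA.
    apply: (@le_trans _ _ (\sum_kap #|Kt|%:R^-1 * nrm2 (ap (H (f x) kap) z))).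
      rewrite /nrm2; under [leRHS]eq_bigr do rewrite mulr_sumr.
      rewrite [leRHS]exchange_big /=; apply: ler_sum => b _.
      have -> : \sum_kap (#|Kt|%:R^-1)%:C * ap (H (f x) kap) z b =
        inner (fun kap : Kt => (#|Kt|%:R^-1)%:C) (fun kap => ap (H (f x) kap) z b).
        by apply: eq_bigr => kap _; rewrite conjc_rc.
      apply: le_trans (CS_sqn _ _) _.
      have -> : nrm2 (fun kap : Kt => (#|Kt|%:R^-1)%:C) = #|Kt|%:R^-1.
        rewrite /nrm2; under eq_bigr do rewrite sqnC.
        by rewrite sumr_const -[LHS]mulr_natl expr2 mulrA mulfV // mul1r.
      by rewrite /nrm2 mulr_sumr.
    rewrite -mulr_sumr; apply: (@le_trans _ _ (#|Kt|%:R^-1 * \sum_(kap : Kt) nrm2 z)).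
      by rewrite ler_wpM2l ?invr_ge0 //; apply: ler_sum => kap _; exact: cH.
    by rewrite sumr_const -[nrm2 z *+ _]mulr_natl mulrA mulVf ?mul1r.
  have := boundedB (contr_bounded (cH (f x) (g x))) bs; rewrite mulr1.
  apply: eq_bounded => b' b; rewrite /F [RHS](bigD1 (f x)) //= [X in _ = _ + X]big1 ?addr0; last first.
    by move=> c hc; rewrite big1 // => kap _; rewrite /key_coef eq_sym (negPf hc) mul0r mul0r.
  have -> : H (f x) (g x) b' b = \sum_kap (g x == kap)%:R * H (f x) kap b' b.
    rewrite (bigD1 (g x)) //= eqxx mul1r big1 ?addr0 // => kap hk.
    by rewrite eq_sym (negPf hk) mul0r.
  rewrite -sumrB; apply: eq_bigr => kap _; rewrite /key_coef eqxx mul1r.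
  by rewrite [(_ - _)%:C]rmorphB /= rc_nat; ring.
have -> : \sum_c \sum_kap Re (\sum_r \sum_r' H c kap r' r * (gram (key_state c kap) r r' - gram (key_target c) r r'))
  = Re (\sum_xk (l' xk.1 xk.2)%:C * (inner (w xk.1 xk.2) (ap (F xk.1) (w xk.1 xk.2))
     - inner (vt xk) (ap (F xk.1) (vt xk)))) +
    \sum_c \sum_kap Re (\sum_r \sum_r' H c kap r' r * key_dev c kap r r').
  under [LHS]eq_bigr do rewrite -Re_sum.
  under [X in _ = _ + X]eq_bigr do rewrite -Re_sum.
  rewrite -!Re_sum -ReD; congr Re.
  have swap (Y : X -> op R G G) : \sum_c \sum_kap \sum_r \sum_r' H c kap r' r * (\sum_x (key_coef c kap x)%:C * Y x r r')
    = \sum_x \sum_r \sum_r' F x r' r * Y x r r'.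
    rewrite [RHS]exchange_big [LHS]pair_big [LHS]exchange_big /=; apply: eq_bigr => r _.
    rewrite [RHS]exchange_big [LHS]exchange_big /=; apply: eq_bigr => r' _.
    under eq_bigr do rewrite mulr_sumr.
    rewrite exchange_big /=; apply: eq_bigr => x _; rewrite /F pair_big mulr_suml.
    by apply: eq_bigr => ck _; ring.
  rewrite /key_dev swap.
  have -> : \sum_c \sum_kap \sum_r \sum_r' H c kap r' r * (gram (key_state c kap) r r' - gram (key_target c) r r')
    = \sum_x \sum_r \sum_r' F x r' r * gram (Phi x) r r'.
    rewrite -swap; apply: eq_bigr => c _; apply: eq_bigr => kap _.
    by apply: eq_bigr => r _; apply: eq_bigr => r' _; rewrite gM.
  have -> : \sum_xk (l' xk.1 xk.2)%:C * (inner (w xk.1 xk.2) (ap (F xk.1) (w xk.1 xk.2))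
     - inner (vt xk) (ap (F xk.1) (vt xk))) = \sum_x \sum_k (l' x k)%:C *
     (inner (w x k) (ap (F x) (w x k)) - inner (vt (x, k)) (ap (F x) (vt (x, k)))).
    by rewrite pair_big; apply: eq_bigr => -[].
  rewrite -big_split /=; apply: eq_bigr => x _.
  rewrite form_trunc.
  have -> : \sum_r \sum_r' F x r' r * gram (Phi x) r r' = \sum_k (l' x k)%:C * inner (w x k) (ap (F x) (w x k)).
    rewrite -[RHS]form_trunc; apply: eq_bigr => r _; apply: eq_bigr => r' _.
    by rewrite (hw x).2; congr (_ * _); apply: eq_bigr => k _; ring.
  rewrite [X in _ = _ + X]big_mkcond -big_split /=; apply: eq_bigr => k _.
  case: ifP => Sk.
    rewrite -mulrDr; congr (_ * _); rewrite -[LHS]addr0 -addrA; congr (_ + _).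
    have e : vt (x, k) =1 prj v SB (w x k) by move=> t; rewrite /vt Sk.
    by rewrite (eq_inner e (eq_ap (fun _ _ => erefl) e)) addNr.
  rewrite addr0; have -> : inner (vt (x, k)) (ap (F x) (vt (x, k))) = 0.
    by rewrite /inner big1 // => t _; rewrite /vt Sk conjc0 mul0r.
  by rewrite subr0.
apply: lerD.
  have hvt xk : nrm2 (vt xk) <= 1.
    case Sc: (Sz xk).
      rewrite -(w1 xk.1 xk.2); apply: le_trans (nrm2_prj_le SB (w xk.1 xk.2) ov).
      by rewrite (@eq_nrm2 _ _ (vt xk) (prj v SB (w xk.1 xk.2))) // => t; rewrite /vt Sc.
    by rewrite /nrm2 big1 // => t _; rewrite /vt Sc sqn0.
  apply: le_trans (@smooth_diff _ _ _ (fun xk => F xk.1) 2 (fun xk => l' xk.1 xk.2)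
    (fun xk => w xk.1 xk.2) vt _ (fun xk => bF xk.1) _ hvt _ _) _ => //.
  - by move=> xk; rewrite w1.
  - by rewrite l1.
  have -> : 2 * 2 = 4 :> R by ring.
  by rewrite ler_wpM2l ?ler0n // ler_wsqrtr // privacy_loss.
rewrite pair_big /=.
(* The factor 1 prepares Cauchy-Schwarz over the pairs (c, kap), which brings in |Cc| |Kt|. *)
apply: (@le_trans _ _ (\sum_(ck : Cc * Kt) 1 * Num.sqrt (#|SB|%:R * hs2 (key_dev ck.1 ck.2)))).
  by apply: ler_sum => ck _; rewrite mul1r; exact: hs_bound (key_dev_prj ck.1 ck.2).
apply: le_trans (real_CS _ _ _) _.
rewrite -sqrtrM; last by apply: sumr_ge0 => ck _; rewrite sqr_ge0.
apply: ler_wsqrtr.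
have -> : \sum_(ck : Cc * Kt) (1 : R) ^+ 2 = (#|Cc| * #|Kt|)%:R.
  by rewrite expr1n sumr_const card_prod.
have -> : \sum_(ck : Cc * Kt) Num.sqrt (#|SB|%:R * hs2 (key_dev ck.1 ck.2)) ^+ 2 =
   #|SB|%:R * \sum_c \sum_kap hs2 (key_dev c kap).
  rewrite pair_big mulr_sumr /=; apply: eq_bigr => ck _.
  by rewrite sqr_sqrtr ?mulr_ge0 ?hs2_ge0.
by rewrite mulrCA mulrA.
Qed.
End Fixed.
End Privacy.

(** * Second moments of a random key function *)

Section AverageKey.
Variable R : realType.
Local Notation C := R[i].
Local Notation "x %:C" := (real_complex R x).
Local Notation Re := (@complex.Re R).
Variables (X G Cc Kt : finType) (f : X -> Cc).
Hypothesis Kt0 : (0 < #|Kt|)%N.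

Lemma sum_delta (k0 : Kt) : \sum_(k : Kt) ((k0 == k)%:R : R) = 1.
Proof. by rewrite (bigD1 k0) //= eqxx big1 ?addr0 // => k; rewrite eq_sym => /negPf ->. Qed.

Lemma avg_key_coef_neq (x x' : X) (c : Cc) kap : x != x' ->
  \sum_(g : {ffun X -> Kt}) key_coef R f g c kap x * key_coef R f g c kap x' = 0.
Proof.
have Kn0 : #|Kt|%:R != 0 :> R by rewrite pnatr_eq0 -lt0n.
have zero (k0 : Kt) : \sum_(k : Kt) ((k == k0)%:R - #|Kt|%:R^-1) = 0 :> R.
  rewrite sumrB; under eq_bigr do rewrite eq_sym.
  by rewrite sum_delta sumr_const -[_^-1 *+ _]mulr_natl mulfV ?subrr.
move=> xx'.
transitivity (((f x == c)%:R * (f x' == c)%:R) *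
  \sum_(g : {ffun X -> Kt}) ((g x == kap)%:R - #|Kt|%:R^-1) * ((g x' == kap)%:R - #|Kt|%:R^-1) : R).
  by rewrite mulr_sumr; apply: eq_bigr => g _; rewrite /key_coef; ring.
rewrite (sum_ffun2 (fun b b' : Kt => ((b == kap)%:R - #|Kt|%:R^-1) * ((b' == kap)%:R - #|Kt|%:R^-1)) xx' Kt0).
have -> : \sum_(b : Kt) \sum_(b' : Kt) ((b == kap)%:R - #|Kt|%:R^-1) * ((b' == kap)%:R - #|Kt|%:R^-1) = 0 :> R.
  by rewrite big1 // => b _; rewrite -mulr_sumr zero mulr0.
by rewrite !mulr0.
Qed.

Lemma key_coef_sqr (x : X) (g : X -> Kt) (c : Cc) :
  \sum_kap key_coef R f g c kap x ^+ 2 <= (f x == c)%:R.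
Proof.
have Kn0 : #|Kt|%:R != 0 :> R by rewrite pnatr_eq0 -lt0n.
rewrite /key_coef; case: (f x == c); last by rewrite big1 // => k _; rewrite mul0r expr0n.
under eq_bigr do rewrite mul1r.
have -> : \sum_k ((g x == k)%:R - #|Kt|%:R^-1) ^+ 2 = 1 - #|Kt|%:R^-1 :> R.
  transitivity (\sum_k ((g x == k)%:R - #|Kt|%:R^-1 * (2 * (g x == k)%:R - #|Kt|%:R^-1)) : R).
    by apply: eq_bigr => k _; case: (g x == k); rewrite /= ?mulr1n ?mulr0n; ring.
  rewrite sumrB sum_delta; congr (_ - _); rewrite -mulr_sumr sumrB -mulr_sumr sum_delta sumr_const.
  rewrite -[_^-1 *+ #|Kt|]mulr_natl mulfV //; ring.
by rewrite lerBlDr lerDl invr_ge0.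
Qed.

Lemma sqn_real_comb (I : finType) (a : I -> R) (y : I -> C) :
  sqn (\sum_i (a i)%:C * y i) = \sum_i \sum_j a i * a j * Re (conjc (y i) * y j).
Proof.
rewrite /sqn mulrC conjc_sum mulr_suml Re_sum; apply: eq_bigr => i _.
rewrite mulr_sumr Re_sum; apply: eq_bigr => j _; rewrite conjcM conjc_rc.
by rewrite mulrACA -rcM Re_rM.
Qed.

(** The cross terms average to 0 by [avg_key_coef_neq]; the squares sum over [c] and [kap] to at
    most 1. Here [f] is fixed and [g] alone is random. *)
Lemma avg_key_dev (Y : X -> op R G G) :
  \sum_(g : {ffun X -> Kt}) \sum_c \sum_kap
     hs2 (fun b b' => \sum_x (key_coef R f g c kap x)%:C * Y x b b') <=
  #|{ffun X -> Kt}|%:R * \sum_x hs2 (Y x).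
Proof.
have pt (y : X -> C) : \sum_(g : {ffun X -> Kt}) \sum_c \sum_kap
   sqn (\sum_x (key_coef R f g c kap x)%:C * y x) <= #|{ffun X -> Kt}|%:R * \sum_x sqn (y x).
  under eq_bigr do under eq_bigr do under eq_bigr do rewrite sqn_real_comb.
  have -> : \sum_(g : {ffun X -> Kt}) \sum_c \sum_kap \sum_x \sum_x'
      key_coef R f g c kap x * key_coef R f g c kap x' * Re (conjc (y x) * y x') =
    \sum_(g : {ffun X -> Kt}) \sum_c \sum_kap \sum_x key_coef R f g c kap x ^+ 2 * sqn (y x).
    rewrite exchange_big [RHS]exchange_big /=; apply: eq_bigr => c _.
    rewrite exchange_big [RHS]exchange_big /=; apply: eq_bigr => kap _.
    rewrite exchange_big [RHS]exchange_big /=; apply: eq_bigr => x _.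
    rewrite exchange_big (bigD1 x) //= [X in _ + X]big1 ?addr0; last first.
      by move=> x' xx'; rewrite -mulr_suml avg_key_coef_neq ?mul0r // eq_sym.
    by apply: eq_bigr => g _; rewrite expr2 mulrC /sqn [conjc _ * _]mulrC mulrC.
  rewrite mulr_natl -sumr_const; apply: ler_sum => g _.
  under eq_bigr do rewrite exchange_big /=.
  rewrite exchange_big /=; apply: ler_sum => x _.
  under eq_bigr do rewrite -mulr_suml.
  rewrite -mulr_suml; apply: ler_piMl; first exact: sqn_ge0.
  apply: (@le_trans _ _ (\sum_c (f x == c)%:R)).
    by apply: ler_sum => c _; exact: key_coef_sqr.
  rewrite (bigD1 (f x)) //= eqxx big1 ?addr0 // => c.
  by rewrite eq_sym => /negPf ->.
have e : \sum_(g : {ffun X -> Kt}) \sum_c \sum_kap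
     hs2 (fun b b' => \sum_x (key_coef R f g c kap x)%:C * Y x b b') =
   \sum_b \sum_b' \sum_(g : {ffun X -> Kt}) \sum_c \sum_kap
     sqn (\sum_x (key_coef R f g c kap x)%:C * Y x b b').
  under [LHS]eq_bigr do under eq_bigr do rewrite exchange_big /=.
  under [LHS]eq_bigr do rewrite exchange_big /=.
  rewrite exchange_big /=; apply: eq_bigr => b _.
  under [LHS]eq_bigr do under eq_bigr do rewrite exchange_big /=.
  under [LHS]eq_bigr do rewrite exchange_big /=.
  by rewrite exchange_big.
rewrite e /hs2 [X in _ <= _ * X]exchange_big mulr_sumr; apply: ler_sum => b _.
rewrite /nrm2 [X in _ <= _ * X]exchange_big mulr_sumr; apply: ler_sum => b' _.
exact: pt.
Qed.
End AverageKey.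

(** * LOCC protocols from product instruments *)

Section LoccTools.
Variable R : realType.
Local Notation C := R[i].
Local Notation "x %:C" := (real_complex R x).
Local Notation Re := (@complex.Re R).
Variable m : nat.
Implicit Types (T U V : 'I_m -> finType).

Lemma conj_by_gram (A B D : finType) (L : op R B A) (N : A -> D -> C) :
  conj_by L (gram N) = gram (fun b e => \sum_a L b a * N a e).
Proof.
apply/funext => a; apply/funext => b; rewrite /conj_by /opmul /gram /adj.
transitivity (\sum_v \sum_v0 \sum_e L a v0 * N v0 e * conjc (L b v * N v e)).
  apply: eq_bigr => v _; rewrite mulr_suml; apply: eq_bigr => v0 _.
  rewrite mulr_sumr mulr_suml; apply: eq_bigr => e _; rewrite conjcM; ring.
under eq_bigr do rewrite exchange_big /=.
rewrite exchange_big /=; apply: eq_bigr => e _.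
rewrite exchange_big conjc_sum mulr_suml /=; apply: eq_bigr => v0 _.
by rewrite mulr_sumr.
Qed.

Lemma conj_by_comp (A B D : finType) (L : op R D B) (M : op R B A) (rho : op R A A) :
  conj_by L (conj_by M rho) = conj_by (opmul L M) rho.
Proof.
have opmulA (E F G H : finType) (x : op R E F) (y : op R F G) (z : op R G H) :
   opmul x (opmul y z) = opmul (opmul x y) z.
  apply/funext => a; apply/funext => b; rewrite /opmul.
  under eq_bigr do rewrite mulr_sumr.
  rewrite exchange_big /=; apply: eq_bigr => v _; rewrite mulr_suml.
  by apply: eq_bigr => w _; rewrite mulrA.
have -> : conj_by (opmul L M) rho = opmul (opmul (opmul L M) rho) (opmul (adj M) (adj L)).
  rewrite /conj_by; congr opmul; apply/funext => a; apply/funext => b.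
  rewrite /adj /opmul conjc_sum; apply: eq_bigr => v _; by rewrite conjcM mulrC.
by rewrite /conj_by !opmulA.
Qed.

Lemma conj_by_id (A : finType) (rho : op R A A) : conj_by (@idop R A) rho = rho.
Proof.
apply/funext => a; apply/funext => b; rewrite /conj_by /opmul /adj /idop.
rewrite (bigD1 b) //= [X in _ + X]big1 ?addr0; last first.
  by move=> v vb; rewrite eq_sym (negPf vb) conjc0 mulr0.
rewrite eqxx conjc1 mulr1 (bigD1 a) //= big1 ?addr0 ?eqxx ?mul1r //.
by move=> v va; rewrite eq_sym (negPf va) mul0r.
Qed.

Lemma gram_sum (A : finType) (I : finType) (D : I -> finType) (N : forall i, A -> D i -> C) :
  (fun a b => \sum_i gram (N i) a b) =
  gram (fun a (p : {i : I & D i} : finType) => N (tag p) a (tagged p)).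
Proof.
apply/funext => a; apply/funext => b; rewrite /gram.
by rewrite sig_big_dep; apply: eq_bigr => -[].
Qed.

(** The type [chan] says nothing about positivity. By induction on the protocol, inputs in Gram form
    give outputs in Gram form, whose expectations are nonnegative. *)
Lemma LOCC_gram T U (Lam : chan R T U) : LOCC Lam ->
  forall (D : finType) (N : Jt T -> D -> C),
  exists (D' : finType) (N' : Jt U -> D' -> C), Lam (gram N) = gram N'.
Proof.
elim=> {T U Lam} [T D N|T U k V Xo Rk K Psi _ _ IH D N]; first by exists D, N.
pose N1 x := fun c (p : {r : Rk & D} : finType) => \sum_a liftK (K x (tag p)) c a * N a (tagged p).
have e x : (fun c d => \sum_r conj_by (liftK (K x r)) (gram N) c d) = gram (N1 x).
  rewrite /N1 -(gram_sum (fun r c e => \sum_a liftK (K x r) c a * N a e)).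
  by apply/funext => c; apply/funext => d; apply: eq_bigr => r _; rewrite conj_by_gram.
pose D2 x := projT1 (cid (IH x _ (N1 x))).
pose N2 x : Jt U -> D2 x -> C := projT1 (cid (projT2 (cid (IH x _ (N1 x))))).
have h x : Psi x (gram (N1 x)) = gram (N2 x).
  exact: (projT2 (cid (projT2 (cid (IH x _ (N1 x)))))).
exists ({x : Xo & D2 x} : finType), (fun a p => N2 (tag p) a (tagged p)).
rewrite -gram_sum; apply/funext => a; apply/funext => b; apply: eq_bigr => x _.
by rewrite -h -e.
Qed.

Lemma heq_same (A : finType) (a b : A) : heq a b -> a = b.
Proof.
move=> h; have := projT2_eq h; rewrite (Prop_irrelevance (projT1_eq h) erefl).
by [].
Qed.

(** Unlike in [liftK] the target family is arbitrary; off [k] it is compared with [T] through [heq],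
    which spares type casts. *)
Definition lift1 T T' (k : 'I_m) (K : op R (T' k) (T k)) : op R (Jt T') (Jt T) :=
  fun y u => if `[< forall i, i != k -> heq (y i) (u i) >] then K (y k) (u k) else 0.

Lemma LOCC_round_gen T T' U (k : 'I_m) (Xo : finType) (K : Xo -> op R (T' k) (T k))
   (Psi : Xo -> chan R T' U) :
  (forall i, i != k -> T' i = T i) ->
  (forall a b, \sum_x opmul (adj (K x)) (K x) a b = @idop R (T k) a b) ->
  (forall x, LOCC (Psi x)) ->
  LOCC (fun rho a b => \sum_x Psi x (conj_by (lift1 (K x)) rho) a b).
Proof.
move=> hT hK hPsi.
have E : T' = upd T k (T' k).
  by apply/funext => i; rewrite /upd; case: eqVneq => [->//|]; exact: hT.
pose liftV (V : finType) (S : 'I_m -> finType) (L : op R V (T k)) : op R (Jt S) (Jt T) :=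
  fun y x => if `[< forall i, i != k -> heq (y i) (x i) >]
             then \sum_(v : V) (if `[< heq (y k) v >] then L v (x k) else 0) else 0.
(* Generalising over the family [S] lets the equation between families be substituted before
   [LOCC_round] is applied. *)
have main (V : finType) (L : Xo -> op R V (T k)) (S : 'I_m -> finType) (Q : Xo -> chan R S U) :
    S = upd T k V ->
    (forall a b, \sum_x opmul (adj (L x)) (L x) a b = @idop R (T k) a b) ->
    (forall x, LOCC (Q x)) ->
    LOCC (fun rho a b => \sum_x Q x (conj_by (liftV V S (L x)) rho) a b).
  move=> e; move: Q; rewrite {S}e => Q hL hQ.
  have := @LOCC_round R m T U k V Xo unit (fun x _ => L x) Q.
  have -> : (fun rho : op R (Jt T) (Jt T) => fun a b =>
       \sum_(x : Xo) Q x (fun c d => \sum_(r : unit) conj_by (liftK (L x)) rho c d) a b) =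
     (fun rho a b => \sum_x Q x (conj_by (liftV V (upd T k V) (L x)) rho) a b).
    apply/funext => rho; apply/funext => a; apply/funext => b; apply: eq_bigr => x _.
    congr (Q x _ a b); apply/funext => c; apply/funext => d.
    by rewrite (big_pred1 tt) //; case.
  apply=> // a b; rewrite -hL; apply: eq_bigr => x _.
  by rewrite (big_pred1 tt) //; case.
have := main (T' k) K T' Psi E hK hPsi.
congr LOCC; apply/funext => rho; apply/funext => a; apply/funext => b; apply: eq_bigr => x _.
congr (Psi x (conj_by _ rho) a b); apply/funext => y; apply/funext => u.
rewrite /liftV /lift1; case: ifP => // _.
rewrite (bigD1 (y k)) //= big1 ?addr0; first by case: asboolP => // h; case: h.
move=> v hv; case: asboolP => // h; move: hv; rewrite (heq_same h) eqxx //.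
Qed.

Section Sequential.
Variables (T V U O : 'I_m -> finType) (K : forall i, Jt O -> op R (V i) (T i)).
Variable Psi : Jt O -> chan R V U.
Arguments K : clear implicits.

(** The systems in mid-protocol: [beta i] holds as long as party [i] has not acted. *)
Definition mixed (beta : 'I_m -> bool) (i : 'I_m) : finType := if beta i then T i else V i.

Definition sel (b : bool) i (L : op R (V i) (T i)) : op R (V i) (if b then T i else V i) :=
  match b with true => L | false => @idop R (V i) end.

Arguments sel b {i} L _ _.

(** [b'] is the status of a party before the round, [b] its status after it. The pair [true],
    [false] would undo an action and gets a junk value. *)
Definition step (b b' : bool) i (L : op R (V i) (T i)) :
   op R (if b then T i else V i) (if b' then T i else V i) :=
  match b, b' with
  | true, true => @idop R (T i)
  | false, false => @idop R (V i)
  | false, true => L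
  | true, false => fun _ _ => 0
  end.

Arguments step b b' {i} L _ _.

Definition kron_part beta (h : Jt O) : op R (Jt V) (Jt (mixed beta)) :=
  fun y u => \prod_i sel (beta i) (K i h) (y i) (u i).

Arguments kron_part : clear implicits.

Lemma sel_step (b b' : bool) i (L : op R (V i) (T i)) y u : (b -> b') ->
  \sum_v sel b L y v * step b b' L v u = sel b' L y u.
Proof.
case: b; case: b' u => /= u hb; [| by have := hb isT | |].
- rewrite (bigD1 u) //= big1 ?addr0 /idop ?eqxx ?mulr1 // => v vu.
  by rewrite (negPf vu) mulr0.
- rewrite /idop (bigD1 y) //= big1 ?addr0 ?eqxx ?mul1r // => v vu.
  by rewrite eq_sym (negPf vu) mul0r.
- rewrite /idop (bigD1 y) //= big1 ?addr0 ?eqxx ?mul1r // => v vu.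
  by rewrite eq_sym (negPf vu) mul0r.
Qed.

Lemma step_heq (b b' : bool) i (L : op R (V i) (T i)) v u : b = b' ->
  step b b' L v u = (`[< heq v u >])%:R.
Proof.
move=> e; move: u; rewrite -{b'}e; case: b v => v u /=; rewrite /idop;
by case: eqVneq => [->|/eqP h]; case: asboolP => // h'; [case: h' | case: h; exact: heq_same].
Qed.

Lemma lift_step (beta beta' : 'I_m -> bool) k (h : Jt O) (w : Jt (mixed beta)) (u : Jt (mixed beta')) :
  (forall i, i != k -> beta i = beta' i) ->
  lift1 (T' := mixed beta) (T := mixed beta') (step (beta k) (beta' k) (K k h)) w u =
  \prod_i step (beta i) (beta' i) (K i h) (w i) (u i).
Proof.
move=> hb; rewrite (bigD1 k) //= /lift1; case: asboolP => H.
  rewrite big1 ?mulr1 // => i ik; rewrite step_heq ?hb //.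
  by case: asboolP => // h'; case: h'; exact: (H i ik).
have [i ik hi] : exists2 i, i != k & ~ heq (w i) (u i).
  by move/existsNP: H => [i /not_implyP [ik hi]]; exists i.
rewrite (bigD1 i) //= [X in _ * (X * _)]step_heq ?hb // (asboolF hi).
by rewrite mul0r mulr0.
Qed.

(** Induction on the parties [s] still to act. [h0] records the outcomes announced so far, and the
    sum runs over their continuations. An operator may depend on its own and on earlier outcomes,
    not on those of [s2]. *)
Lemma LOCC_sequential_aux (s : seq 'I_m) : uniq s ->
  (forall s1 k s2, s = s1 ++ k :: s2 -> forall h h' : Jt O,
      (forall l, l \notin s2 -> h l = h' l) -> K k h = K k h') ->
  (forall k (h : Jt O) a b, k \in s -> \sum_(o : O k) opmul (adj (K k (setc h o))) (K k (setc h o)) a b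
     = @idop R (T k) a b) ->
  (forall h, LOCC (Psi h)) ->
  forall (beta : 'I_m -> bool) (h0 : Jt O), (forall i, beta i = (i \in s)) ->
  LOCC (fun (rho : op R (Jt (mixed beta)) (Jt (mixed beta))) a b =>
     \sum_(h : Jt O | [forall l, (l \in s) || (h l == h0 l)]) Psi h (conj_by (kron_part beta h) rho) a b).
Proof.
elim: s => [|k s IH] /= us hadapt hK hPsi beta h0 hbeta.
  have -> : beta = (fun _ => false) by apply/funext => i; rewrite hbeta.
  have := hPsi h0; congr LOCC; apply/funext => rho; apply/funext => a; apply/funext => b.
  rewrite (big_pred1 h0); last first.
    move=> h; apply/forallP/eqP => [e|->]; last by move=> l; rewrite eqxx ?orbT.
    by apply/ffunP => l; have := e l; move/eqP.
  have -> : kron_part (fun _ => false) h0 = @idop R (Jt V); last by rewrite conj_by_id.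
  apply/funext => y; apply/funext => u; rewrite /kron_part /= /idop.
  case: eqVneq => [->|yu]; first by rewrite big1 // => i _; rewrite eqxx.
  have [i hi] : exists i, y i != u i.
    apply/existsP; rewrite -negb_forall; apply: contra yu => /forallP h.
    by apply/eqP/ffunP => i; apply/eqP.
  by rewrite (bigD1 i) //= (negPf hi) mul0r.
move/andP: us => [ks us].
pose beta' i := i \in s.
have bk : beta k = true by rewrite hbeta inE eqxx.
have bk' : beta' k = false by apply/negbTE.
have bb i : i != k -> beta' i = beta i by move=> ik; rewrite hbeta inE (negPf ik).
pose Kk (o : O k) : op R (mixed beta' k) (mixed beta k) := step (beta' k) (beta k) (K k (setc h0 o)).
pose Psi' (o : O k) : chan R (mixed beta') U := fun rho a b =>
  \sum_(h : Jt O | [forall l, (l \in s) || (h l == setc h0 o l)]) Psi h (conj_by (kron_part beta' h) rho) a b.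
have H1 i : i != k -> mixed beta' i = mixed beta i by move=> ik; rewrite /mixed bb.
have H2 a b : \sum_o opmul (adj (Kk o)) (Kk o) a b = @idop R (mixed beta k) a b.
  have hk a' b' := hK k h0 a' b' (mem_head k s).
  move: a b; rewrite /Kk /mixed; move: bk bk'; case: (beta k) => // _; case: (beta' k) => // _ a b.
have H3 o : LOCC (Psi' o).
  apply: IH => //.
    by move=> s1 k' s2 e; apply: (hadapt (k :: s1)); rewrite e.
  by move=> k' h a b k's; apply: hK; rewrite inE k's orbT.
have := LOCC_round_gen H1 H2 H3.
congr LOCC; apply/funext => rho; apply/funext => a; apply/funext => b.
rewrite /Psi' [RHS](partition_big (fun h : Jt O => h k) xpredT) //=; apply: eq_bigr => o _.
apply: eq_big => [h|h /forallP hh].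
  apply/forallP/andP => [hh|[/forallP hh /eqP hk] l].
    split; last by have := hh k; rewrite (negPf ks) setc_in.
    apply/forallP => l; rewrite inE; case: eqVneq => //= lk.
    by have := hh l; rewrite setc_out // eq_sym.
  have := hh l; rewrite inE; case: eqVneq => [->|lk] /=.
    by rewrite (negPf ks) setc_in hk eqxx.
  by rewrite setc_out // eq_sym.
rewrite conj_by_comp; congr (Psi h (conj_by _ rho) a b).
have -> : Kk o = step (beta' k) (beta k) (K k h).
  rewrite /Kk; congr step; apply: (hadapt [::] k s erefl) => l ls.
  by have := hh l; rewrite (negPf ls) /= => /eqP.
apply/funext => y; apply/funext => u; rewrite /opmul.
under eq_bigr do rewrite (lift_step h _ _ bb) /kron_part -big_split /=.
rewrite (sum_prod_dffun (fun i v => sel (beta' i) (K i h) (y i) v * step (beta' i) (beta i) (K i h) v (u i))).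
apply: eq_bigr => i _; apply: sel_step.
by rewrite /beta' hbeta inE => ->; rewrite orbT.
Qed.

Definition kron (L : forall i, op R (V i) (T i)) : op R (Jt V) (Jt T) :=
  fun y u => \prod_i @L i (y i) (u i).

(* Party [j] acts last, knowing all outcomes; the Kraus operators of the others depend on
   their own outcome only. *)
Lemma LOCC_sequential (j : 'I_m) (h0 : Jt O) :
  (forall i, i != j -> forall h h' : Jt O, h i = h' i -> K i h = K i h') ->
  (forall i (h : Jt O) a b, \sum_(o : O i) opmul (adj (K i (setc h o))) (K i (setc h o)) a b
     = @idop R (T i) a b) ->
  (forall h, LOCC (Psi h)) ->
  LOCC (fun rho a b => \sum_(h : Jt O) Psi h (conj_by (kron (fun i => K i h)) rho) a b).
Proof.
move=> hadapt hK hPsi.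
pose s := rcons (rem j (enum 'I_m)) j.
have us : uniq s by rewrite rcons_uniq mem_rem_uniqF ?enum_uniq // rem_uniq ?enum_uniq.
have hs i : i \in s.
  rewrite mem_rcons inE; case: eqVneq => //= ij.
  by rewrite mem_rem_uniq ?enum_uniq // inE ij mem_enum.
have := @LOCC_sequential_aux s us _ (fun k h a b _ => hK k h a b) hPsi xpredT h0 _.
have -> : (fun (rho : op R (Jt (mixed xpredT)) (Jt (mixed xpredT))) a b =>
     \sum_(h : Jt O | [forall l, (l \in s) || (h l == h0 l)]) Psi h (conj_by (kron_part xpredT h) rho) a b)
  = (fun rho a b => \sum_(h : Jt O) Psi h (conj_by (kron (fun i => K i h)) rho) a b).
  apply/funext => rho; apply/funext => a; apply/funext => b; apply: eq_bigl => h.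
  by apply/forallP => l; rewrite hs.
apply; last by move=> i; rewrite hs.
move=> s1 k s2 e h h' hh.
have [kj|kj] := eqVneq k j; last first.
  apply: hadapt => //; apply: hh; apply/negP => ks2.
  have : uniq (k :: s2) by move: us; rewrite e cat_uniq => /and3P[].
  by rewrite /= ks2.
have e2 : s2 = [::].
  case: (lastP s2) e => [//|s2' x] e.
  have ex : x = j by have := congr1 (last j) e; rewrite last_rcons last_cat /= last_rcons.
  have : uniq (k :: rcons s2' x) by move: us; rewrite e cat_uniq => /and3P[].
  by rewrite /= mem_rcons inE ex kj eqxx.
have -> : h = h' by apply/ffunP => l; apply: hh; rewrite e2.
by [].
Qed.
End Sequential.
End LoccTools.

(** * Contractive Kraus families as protocols *)

Section Gain.
Variable R : realType.
Local Notation C := R[i].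
Local Notation "x %:C" := (real_complex R x).
Local Notation Re := (@complex.Re R).

Lemma opmul_adj (V T : finType) (F : op R V T) : opmul (adj F) F = gram (adj F).
Proof.
apply/funext => a; apply/funext => b; apply: eq_bigr => v _.
by rewrite /adj conjcK.
Qed.

Lemma ap_idop (T : finType) (v : T -> C) : ap (@idop R T) v =1 v.
Proof.
move=> t; rewrite /ap (bigD1 t) //= /idop eqxx mul1r big1 ?addr0 // => s st.
by rewrite eq_sym (negPf st) mul0r.
Qed.

(** L is a root of the defect 1 - sum F^* F, built from its eigenvectors. Contractivity is assumed
    under the existential, so that [L] can be chosen as a function of [F] alone: equal families then
    receive equal completions, as the dependence on outcomes in [LOCC_gain] demands. *)
Lemma instrument_completion (O V T : finType) (F : O -> op R V T) :
  exists L : op R T T, (forall v, \sum_o nrm2 (ap (F o) v) <= nrm2 v) ->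
  forall a b, \sum_o opmul (adj (F o)) (F o) a b + opmul (adj L) L a b = @idop R T a b.
Proof.
pose B : op R T T := fun a b => @idop R T a b - \sum_o gram (adj (F o)) a b.
have hB a b : B b a = conjc (B a b).
  rewrite /B conjcB conjc_natr eq_sym; congr (_ - _); rewrite conjc_sum.
  by apply: eq_bigr => o _; exact: gram_herm.
have [u [l hl]] := hermitian_spectral hB.
exists (fun c a => (Num.sqrt (l c))%:C * conjc (u c a)) => hF a b.
have l0 c : 0 <= l c.
  have e : (l c)%:C = inner (u c) (ap B (u c)).
    by rewrite (eq_inner (fun _ => erefl) (spectral_eig c hl)) innerZr hl.1 eqxx mulr1.
  have : inner (u c) (ap B (u c)) = (nrm2 (u c) - \sum_o nrm2 (ap (F o) (u c)))%:C.
    rewrite rmorphB /= -inner_nrm2 rc_sum.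
    transitivity (inner (u c) (ap (@idop R T) (u c)) - \sum_o inner (u c) (ap (gram (adj (F o))) (u c))).
      rewrite /inner exchange_big -sumrB /=; apply: eq_bigr => t _.
      rewrite -mulr_sumr -mulrBr; congr (_ * _); rewrite /ap /B.
      rewrite exchange_big /= -sumrB; apply: eq_bigr => s _.
      by rewrite mulrBl mulr_suml.
    rewrite (eq_inner (fun _ => erefl) (ap_idop _)); congr (_ - _).
    by apply: eq_bigr => o _; rewrite inner_gram adjK inner_nrm2.
  rewrite -e => /complexI ->; rewrite subr_ge0; exact: hF.
have -> : opmul (adj (fun c a => (Num.sqrt (l c))%:C * conjc (u c a)))
   (fun c a => (Num.sqrt (l c))%:C * conjc (u c a)) a b = B a b.
  rewrite hl.2 /opmul /adj; apply: eq_bigr => c _; rewrite conjcM conjcK conjc_rc.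
  rewrite -[in RHS](sqr_sqrtr (l0 c)) expr2 rcM; ring.
under eq_bigr do rewrite opmul_adj.
rewrite /B addrC.
by rewrite subrK.
Qed.

Lemma expval_sum (I T : finType) (G : T -> C) (A : I -> op R T T) :
  expval G (fun a b => \sum_i A i a b) = \sum_i expval G (A i).
Proof.
rewrite /expval -Re_sum; congr Re; rewrite /inner exchange_big /=; apply: eq_bigr => t _.
rewrite -mulr_sumr; congr (_ * _); rewrite /ap exchange_big /=; apply: eq_bigr => s _.
by rewrite mulr_suml.
Qed.

Section Product.
Variable m : nat.
Variables (T V U O : 'I_m -> finType) (K : forall i, Jt O -> op R (V i) (T i)).
Variable Psi : Jt O -> chan R V U.
Arguments K : clear implicits.

(* Contractive families are completed to instruments by one more outcome, whose
   contribution to the expectation is nonnegative. *)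
Lemma LOCC_gain (j : 'I_m) (h0 : Jt O) (v0 : Jt V) (G : Jt U -> C) (D : finType)
    (N : Jt T -> D -> C) :
  (forall i, i != j -> forall h h' : Jt O, h i = h' i -> K i h = K i h') ->
  (forall i (h : Jt O) v, \sum_(o : O i) nrm2 (ap (K i (setc h o)) v) <= nrm2 v) ->
  (forall h, LOCC (Psi h)) ->
  exists Lam : chan R T U, LOCC Lam /\
    \sum_h expval G (Psi h (gram (fun a e => \sum_b kron (fun i => K i h) a b * N b e)))
      <= expval G (Lam (gram N)).
Proof.
move=> hadapt hK hPsi.
pose fam i (h : Jt O) : O i -> op R (V i) (T i) := fun o => K i (setc h o).
pose Lc i (F : O i -> op R (V i) (T i)) := projT1 (cid (instrument_completion F)).
have LcP i (h : Jt O) a b : \sum_o opmul (adj (fam i h o)) (fam i h o) a b +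
    opmul (adj (Lc i (fam i h))) (Lc i (fam i h)) a b = @idop R (T i) a b.
  by apply: (projT2 (cid (instrument_completion (fam i h)))) => v; exact: hK.
(* An outcome [inr t] is the [t]-th row of the completion, with the output reset to [v0]; [ph]
   reports it to the others as the default [h0 i]. *)
pose O' i : finType := (O i + T i)%type.
pose ph (h' : Jt O') : Jt O := finfun (fun i => match h' i with inl o => o | inr _ => h0 i end).
pose K' i (h' : Jt O') : op R (V i) (T i) := match h' i with
  | inl o => fam i (ph h') o
  | inr t => fun y a => (y == v0 i)%:R * Lc i (fam i (ph h')) t a end.
have phin (h : Jt O) : ph (finfun (fun i => inl (h i)) : Jt O') = h.
  by apply/ffunP => i; rewrite !ffunE.
have fam_adapt i : i != j -> forall h h', fam i h = fam i h'.
  by move=> ij h h'; apply/funext => o; apply: hadapt => //; rewrite !setc_in.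
have fam_set i (h' : Jt O') (x : O' i) : fam i (ph (setc h' x)) = fam i (ph h').
  apply/funext => o; rewrite /fam; congr (K i _); apply/ffunP => l.
  case: (eqVneq i l) => [<-|il]; first by rewrite !setc_in.
  rewrite !(setc_out _ _ il). rewrite /ph [LHS]ffunE [RHS]ffunE. by rewrite (setc_out _ _ il).
have H1 i : i != j -> forall h h' : Jt O', h i = h' i -> K' i h = K' i h'.
  by move=> ij h h' e; rewrite /K' e (fam_adapt i ij (ph h) (ph h')).
have H2 i (h : Jt O') a b : \sum_(o : O' i) opmul (adj (K' i (setc h o))) (K' i (setc h o)) a b
     = @idop R (T i) a b.
  rewrite big_sumType /= -(LcP i (ph h)); congr (_ + _).
    by apply: eq_bigr => o _; rewrite /K' setc_in fam_set.
  rewrite [RHS]/opmul; apply: eq_bigr => t _; rewrite /K' setc_in fam_set /opmul.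
  rewrite (bigD1 (v0 i)) //= /adj eqxx mul1r mul1r big1 ?addr0 //.
  by move=> y /negPf ->; rewrite !mul0r conjc0 mul0r.
have hL := LOCC_sequential (Psi := fun h' => Psi (ph h')) (finfun (fun i => inl (h0 i)) : Jt O') H1 H2
   (fun h' => hPsi (ph h')).
eexists; split; first exact: hL.
rewrite expval_sum.
pose emb (h : Jt O) : Jt O' := finfun (fun i => inl (h i)).
pose F (h' : Jt O') := expval G (Psi (ph h') (conj_by (kron (fun i => K' i h')) (gram N))).
have F0 h' : 0 <= F h'.
  rewrite /F conj_by_gram; have [D' [N' ->]] := LOCC_gram (hPsi (ph h')) (fun b e => \sum_a kron (fun i => K' i h') b a * N a e).
  by rewrite expval_gram nrm2_ge0.
have -> : \sum_h expval G (Psi h (gram (fun a e => \sum_b kron (fun i => K i h) a b * N b e))) = \sum_h F (emb h).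
  apply: eq_bigr => h _; rewrite /F conj_by_gram phin.
  suff -> : (fun i => K' i (emb h)) = (fun i => K i h) by [].
  apply/functional_extensionality_dep => i; rewrite /K' /emb ffunE -/(emb h) phin /fam; congr (K i _).
  exact: setc_id.
rewrite [leRHS](partition_big ph xpredT) //=; apply: ler_sum => h _.
rewrite [leRHS](bigD1 (emb h)) /=; last by rewrite phin.
rewrite lerDl; apply: sumr_ge0 => h' _; exact: F0.
Qed.
End Product.
End Gain.

(** * One-shot GHZ distillation *)

Section OneShotTools.
Variable R : realType.
Local Notation C := R[i].
Local Notation "x %:C" := (real_complex R x).
Local Notation Re := (@complex.Re R).

Lemma sum_Jt_pair (I : finType) (T1 T2 : I -> finType) (S : nmodType)
    (F : Jt (fun i => (T1 i * T2 i)%type : finType) -> S) :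
  \sum_h F h = \sum_(x : Jt T1) \sum_(y : Jt T2) F (finfun (fun i => (x i, y i))).
Proof.
rewrite pair_big /=.
rewrite (reindex (fun p : Jt T1 * Jt T2 => finfun (fun i => (p.1 i, p.2 i))
   : Jt (fun i => (T1 i * T2 i)%type : finType))) //=.
exists (fun h => (finfun (fun i => (h i).1) : Jt T1, finfun (fun i => (h i).2) : Jt T2)).
  by move=> [x y] _ /=; congr pair; apply/ffunP => i; rewrite !ffunE.
by move=> h _; apply/ffunP => i; rewrite !ffunE -surjective_pairing.
Qed.

Definition sgn (b : bool) : R := if b then -1 else 1.

Lemma sgn_avg (T : finType) (x y : T) :
  \sum_(s : {ffun T -> bool}) sgn (s x) * sgn (s y) = #|{ffun T -> bool}|%:R * (x == y)%:R.
Proof.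
have sq b : sgn b * sgn b = 1 by case: b; rewrite /sgn ?mulrNN mulr1.
case: eqVneq => [<-|xy].
  by under eq_bigr do rewrite sq; rewrite sumr_const mulr1.
rewrite (sum_ffun2 (fun b b' => sgn b * sgn b') xy) ?card_bool // mulr0.
by rewrite !big_bool /sgn /=; ring.
Qed.

Lemma sgn_nrm2 (T : finType) (z : T -> C) :
  \sum_(s : {ffun T -> bool}) sqn (\sum_x (sgn (s x))%:C * z x) =
  #|{ffun T -> bool}|%:R * \sum_x sqn (z x).
Proof.
under eq_bigr do rewrite sqn_real_comb.
rewrite exchange_big mulr_sumr /=; apply: eq_bigr => x _.
rewrite exchange_big /= (bigD1 x) //= [X in _ + X]big1 ?addr0.
  by rewrite -mulr_suml sgn_avg eqxx mulr1 /sqn [conjc _ * _]mulrC.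
by move=> y yx; rewrite -mulr_suml sgn_avg eq_sym (negPf yx) mulr0 mul0r.
Qed.

(** [k] GHZ states are the uniform superposition of all strings [kap] held in [m] equal copies. The
    weight 2^(-k/2) is written with |Kt| to match [key_target]. *)
Lemma sum_ghz (m k : nat) (j : 'I_m) (F : Jt (@qsys m k) -> C) :
  \sum_z conjc (ghz_vec R z) * F z =
  \sum_(kap : {ffun 'I_k -> bool}) ((Num.sqrt (#|{ffun 'I_k -> bool}|%:R^-1))%:C *
     F (finfun (fun _ => kap))).
Proof.
have sX q : Num.sqrt (2 : R) ^+ q = Num.sqrt (2 ^+ q).
  elim: q => [|q IH]; first by rewrite !expr0 sqrtr1.
  by rewrite !exprS sqrtrM ?ler0n // IH.
pose cst (kap : {ffun 'I_k -> bool}) : Jt (@qsys m k) := finfun (fun _ => kap).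
have cstI : injective cst by move=> a b /ffunP /(_ j); rewrite !ffunE.
have e (z : Jt (@qsys m k)) : ghz_vec R z = (z == cst (z j))%:R * (Num.sqrt (#|{ffun 'I_k -> bool}|%:R^-1))%:C.
  rewrite /ghz_vec.
  have -> : [forall t : 'I_k, forall i : 'I_m, forall i' : 'I_m, z i t == z i' t] = (z == cst (z j)).
    apply/forallP/eqP => [h|-> t].
      apply/ffunP => i; apply/ffunP => t; rewrite ffunE.
      by have /forallP /(_ i) /forallP /(_ j) /eqP := h t.
    by apply/forallP => i; apply/forallP => i'; rewrite !ffunE.
  case: eqP => _; rewrite ?mul0r // mul1r; congr (_%:C).
  rewrite card_ffun card_bool card_ord natrX sqrtrV ?exprn_ge0 // exprVn; congr (_^-1).
  exact: sX.
rewrite (bigID (fun z : Jt (@qsys m k) => z == cst (z j))) /= [X in _ + X]big1 ?addr0; last first.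
  by move=> z /negPf h; rewrite e h mul0r conjc0 mul0r.
rewrite (reindex_onto cst (fun z : Jt (@qsys m k) => z j)) /=; last by move=> z /eqP.
apply: eq_big => [kap|kap _]; first by rewrite /cst !ffunE !eqxx.
by rewrite e /cst ffunE eqxx mul1r conjc_rc.
Qed.
End OneShotTools.

(** * Decoders acting at different parties, and their joint error *)

Section LocalActions.
Variable R : realType.
Local Notation C := R[i].
Local Notation "x %:C" := (real_complex R x).
Local Notation Re := (@complex.Re R).
Variables (m : nat) (X A' : 'I_m -> finType) (E : finType).
Variables (phi : Jt X -> Jt A' * E -> C) (a0 : Jt A').
Local Notation G := (Jt A' * E)%type.

(* Party [i]'s system [A' i] is split off by pinning its coordinate to [a0 i] in the
   remaining index, so that no type of partial configurations is needed. *)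
Definition splitoff (i : 'I_m) (x : Jt X) (be : G) (q : A' i) : C :=
  (be.1 i == a0 i)%:R * phi x (setc be.1 q, be.2).

Arguments splitoff : clear implicits.

Lemma sum_splitoff (S : nmodType) (i : 'I_m) (F : G -> S) :
  \sum_be F be = \sum_(be : G | be.1 i == a0 i) \sum_(q : A' i) F (setc be.1 q, be.2).
Proof.
transitivity (\sum_b \sum_e F (b, e)); first by rewrite pair_big; apply: eq_bigr => -[].
rewrite (sum_setc (i := i) (a0 i)).
transitivity (\sum_(b : Jt A' | b i == a0 i) \sum_e \sum_(q : A' i) F (setc b q, e)).
  by apply: eq_bigr => b _; rewrite exchange_big.
by rewrite pair_big; apply: eq_big => [[b e]|[b e] _] //=; rewrite andbT.
Qed.

Lemma inner_splitoff (i : 'I_m) (u v : G -> C) :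
  inner u v = \sum_(be : G | be.1 i == a0 i)
    inner (fun q : A' i => u (setc be.1 q, be.2)) (fun q => v (setc be.1 q, be.2)).
Proof. exact: sum_splitoff. Qed.

Lemma nrm2_splitoff (i : 'I_m) (v : G -> C) :
  nrm2 v = \sum_(be : G | be.1 i == a0 i) nrm2 (fun q : A' i => v (setc be.1 q, be.2)).
Proof. exact: sum_splitoff. Qed.

Definition act (i : 'I_m) (D : op R (A' i) (A' i)) (th : G -> C) : G -> C :=
  fun be => \sum_q D (be.1 i) q * th (setc be.1 q, be.2).

Lemma act_setc i (D : op R (A' i) (A' i)) th b e q' :
  act D th (setc b q', e) = ap D (fun q => th (setc b q, e)) q'.
Proof. by rewrite /act /ap /=; apply: eq_bigr => q _; rewrite setc_in setcC. Qed.

Lemma nrm2_act i (D : op R (A' i) (A' i)) th : contr D -> nrm2 (act D th) <= nrm2 th.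
Proof.
move=> cD; rewrite (nrm2_splitoff i) [leRHS](nrm2_splitoff i); apply: ler_sum => be _.
by rewrite (eq_nrm2 (fun q' => act_setc D th be.1 be.2 q')).
Qed.

Lemma hs2_splitoff i x : hs2 (splitoff i x) = nrm2 (phi x).
Proof.
rewrite (nrm2_splitoff i) [RHS]big_mkcond; apply: eq_bigr => be _.
rewrite /splitoff nrm2Z sqn_nat; case: eqP; rewrite ?expr1n ?mul1r //.
by rewrite expr0n mul0r.
Qed.

Lemma inner_act i (D : op R (A' i) (A' i)) x :
  inner (phi x) (act D (phi x)) = \sum_be inner (splitoff i x be) (ap D (splitoff i x be)).
Proof.
rewrite (inner_splitoff i) big_mkcond; apply: eq_bigr => be _.
rewrite (eq_inner (fun _ => erefl) (fun q' => act_setc D (phi x) be.1 be.2 q')).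
rewrite /splitoff; case: eqP => _.
  by apply: eq_inner => [q|q']; rewrite ?mul1r //; apply: eq_bigr => q _; rewrite mul1r.
by rewrite /inner big1 // => q _; rewrite mul0r conjc0 mul0r.
Qed.

Section Family.
Variable D : forall i, Jt X -> op R (A' i) (A' i).
Variable delta : 'I_m -> R.
Arguments D : clear implicits.
Hypothesis cD : forall i x, contr (D i x).
Hypothesis phi1 : \sum_x nrm2 (phi x) = 1.
Hypothesis hD : forall i,
  1 - delta i <= Re (\sum_x \sum_be inner (splitoff i x be) (ap (D i x) (splitoff i x be))).

Definition kron_on (s : seq 'I_m) x (b a : Jt A') : C :=
  \prod_l (if l \in s then D l x (b l) (a l) else (b l == a l)%:R).
Definition acted (s : seq 'I_m) x (be : G) : C := \sum_a kron_on s x be.1 a * phi x (a, be.2).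

Lemma acted_nil x : acted [::] x =1 phi x.
Proof.
move=> [b e]; rewrite /acted /= (bigD1 b) //= big1 ?addr0.
  by rewrite /kron_on big1 ?mul1r // => l _; rewrite /= eqxx.
move=> a ab; have [i hi] : exists i, b i != a i.
  apply/existsP; rewrite -negb_forall; apply: contra ab => /forallP h.
  by apply/eqP/ffunP => i; apply/esym/eqP.
by rewrite /kron_on (bigD1 i) //= (negPf hi) !mul0r.
Qed.

Lemma acted_cons i s x : i \notin s -> act (D i x) (acted s x) =1 acted (i :: s) x.
Proof.
move=> is' [b e]; rewrite /act /acted /=.
under eq_bigr do rewrite mulr_sumr.
rewrite exchange_big /=; apply: eq_bigr => a _.
under eq_bigr do rewrite mulrA.
rewrite -mulr_suml; congr (_ * _).
rewrite /kron_on [RHS](bigD1 i) //= inE eqxx /=.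
rewrite (bigD1 (a i)) //= [X in _ + X]big1 ?addr0; last first.
  by move=> q qa; rewrite (bigD1 i) //= (negPf is') setc_in (negPf qa) mul0r mulr0.
congr (_ * _); rewrite (bigD1 i) //= (negPf is') setc_in eqxx mul1r.
apply: eq_bigr => l li; rewrite inE (negPf li) /=.
by rewrite setc_out // eq_sym.
Qed.

(** For a contraction |D u - u|^2 <= 2 |u|^2 - 2 Re <u, D u>, and [hD] bounds the overlap. *)
Lemma act_close i : \sum_x nrm2 (fun be => act (D i x) (phi x) be - phi x be) <= 2 * delta i.
Proof.
have h x : nrm2 (fun be => act (D i x) (phi x) be - phi x be) <=
   2 * nrm2 (phi x) - 2 * Re (\sum_be inner (splitoff i x be) (ap (D i x) (splitoff i x be))).
  rewrite nrm2B Re_innerC inner_act; have := nrm2_act (phi x) (@cD i x); lra.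
apply: le_trans (ler_sum _ (fun x _ => h x)) _.
rewrite sumrB -!mulr_sumr phi1 -Re_sum; have := hD i; lra.
Qed.

(** The decoders act one after another. Each is a contraction and does not amplify the errors
    already made, so the distances add up by the triangle inequality. *)
Lemma acted_close (s : seq 'I_m) : uniq s ->
  Num.sqrt (\sum_x nrm2 (fun be => acted s x be - phi x be)) <= \sum_(i <- s) Num.sqrt (2 * delta i).
Proof.
elim: s => [_|i s IH /= /andP[is' us]].
  rewrite big_nil big1 ?sqrtr0 // => x _; rewrite /nrm2 big1 // => be _.
  by rewrite acted_nil subrr sqn0.
rewrite big_cons.
pose u (p : Jt X * G) := act (D i p.1) (fun be => acted s p.1 be - phi p.1 be) p.2.
pose v (p : Jt X * G) := act (D i p.1) (phi p.1) p.2 - phi p.1 p.2.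
have -> : \sum_x nrm2 (fun be => acted (i :: s) x be - phi x be) = nrm2 (fun p => v p + u p).
  rewrite nrm2_curry; apply: eq_bigr => x _; apply: eq_nrm2 => be.
  rewrite -acted_cons // /u /v /=.
  have -> : act (D i x) (fun be => acted s x be - phi x be) be =
     act (D i x) (acted s x) be - act (D i x) (phi x) be.
    by rewrite /act -sumrB; apply: eq_bigr => q _; rewrite mulrBr.
  by ring.
apply: le_trans (nrm2_triangle _ _) _; apply: lerD.
  by apply: ler_wsqrtr; rewrite nrm2_curry; exact: act_close.
apply: le_trans (IH us); apply: ler_wsqrtr.
by rewrite nrm2_curry; apply: ler_sum => x _; exact: (nrm2_act (fun be => acted s x be - phi x be) (@cD i x)).
Qed.

Definition acted_all x (be : G) : C := \sum_(a : Jt A') (\prod_l D l x (be.1 l) (a l)) * phi x (a, be.2).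

Lemma acted_all_close :
  \sum_x nrm2 (fun be => acted_all x be - phi x be) <= (\sum_i Num.sqrt (2 * delta i)) ^+ 2.
Proof.
have h : \sum_x nrm2 (fun be => acted_all x be - phi x be) =
    \sum_x nrm2 (fun be => acted (enum 'I_m) x be - phi x be).
  apply: eq_bigr => x _; apply: eq_nrm2 => be; congr (_ - _); apply: eq_bigr => a _.
  by congr (_ * _); apply: eq_bigr => l _; rewrite mem_enum.
have := acted_close (enum_uniq 'I_m); rewrite -h big_enum /= => h2.
have h0 : 0 <= \sum_x nrm2 (fun be => acted_all x be - phi x be).
  by apply: sumr_ge0 => x _; exact: nrm2_ge0.
by rewrite -(sqr_sqrtr h0) lerXn2r // nnegrE ?sqrtr_ge0 // sumr_ge0 // => i _; rewrite sqrtr_ge0.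
Qed.
End Family.
End LocalActions.

(** * Extraction of GHZ states once the hashes are known *)

Section SecondPhase.
Variable R : realType.
Local Notation C := R[i].
Local Notation "x %:C" := (real_complex R x).
Local Notation Re := (@complex.Re R).
Variables (m : nat) (j : 'I_m) (X A' Cc : 'I_m -> finType) (E : finType) (k : nat).
Local Notation Kt := {ffun 'I_k -> bool}.
Local Notation G := (Jt A' * E)%type.
Local Notation S := {ffun Jt X -> bool}.
Variables (phi : Jt X -> G -> C) (f : forall l, X l -> Cc l) (g : Jt X -> Kt).
Variable D : forall i, Jt X -> op R (A' i) (A' i).
Arguments D : clear implicits.
Variable U : forall i, Jt Cc -> Kt -> op R (Jt X * A' i)%type (Jt X * A' i)%type.
Arguments U : clear implicits.
Local Notation enc := (code f).

Hypothesis phi1 : \sum_x nrm2 (phi x) = 1.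
Hypothesis hD : forall i L v, \sum_(x | cls i f x == L) nrm2 (ap (D i x) v) <= nrm2 v.
Hypothesis cU : forall i c kap, contr (U i c kap).

Definition outc (i : 'I_m) : finType := (S * (Jt X * A' i))%type.

Local Notation sig := (Num.sqrt (#|{: S}|%:R^-1) : R).
Local Notation rho := (Num.sqrt (#|{: Jt X}|%:R^-1) : R).

Lemma S_gt0 : (#|{: S}|%:R : R) != 0.
Proof. by rewrite pnatr_eq0 -lt0n card_ffun_gt0 // card_bool. Qed.

Lemma X_gt0 : (#|{: Jt X}|%:R : R) != 0.
Proof.
rewrite pnatr_eq0 -lt0n; apply/card_gt0P.
case: (pickP (fun _ : Jt X => true)) => [x _|h]; first by exists x.
have := phi1; rewrite big_pred0 // => /esym/eqP; by rewrite oner_eq0.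
Qed.

Lemma sig2 : #|{: S}|%:R * sig ^+ 2 = 1 :> R.
Proof. by rewrite sqr_sqrtr ?invr_ge0 ?ler0n // mulfV ?S_gt0. Qed.
Lemma rho2 : #|{: Jt X}|%:R * rho ^+ 2 = 1 :> R.
Proof. by rewrite sqr_sqrtr ?invr_ge0 ?ler0n // mulfV ?X_gt0. Qed.

Definition signs (i : 'I_m) (s : 'I_m -> S) (x : Jt X) : R :=
  if i == j then \prod_(l | l != j) sgn R (s l x) else sgn R (s i x).

(** All parties have outcomes of one shape. For [j] the signs in the outcome are a dummy, of weight
    sig^2; for the others the tuple is a dummy, of weight rho^2, and [sig] normalises the
    measurement in the randomised basis. *)
Definition local_op (i : 'I_m) (yb : Jt X * A' i) c kap x (q : A' i) : C :=
  if i == j then sig%:C * \sum_b' U i c kap yb (x, b') * D i x b' q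
  else (sig * rho)%:C * D i x yb.2 q.
Arguments local_op : clear implicits.

(* Party [i] decodes a copy of [x], measures it in a basis randomised by the signs [s i],
   announces everything, and keeps the key [g x]; averaging over the signs forces the
   copies of [x] held by the parties to agree.  Party [j] undoes all the signs and applies
   the Uhlmann contraction [U]. *)
Definition final_kraus (c : Jt Cc) (i : 'I_m) (h : Jt outc) : op R Kt (X i * A' i)%type :=
  fun kap xq => \sum_(x : Jt X) ((x i == xq.1)%:R * ((enc x == c)%:R * (g x == kap)%:R)) *
    ((signs i (fun l => (h l).1) x)%:C * local_op i (h i).2 c kap x xq.2).
Arguments final_kraus : clear implicits.

Lemma sgn2 b : sgn R b ^+ 2 = 1.
Proof. by case: b; rewrite /sgn ?sqrrN expr1n. Qed.

Lemma final_kraus_adapt c i : i != j -> forall h h' : Jt outc, h i = h' i ->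
  final_kraus c i h = final_kraus c i h'.
Proof.
move=> ij h h' e; apply/funext => kap; apply/funext => xq; apply: eq_bigr => x _.
by rewrite /signs (negPf ij) e.
Qed.

Lemma decode_contr (c : Jt Cc) i (v : X i * A' i -> C) :
  \sum_(x | enc x == c) nrm2 (ap (D i x) (fun q => v (x i, q))) <= nrm2 v.
Proof.
rewrite nrm2_curry (partition_big (fun x : Jt X => x i) xpredT) //=; apply: ler_sum => xi _.
apply: le_trans (hD (xi, c) (fun q => v (xi, q))).
rewrite le_eqVlt; apply/orP; left; apply/eqP; apply: eq_big => [x|x /andP[_ /eqP ->] //].
by rewrite /cls xpair_eqE andbC.
Qed.

Lemma ap_final_kraus c i (h : Jt outc) v kap : ap (final_kraus c i h) v kap =
  \sum_x (signs i (fun l => (h l).1) x)%:C * (((enc x == c) && (g x == kap))%:R *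
     \sum_q local_op i (h i).2 c kap x q * v (x i, q)).
Proof.
rewrite /ap /final_kraus.
under eq_bigr do rewrite mulr_suml.
rewrite exchange_big /=; apply: eq_bigr => x _.
transitivity (\sum_xi \sum_q (x i == xi)%:R * ((enc x == c)%:R * (g x == kap)%:R) *
  ((signs i (fun l => (h l).1) x)%:C * local_op i (h i).2 c kap x q) * v (xi, q)).
  by rewrite pair_big; apply: eq_bigr => -[].
rewrite (bigD1 (x i)) //= [X in _ + X]big1 ?addr0; last first.
  by move=> xi hx; rewrite big1 // => q _; rewrite eq_sym (negPf hx) !mul0r.
rewrite !mulr_sumr; apply: eq_bigr => q _; rewrite eqxx mul1r.
by case: (enc x == c); case: (g x == kap); rewrite /= ?mulr1n; ring.
Qed.

Lemma sum_key (F : Jt X -> R) c :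
  \sum_kap \sum_x ((enc x == c) && (g x == kap))%:R * F x = \sum_(x | enc x == c) F x.
Proof.
rewrite exchange_big [RHS]big_mkcond /=; apply: eq_bigr => x _.
rewrite (bigD1 (g x)) //= eqxx andbT big1 ?addr0.
  by case: (_ == _); rewrite ?mul1r ?mul0r.
by move=> kap; rewrite eq_sym => /negPf ->; rewrite andbF mul0r.
Qed.

(** For [i != j] the sum over signs removes the cross terms between distinct x, by [sgn_nrm2]; for
    [j] the signs have modulus 1 and [U] is a contraction. What remains is contractivity of the
    decoders within one class. *)
Lemma final_kraus_contr c i (h : Jt outc) v :
  \sum_(o : outc i) nrm2 (ap (final_kraus c i (setc h o)) v) <= nrm2 v.
Proof.
apply: le_trans (decode_contr c v).
pose z x := ap (D i x) (fun q => v (x i, q)).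
rewrite -(sum_key (fun x => nrm2 (z x))).
have -> : \sum_(o : outc i) nrm2 (ap (final_kraus c i (setc h o)) v) =
  \sum_(s : S) \sum_(yb : Jt X * A' i) \sum_kap sqn (ap (final_kraus c i (setc h (s, yb))) v kap).
  by rewrite [RHS]pair_big; apply: eq_bigr => -[].
case: (eqVneq i j) => [ij|ij].
  have eij : (i == j) = true by apply/eqP.
  have sgE s yb x : signs i (fun l => (setc h ((s, yb) : outc i) l).1) x =
     \prod_(l | l != j) sgn R ((h l).1 x).
    rewrite /signs eij; apply: eq_bigr => l lj.
    have il : i != l by rewrite ij eq_sym.
    by rewrite (setc_out _ _ il).
  pose ze kap (xb : Jt X * A' i) := ((enc xb.1 == c) && (g xb.1 == kap))%:R *
     ((\prod_(l | l != j) sgn R ((h l).1 xb.1))%:C * z xb.1 xb.2).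
  have e s yb kap : ap (final_kraus c i (setc h ((s, yb) : outc i))) v kap =
     sig%:C * ap (U i c kap) (ze kap) yb.
    rewrite ap_final_kraus setc_in /=.
    have -> : ap (U i c kap) (ze kap) yb = \sum_x \sum_b U i c kap yb (x, b) * ze kap (x, b).
      by rewrite /ap pair_big; apply: eq_bigr => -[].
    rewrite mulr_sumr; apply: eq_bigr => x _; rewrite sgE.
    have -> : \sum_q local_op i yb c kap x q * v (x i, q) = sig%:C * \sum_b U i c kap yb (x, b) * z x b.
      rewrite /local_op eij.
      under eq_bigr do rewrite -mulrA mulr_suml.
      rewrite -mulr_sumr; congr (_ * _); rewrite exchange_big /=; apply: eq_bigr => b _.
      by rewrite /z /ap mulr_sumr; apply: eq_bigr => q _; rewrite mulrA.
    rewrite !mulr_sumr; apply: eq_bigr => b _; rewrite /ze /=; ring.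
  have -> : \sum_(s : S) \sum_(yb : Jt X * A' i) \sum_kap sqn (ap (final_kraus c i (setc h (s, yb))) v kap)
    = \sum_kap nrm2 (ap (U i c kap) (ze kap)).
    transitivity (\sum_(s : S) sig ^+ 2 * \sum_kap nrm2 (ap (U i c kap) (ze kap))).
      apply: eq_bigr => s _; rewrite exchange_big mulr_sumr /=; apply: eq_bigr => kap _.
      by rewrite /nrm2 mulr_sumr; apply: eq_bigr => yb _; rewrite e sqnM sqnC.
    by rewrite sumr_const -[LHS]mulr_natl mulrA sig2 mul1r.
  apply: ler_sum => kap _; apply: le_trans (cU c kap (ze kap)) _.
  rewrite nrm2_curry; apply: ler_sum => x _.
  rewrite /nrm2 mulr_sumr; apply: ler_sum => b _; rewrite /ze /= !sqnM sqnC sqn_nat.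
  rewrite -prodrXl [\prod_(l | l != j) _]big1 ?mul1r; last by move=> l _; exact: sgn2.
  by case: (_ && _); rewrite ?expr1n ?expr0n.
have e s (yb : Jt X * A' i) kap : ap (final_kraus c i (setc h ((s, yb) : outc i))) v kap =
   \sum_x (sgn R (s x))%:C * ((sig * rho)%:C * (((enc x == c) && (g x == kap))%:R * z x yb.2)).
  rewrite ap_final_kraus; apply: eq_bigr => x _.
  rewrite /signs (negPf ij) setc_in /=; congr (_ * _); rewrite mulrCA; congr (_ * _).
  by rewrite /local_op (negPf ij) /z /ap mulr_sumr; apply: eq_bigr => q _; rewrite mulrA.
rewrite le_eqVlt; apply/orP; left; apply/eqP.
rewrite exchange_big /=.
transitivity (\sum_(yb : Jt X * A' i) \sum_kap rho ^+ 2 * \sum_x ((enc x == c) && (g x == kap))%:R * sqn (z x yb.2)).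
  apply: eq_bigr => yb _; rewrite exchange_big /=; apply: eq_bigr => kap _.
  under eq_bigr do rewrite e.
  have er : rho ^+ 2 = #|{: S}|%:R * (sig * rho) ^+ 2 by rewrite exprMn mulrA sig2 mul1r.
  rewrite sgn_nrm2 er -mulrA; congr (_ * _); rewrite mulr_sumr; apply: eq_bigr => x _.
  by rewrite !sqnM sqnC sqn_nat; case: (_ && _); rewrite ?expr1n ?expr0n.
transitivity (\sum_(y : Jt X) \sum_(b : A' i) \sum_kap rho ^+ 2 * \sum_x ((enc x == c) && (g x == kap))%:R * sqn (z x b)).
  by rewrite [RHS]pair_big; apply: eq_bigr => -[].
rewrite sumr_const -[LHS]mulr_natl.
have -> : \sum_(b : A' i) \sum_kap rho ^+ 2 * \sum_x ((enc x == c) && (g x == kap))%:R * sqn (z x b) =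
   rho ^+ 2 * \sum_kap \sum_x ((enc x == c) && (g x == kap))%:R * nrm2 (z x).
  rewrite exchange_big mulr_sumr /=; apply: eq_bigr => kap _; rewrite -mulr_sumr; congr (_ * _).
  by rewrite exchange_big /=; apply: eq_bigr => x _; rewrite -mulr_sumr.
by rewrite mulrA rho2 mul1r.
Qed.

Definition zeta (i : 'I_m) : R := if i == j then sig else sig * rho.

Lemma zeta_const : (\prod_(i < m) #|{: S}|%:R) * (\prod_(i < m | i != j) #|{: Jt X}|%:R) *
  (\prod_i zeta i) ^+ 2 = 1 :> R.
Proof.
rewrite [X in _ * X * _]big_mkcond -big_split /= -prodrXl -big_split /= big1 // => i _.
rewrite /zeta; case: eqVneq => _ /=; first by rewrite mulr1 sig2.
by rewrite exprMn mulrACA sig2 rho2 mulr1.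
Qed.

Lemma sum_coord (T : finType) (W : nmodType) (F : T -> W) :
  \sum_(y : Jt (fun _ : 'I_m => T)) F (y j) = \sum_(t : T) F t *+ (\prod_(i < m | i != j) #|T|).
Proof.
rewrite (partition_big (fun y : Jt (fun _ : 'I_m => T) => y j) xpredT) //=; apply: eq_bigr => t _.
transitivity (\sum_(y : Jt (fun _ : 'I_m => T) | y j == t) F t).
  by apply: eq_bigr => y /eqP ->.
rewrite sumr_const; congr (_ *+ _).
pose P i : pred T := fun z => (i == j) ==> (z == t).
transitivity (#|(family P : {pred {ffun 'I_m -> T}})|).
  apply: eq_card => y; rewrite [LHS]unfold_in; apply/eqP/familyP => [h i|h].
    by rewrite unfold_in /P; apply/implyP => /eqP ->; rewrite h.
  by have := h j; rewrite unfold_in /P eqxx /= => /eqP.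
rewrite card_family foldrE big_map big_enum /= (bigD1 j) //=.
have -> : #|P j| = 1%N by rewrite -(card1 t); apply: eq_card => z; rewrite !unfold_in /P eqxx.
rewrite mul1n; apply: eq_bigr => i ij; apply: eq_card => z; rewrite !unfold_in /P.
by rewrite (negPf ij).
Qed.

(** The function [s i] is evaluated at [t i] by party [i] and at [t j] by party [j]; random signs at
    different points are uncorrelated. *)
Lemma signs_avg (t : {ffun 'I_m -> Jt X}) :
  \sum_(s : Jt (fun _ : 'I_m => S)) \prod_i signs i s (t i) =
  (\prod_(i < m) #|{: S}|%:R) * (t == [ffun => t j])%:R.
Proof.
pose F i (s : S) : R := if i == j then 1 else sgn R (s (t j)) * sgn R (s (t i)).
transitivity (\sum_(s : Jt (fun _ : 'I_m => S)) \prod_i F i (s i)).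
  apply: eq_bigr => s _; rewrite (bigD1 j) //= [RHS](bigD1 j) //=.
  have -> : signs j s (t j) = \prod_(l | l != j) sgn R (s l (t j)) by rewrite /signs eqxx.
  have -> : F j (s j) = 1 by rewrite /F eqxx.
  rewrite mul1r -big_split /=; apply: eq_bigr => i ij.
  by rewrite /signs /F (negPf ij).
rewrite (sum_prod_dffun (T := fun _ => S) F).
have -> : (t == [ffun => t j])%:R = \prod_(i < m) ((t j == t i)%:R : R).
  case: eqP => [e|ne].
    by rewrite big1 // => i _; rewrite e !ffunE eqxx.
  have [i hi] : exists i, t j != t i.
    apply/existsP; rewrite -negb_forall; apply/negP => /forallP h; apply: ne.
    by apply/ffunP => i; rewrite ffunE; apply/esym/eqP.
  by rewrite (bigD1 i) //= (negPf hi) mul0r.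
rewrite -big_split /=; apply: eq_bigr => i _; rewrite /F; case: (eqVneq i j) => [->|_].
  by rewrite sumr_const eqxx mulr1.
exact: sgn_avg.
Qed.

Definition after_first (c : Jt Cc) (w : Jt (fun i => (X i * A' i)%type : finType)) (e : E) : C :=
  (enc (finfun (fun l => (w l).1)) == c)%:R *
    phi (finfun (fun l => (w l).1)) (finfun (fun l => (w l).2), e).

Definition out_amp c (h : Jt outc) (e : E) : C :=
  \sum_z conjc (ghz_vec R z) * \sum_w kron (fun i => final_kraus c i h) z w * after_first c w e.

(** The unit vector against which [out_amp] is tested. It does not depend on the signs, so in the
    overlap the sum over signs falls on [out_amp] alone. *)
Definition target_amp c (h : Jt outc) (e : E) : C :=
  (\prod_i zeta i)%:C * ((enc (h j).2.1 == c)%:R *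
     phi (h j).2.1 (finfun (fun i => (h i).2.2), e)).

Lemma sum_outc (W : nmodType) (F : Jt outc -> W) :
  \sum_h F h = \sum_(s : Jt (fun _ : 'I_m => S)) \sum_(y : Jt (fun _ : 'I_m => Jt X))
    \sum_(b : Jt A') F (finfun (fun i => (s i, (y i, b i)))).
Proof.
rewrite (sum_Jt_pair (T1 := fun _ => S) (T2 := fun i => (Jt X * A' i)%type : finType)).
apply: eq_bigr => s _; rewrite (sum_Jt_pair (T1 := fun _ => Jt X)).
apply: eq_bigr => y _; apply: eq_bigr => b _; congr F.
by apply/ffunP => i; rewrite !ffunE.
Qed.

Lemma target_norm : \sum_c \sum_h nrm2 (target_amp c h) = 1.
Proof.
pose F x := (\prod_i zeta i) ^+ 2 * nrm2 (phi x).
transitivity (\sum_(s : Jt (fun _ : 'I_m => S)) \sum_(y : Jt (fun _ : 'I_m => Jt X)) F (y j)).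
  rewrite exchange_big sum_outc /=; apply: eq_bigr => s _; apply: eq_bigr => y _.
  rewrite /F (nrm2_curry (phi (y j))) mulr_sumr; apply: eq_bigr => b _.
  rewrite (bigD1 (enc (y j))) //= [X in _ + X]big1 ?addr0; last first.
    move=> c hc; rewrite /nrm2 big1 // => e _; rewrite /target_amp !ffunE /=.
    by rewrite eq_sym (negPf hc) mul0r mulr0 sqn0.
  rewrite /nrm2 mulr_sumr; apply: eq_bigr => e _; rewrite /target_amp !ffunE /= eqxx mul1r.
  rewrite sqnM sqnC; congr (_ * sqn (phi _ (_, _))).
  by apply/ffunP => i; rewrite !ffunE.
rewrite sum_coord sumr_const [X in _ *+ X](_ : _ = (\prod_(i < m) #|{: S}|)%N); last first.
  by rewrite -(card_Jt (fun _ : 'I_m => S)); apply: eq_card.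
rewrite sumrMnl -mulr_sumr phi1 mulr1 -mulrnA -mulr_natl natrM -[RHS]zeta_const.
by rewrite !natr_prod; congr (_ * _); rewrite mulrC.
Qed.

Definition sel_key c kap x : C := (enc x == c)%:R * (g x == kap)%:R.
Local Notation gam := ((Num.sqrt (#|{: Kt}|%:R^-1))%:C : C).
Definition outcome (s : Jt (fun _ : 'I_m => S)) (y : Jt (fun _ : 'I_m => Jt X)) (b : Jt A') : Jt outc :=
  finfun (fun i => (s i, (y i, b i))).

(** [t i] is the tuple that party [i] believes in. Each decoded tuple has the party's own outcome at
    its own position, so the actual tuple consists of the [t i i]. *)
Lemma expand_final_kraus c kap (h : Jt outc) (a : Jt A') (th : Jt X -> C) :
  \sum_(x' : Jt X) (\prod_i final_kraus c i h kap (x' i, a i)) * th x' =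
  \sum_(t : {ffun 'I_m -> Jt X})
    (\prod_i (sel_key c kap (t i) * ((signs i (fun l => (h l).1) (t i))%:C *
       local_op i (h i).2 c kap (t i) (a i)))) * th (finfun (fun i => t i i)).
Proof.
under eq_bigr do rewrite /final_kraus bigA_distr_bigA mulr_suml.
rewrite exchange_big /=; apply: eq_bigr => t _.
pose d : Jt X := finfun (fun i => t i i).
have pd (x' : Jt X) : \prod_i ((t i i == x' i)%:R : C) = (x' == d)%:R.
  case: eqP => [->|ne].
    by rewrite big1 // => i _; rewrite ffunE eqxx.
  have [i hi] : exists i, t i i != x' i.
    apply/existsP; rewrite -negb_forall; apply/negP => /forallP h'; apply: ne.
    by apply/ffunP => i; rewrite ffunE; apply/esym/eqP.
  by rewrite (bigD1 i) //= (negPf hi) mul0r.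
transitivity (\sum_(x' : Jt X) (x' == d)%:R * ((\prod_i (sel_key c kap (t i) *
   ((signs i (fun l => (h l).1) (t i))%:C * local_op i (h i).2 c kap (t i) (a i)))) * th x')).
  apply: eq_bigr => x' _; rewrite -pd mulrA -big_split /=; congr (_ * _).
  by apply: eq_bigr => i _; rewrite /sel_key -[LHS]mulrA.
rewrite (bigD1 d) //= eqxx mul1r [X in _ + X]big1 ?addr0 // => x' /negPf ->.
by rewrite mul0r.
Qed.

Lemma sel_key_prod c kap x : \prod_(i < m) sel_key c kap x = sel_key c kap x.
Proof.
have idem : sel_key c kap x * sel_key c kap x = sel_key c kap x.
  by rewrite /sel_key; case: (enc x == c); case: (g x == kap); rewrite /= ?mulr1n ?mulr0n; ring.
rewrite (bigD1 j) //=; elim/big_rec: _ => [|i z _ IH]; first by rewrite mulr1.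
by rewrite IH idem.
Qed.

Lemma out_amp_avg c y b e :
  \sum_s out_amp c (outcome s y b) e = (\prod_(i < m) #|{: S}|%:R) *
   \sum_kap gam * \sum_x sel_key c kap x *
     \sum_(a : Jt A') (\prod_i local_op i (y i, b i) c kap x (a i)) * phi x (a, e).
Proof.
transitivity (\sum_(s : Jt (fun _ : 'I_m => S)) \sum_kap gam * \sum_(a : Jt A') \sum_(t : {ffun 'I_m -> Jt X})
   (\prod_i signs i s (t i))%:C * ((\prod_i sel_key c kap (t i)) * (\prod_i local_op i (y i, b i) c kap (t i) (a i))
     * ((enc (finfun (fun i => t i i)) == c)%:R * phi (finfun (fun i => t i i)) (a, e)))).
  apply: eq_bigr => s _; rewrite /out_amp (sum_ghz j); apply: eq_bigr => kap _; congr (_ * _).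
  rewrite (sum_Jt_pair (T1 := X) (T2 := A')) exchange_big /=; apply: eq_bigr => a _.
  transitivity (\sum_(x' : Jt X) (\prod_i final_kraus c i (outcome s y b) kap (x' i, a i)) *
     ((enc x' == c)%:R * phi x' (a, e))).
    apply: eq_bigr => x' _; rewrite /kron /after_first; congr (_ * _).
      by apply: eq_bigr => i _; rewrite !ffunE.
    have -> : finfun (fun l => ((finfun (fun i => (x' i, a i)) : Jt (fun i => (X i * A' i)%type : finType)) l).1) = x'.
      by apply/ffunP => l; rewrite !ffunE.
    have -> : finfun (fun l => ((finfun (fun i => (x' i, a i)) : Jt (fun i => (X i * A' i)%type : finType)) l).2) = a.
      by apply/ffunP => l; rewrite !ffunE.
    by [].
  rewrite expand_final_kraus; apply: eq_bigr => t _.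
  rewrite [RHS]mulrA; congr (_ * _); rewrite rc_prod -!big_split /=; apply: eq_bigr => i _.
  have -> : signs i (fun l => (outcome s y b l).1) (t i) = signs i s (t i).
    rewrite /signs; case: ifP => _; last by rewrite ffunE.
    by apply: eq_bigr => l _; rewrite ffunE.
  by rewrite ffunE /=; ring.
rewrite exchange_big mulr_sumr /=; apply: eq_bigr => kap _.
rewrite -mulr_sumr [RHS]mulrCA; congr (_ * _).
transitivity (\sum_(a : Jt A') \sum_(t : {ffun 'I_m -> Jt X})
   ((\prod_(i < m) #|{: S}|%:R) * (t == [ffun => t j])%:R)%:C *
   ((\prod_i sel_key c kap (t i)) * (\prod_i local_op i (y i, b i) c kap (t i) (a i))
     * ((enc (finfun (fun i => t i i)) == c)%:R * phi (finfun (fun i => t i i)) (a, e)))).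
  rewrite exchange_big /=; apply: eq_bigr => a _; rewrite exchange_big /=; apply: eq_bigr => t _.
  by rewrite -signs_avg rc_sum mulr_suml.
rewrite mulr_sumr exchange_big /=.
rewrite (bigID (fun t : {ffun 'I_m -> Jt X} => t == [ffun => t j])) /= [X in _ + X]big1 ?addr0; last first.
  by move=> t /negPf ht; rewrite big1 // => a _; rewrite ht mulr0 mul0r.
rewrite (reindex_onto (fun x => [ffun => x] : {ffun 'I_m -> Jt X}) (fun t => t j)) /=; last by move=> t /eqP.
apply: eq_big => [x|x _]; first by rewrite !ffunE !eqxx.
rewrite mulrA mulr_sumr; apply: eq_bigr => a _.
have -> : finfun (fun i => ([ffun => x] : {ffun 'I_m -> Jt X}) i i) = x.
  by apply/ffunP => i; rewrite !ffunE.
rewrite ffunE eqxx mulr1.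
under [X in _ * (X * _ * _) = _]eq_bigr do rewrite ffunE.
under [X in _ * (_ * X * _) = _]eq_bigr do rewrite ffunE.
rewrite sel_key_prod rc_prod; under [X in X * _ = _]eq_bigr do rewrite rc_nat.
by rewrite /sel_key; case: (enc x == c); rewrite ?mul1r ?mul0r ?mulr0 ?mul0r // !mulrA.
Qed.

Lemma local_op_prod c kap x (y : Jt (fun _ : 'I_m => Jt X)) (b : Jt A') e :
  \sum_(a : Jt A') (\prod_i local_op i (y i, b i) c kap x (a i)) * phi x (a, e) =
  (\prod_i zeta i)%:C * \sum_b' U j c kap (y j, b j) (x, b') * acted_all phi D x (setc b b', e).
Proof.
rewrite /acted_all; under [X in _ = _ * X]eq_bigr do rewrite mulr_sumr.
rewrite exchange_big mulr_sumr /=; apply: eq_bigr => a _.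
under [X in _ = _ * X]eq_bigr do rewrite mulrA.
rewrite -mulr_suml mulrA; congr (_ * _).
have -> : \prod_i local_op i (y i, b i) c kap x (a i) =
  (sig%:C * \sum_b' U j c kap (y j, b j) (x, b') * D j x b' (a j)) *
  \prod_(i | i != j) ((sig * rho)%:C * D i x (b i) (a i)).
  rewrite (bigD1 j) //=; congr (_ * _); first by rewrite /local_op eqxx.
  by apply: eq_bigr => i ij; rewrite /local_op (negPf ij).
have -> : (\prod_i zeta i)%:C = sig%:C * \prod_(i | i != j) (sig * rho)%:C.
  rewrite rc_prod (bigD1 j) //= /zeta eqxx; congr (_ * _).
  by apply: eq_bigr => i ij; rewrite (negPf ij).
have e2 b' : \prod_l D l x (setc b b' l) (a l) = D j x b' (a j) * \prod_(i | i != j) D i x (b i) (a i).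
  rewrite (bigD1 j) //= setc_in; congr (_ * _); apply: eq_bigr => i ij.
  by rewrite setc_out // eq_sym.
under [X in _ = _ * X]eq_bigr do rewrite e2 mulrA.
by rewrite -mulr_suml big_split /=; ring.
Qed.

(** The overlap as a linear functional of the state entering [U]: at [phi] it is the overlap of the
    privacy estimate, at [acted_all] that of the actual protocol. *)
Definition ip_form (th : Jt X -> G -> C) : C :=
  \sum_c \sum_kap gam * \sum_be \sum_y \sum_x \sum_b'
    conjc ((enc y == c)%:R * phi y be) *
    (sel_key c kap x * (U j c kap (y, be.1 j) (x, b') * th x (setc be.1 b', be.2))).

Lemma overlap :
  \sum_c \sum_h inner (target_amp c h) (out_amp c h) = ip_form (acted_all phi D).
Proof.
apply: eq_bigr => c _.
pose F (b : Jt A') (e : E) (kap : Kt) (y0 : Jt X) : C :=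
  conjc ((enc y0 == c)%:R * phi y0 (b, e)) * (gam * \sum_x sel_key c kap x *
    \sum_b' U j c kap (y0, b j) (x, b') * acted_all phi D x (setc b b', e)).
transitivity (\sum_(b : Jt A') \sum_e \sum_(y : Jt (fun _ : 'I_m => Jt X)) \sum_kap
   ((\prod_(i < m) #|{: S}|%:R) * (\prod_i zeta i) ^+ 2)%:C * F b e kap (y j)).
  rewrite sum_outc exchange_big /=.
  under eq_bigr do rewrite exchange_big /=.
  rewrite exchange_big /=; apply: eq_bigr => b _.
  under eq_bigr => y _ do rewrite exchange_big /=.
  rewrite exchange_big /=; apply: eq_bigr => e _; apply: eq_bigr => y _.
  transitivity (conjc ((\prod_i zeta i)%:C * ((enc (y j) == c)%:R * phi (y j) (b, e))) *
     \sum_s out_amp c (outcome s y b) e).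
    rewrite mulr_sumr; apply: eq_bigr => s _; rewrite /target_amp !ffunE /=.
    congr (conjc (_ * (_ * phi _ (_, _))) * _).
    by apply/ffunP => i; rewrite !ffunE.
  rewrite out_amp_avg !mulr_sumr; apply: eq_bigr => kap _; rewrite /F.
  under [X in _ * (_ * (_ * X)) = _]eq_bigr do rewrite local_op_prod mulrCA.
  rewrite -mulr_sumr.
  have -> : ((\prod_(i < m) #|{: S}|%:R) * (\prod_i zeta i) ^+ 2)%:C =
     (\prod_(i < m) #|{: S}|%:R) * ((\prod_i zeta i)%:C * (\prod_i zeta i)%:C).
    by rewrite expr2 !rcM [X in X * _ = _]rc_prod; congr (_ * _); apply: eq_bigr => i _; rewrite rc_nat.
  by rewrite [conjc (_%:C * _)]conjcM conjc_rc; ring.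
transitivity (\sum_(b : Jt A') \sum_e \sum_kap \sum_y0 F b e kap y0).
  apply: eq_bigr => b _; apply: eq_bigr => e _; rewrite exchange_big /=; apply: eq_bigr => kap _.
  rewrite (sum_coord (fun y0 => ((\prod_(i < m) #|{: S}|%:R) * (\prod_i zeta i) ^+ 2)%:C * F b e kap y0)).
  rewrite sumrMnl -mulr_sumr -[LHS]mulr_natl mulrA.
  rewrite -[RHS]mul1r; congr (_ * _); rewrite -rc_nat -rcM natr_prod.
  by rewrite mulrA [\prod_(i < m | _) _ * _]mulrC zeta_const.
rewrite pair_big /=; rewrite exchange_big /=; apply: eq_bigr => kap _.
rewrite mulr_sumr; apply: eq_bigr => -[b e] _ /=.
rewrite mulr_sumr; apply: eq_bigr => y _; rewrite /F.
rewrite mulrCA; congr (_ * _); rewrite mulr_sumr; apply: eq_bigr => x _.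
by rewrite !mulr_sumr; apply: eq_bigr => b' _.
Qed.

Variable a0 : Jt A'.
Local Notation target := (key_target Kt (splitoff phi a0 (i := j)) enc).
Local Notation state th := (key_state (splitoff th a0 (i := j)) enc g).

Lemma ip_form_key (th : Jt X -> G -> C) :
  ip_form th = \sum_c \sum_kap \sum_be inner (target c be) (ap (U j c kap) (state th c kap be)).
Proof.
apply: eq_bigr => c _; apply: eq_bigr => kap _.
rewrite (sum_splitoff a0 j) big_mkcond mulr_sumr; apply: eq_bigr => -[b e] _ /=.
rewrite inner_curry; under [RHS]eq_bigr do rewrite /inner.
rewrite [RHS]exchange_big /=; case: ifP => bj; last first.
  rewrite mulr0 big1 // => q _; rewrite big1 // => y _.
  by rewrite /key_target /splitoff /= bj mul0r !mulr0 conjc0 mul0r.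
rewrite mulr_sumr; apply: eq_bigr => q _; rewrite mulr_sumr; apply: eq_bigr => y _.
have -> : ap (U j c kap) (state th c kap (b, e)) (y, q) =
  \sum_x \sum_b' U j c kap (y, q) (x, b') * state th c kap (b, e) (x, b').
  by rewrite /ap [RHS]pair_big; apply: eq_bigr => -[].
rewrite [LHS]mulr_sumr [RHS]mulr_sumr; apply: eq_bigr => x _.
rewrite [LHS]mulr_sumr [RHS]mulr_sumr; apply: eq_bigr => b' _.
rewrite /key_target /key_state /splitoff /= bj !setcC setc_in !mul1r.
by rewrite [conjc (_%:C * _)]conjcM conjc_rc /sel_key; ring.
Qed.

Lemma sum_state (th : Jt X -> G -> C) : \sum_c \sum_kap hs2 (state th c kap) = \sum_x nrm2 (th x).
Proof.
transitivity (\sum_x hs2 (splitoff th a0 (i := j) x)); last first.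
  by apply: eq_bigr => x _; rewrite hs2_splitoff.
transitivity (\sum_x \sum_c \sum_kap \sum_be nrm2 (fun q => state th c kap be (x, q))).
  rewrite [RHS]exchange_big /=; apply: eq_bigr => c _.
  rewrite [RHS]exchange_big /=; apply: eq_bigr => kap _.
  by rewrite [RHS]exchange_big /=; apply: eq_bigr => be _; rewrite nrm2_curry.
apply: eq_bigr => x _.
have z q c kap be : state th c kap be (x, q) =
  ((enc x == c) && (g x == kap))%:R * splitoff th a0 (i := j) x be q.
  by rewrite /key_state /= mulrA; case: (_ == _); case: (_ == _); rewrite ?mul1r ?mul0r.
rewrite (bigD1 (enc x)) //= [X in _ + X]big1 ?addr0; last first.
  move=> c hc; rewrite big1 // => kap _; rewrite big1 // => be _.
  by rewrite /nrm2 big1 // => q _; rewrite z eq_sym (negPf hc) mul0r sqn0.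
rewrite (bigD1 (g x)) //= [X in _ + X]big1 ?addr0; last first.
  move=> kap hk; rewrite big1 // => be _.
  by rewrite /nrm2 big1 // => q _; rewrite z [g x == _]eq_sym (negPf hk) andbF mul0r sqn0.
by apply: eq_bigr => be _; apply: eq_nrm2 => q; rewrite z !eqxx mul1r.
Qed.

Lemma sum_target : \sum_c \sum_(kap : Kt) hs2 (target c) = 1.
Proof.
have Kn0 : #|{: Kt}|%:R != 0 :> R by rewrite pnatr_eq0 -lt0n card_ffun_gt0 // card_bool.
rewrite -phi1 -sum_state; apply: eq_bigr => c _.
have e be : nrm2 (target c be) = #|{: Kt}|%:R^-1 * \sum_kap nrm2 (state phi c kap be).
  rewrite nrm2Z sqnC sqr_sqrtr ?invr_ge0 ?ler0n //; congr (_ * _).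
  rewrite /nrm2 exchange_big /=; apply: eq_bigr => -[x q] _ /=.
  rewrite (bigD1 (g x)) //= [X in _ + X]big1 ?addr0.
    by rewrite /key_state /= eqxx mul1r.
  by move=> kap hk; rewrite /key_state /= [g x == _]eq_sym (negPf hk) mul0r mulr0 sqn0.
rewrite sumr_const /hs2; under eq_bigr do rewrite e.
rewrite -mulr_sumr -[LHS]mulr_natl mulrA mulfV // mul1r exchange_big /=.
by apply: eq_bigr => kap _.
Qed.

(** The targets form a unit vector and the [U] are contractions, so the functional has norm at most
    1; passing from [phi] to [acted_all] costs only their distance. *)
Lemma ip_form_le (th : Jt X -> G -> C) : `|Re (ip_form th)| <= Num.sqrt (\sum_x nrm2 (th x)).
Proof.
rewrite ip_form_key.
pose u (p : Jt Cc * (Kt * (G * (Jt X * A' j)))) := target p.1 p.2.2.1 p.2.2.2.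
pose v (p : Jt Cc * (Kt * (G * (Jt X * A' j)))) :=
  ap (U j p.1 p.2.1) (state th p.1 p.2.1 p.2.2.1) p.2.2.2.
have -> : \sum_c \sum_kap \sum_be inner (target c be) (ap (U j c kap) (state th c kap be)) = inner u v.
  rewrite inner_curry; apply: eq_bigr => c _; rewrite inner_curry; apply: eq_bigr => kap _.
  by rewrite inner_curry.
have nu : nrm2 u = 1.
  rewrite -sum_target nrm2_curry; apply: eq_bigr => c _; rewrite nrm2_curry; apply: eq_bigr => kap _.
  by rewrite nrm2_curry.
apply: le_trans (CS u v) _; rewrite nu sqrtr1 mul1r ler_wsqrtr // -sum_state.
rewrite nrm2_curry; apply: ler_sum => c _; rewrite nrm2_curry; apply: ler_sum => kap _.
rewrite nrm2_curry; apply: ler_sum => be _; exact: (@cU j c kap (state th c kap be)).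
Qed.

Lemma ip_formB (th th' : Jt X -> G -> C) : ip_form (fun x be => th x be - th' x be) = ip_form th - ip_form th'.
Proof.
rewrite /ip_form -sumrB; apply: eq_bigr => c _; rewrite -sumrB; apply: eq_bigr => kap _.
rewrite -mulrBr; congr (_ * _).
do 4 (rewrite -sumrB; apply: eq_bigr => ? _).
ring.
Qed.

Lemma decode_each i x : contr (D i x).
Proof.
move=> v; apply: le_trans (hD (cls i f x) v).
by rewrite (bigD1 x) //= lerDl sumr_ge0 // => y _; exact: nrm2_ge0.
Qed.

(** By Cauchy-Schwarz against [target_amp], the squared overlap is at most the total GHZ weight; the
    overlap is that of the privacy estimate up to the decoding errors. *)
Lemma second_phase_value (eps : R) (delta : 'I_m -> R) :
  (forall i, 1 - delta i <= Re (\sum_x \sum_be inner (splitoff phi a0 x be) (ap (D i x) (splitoff phi a0 x be)))) ->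
  1 - eps <= Re (\sum_c \sum_kap \sum_be inner (target c be) (ap (U j c kap) (state phi c kap be))) ->
  0 <= 1 - eps - \sum_i Num.sqrt (2 * delta i) ->
  (1 - eps - \sum_i Num.sqrt (2 * delta i)) ^+ 2 <= \sum_c \sum_h nrm2 (out_amp c h).
Proof.
move=> hdel heps hB; set B := 1 - eps - _ in hB *.
rewrite -ip_form_key in heps.
have close := acted_all_close decode_each phi1 hdel.
have s0 : 0 <= \sum_i Num.sqrt (2 * delta i) by apply: sumr_ge0 => i _; rewrite sqrtr_ge0.
have B1 : B <= Re (ip_form (acted_all phi D)).
  have := ip_form_le (fun x be => acted_all phi D x be - phi x be).
  rewrite ip_formB ReB => h1.
  have h2 := ler_wsqrtr close; rewrite sqrtr_sqr ger0_norm // in h2.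
  have := le_trans h1 h2; rewrite ler_norml => /andP[h3 _].
  rewrite /B; lra.
pose u (p : Jt Cc * (Jt outc * E)) := target_amp p.1 p.2.1 p.2.2.
pose v (p : Jt Cc * (Jt outc * E)) := out_amp p.1 p.2.1 p.2.2.
have nu : nrm2 u = 1.
  by rewrite -target_norm nrm2_curry; apply: eq_bigr => c _; rewrite nrm2_curry.
have -> : \sum_c \sum_h nrm2 (out_amp c h) = nrm2 v.
  by rewrite nrm2_curry; apply: eq_bigr => c _; rewrite nrm2_curry.
have e : inner u v = ip_form (acted_all phi D).
  by rewrite -overlap inner_curry; apply: eq_bigr => c _; rewrite inner_curry.
have := CS2 u v; rewrite nu mul1r e; apply: le_trans.
by rewrite lerXn2r // nnegrE; apply: le_trans B1.
Qed.
End SecondPhase.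

(** * The two-round protocol *)

Section OneShotGHZ.
Variable R : realType.
Local Notation C := R[i].
Local Notation "x %:C" := (real_complex R x).
Local Notation Re := (@complex.Re R).

Lemma instrument_norm (O V T : finType) (F : O -> op R V T) v :
  (forall a b, \sum_o opmul (adj (F o)) (F o) a b = @idop R T a b) ->
  \sum_o nrm2 (ap (F o) v) = nrm2 v.
Proof.
move=> hF; apply: (@complexI R); rewrite rc_sum -inner_nrm2.
transitivity (\sum_o inner v (ap (gram (adj (F o))) v)).
  by apply: eq_bigr => o _; rewrite inner_gram adjK inner_nrm2.
rewrite -(eq_inner (fun _ => erefl) (ap_idop v)) /inner exchange_big /=.
apply: eq_bigr => t _; rewrite -mulr_sumr; congr (_ * _).
rewrite /ap exchange_big /=; apply: eq_bigr => s _; rewrite -mulr_suml -hF; congr (_ * _).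
by apply: eq_bigr => o _; rewrite opmul_adj.
Qed.

Variables (m : nat) (A A' X : 'I_m -> finType) (E : finType).
Variables (psi : vec R (Jt A * E)%type) (Ek : forall j : 'I_m, X j -> op R (A' j) (A j)).
Arguments Ek : clear implicits.
Hypothesis psi1 : unit_vec psi.
Hypothesis hE : forall j a b, \sum_(x : X j) opmul (adj (Ek j x)) (Ek j x) a b = @idop R (A j) a b.

Lemma kraus_prod_complete a b :
  \sum_(x : Jt X) opmul (adj (kraus_prod Ek x)) (kraus_prod Ek x) a b = @idop R (Jt A) a b.
Proof.
transitivity (\prod_l \sum_(x : X l) \sum_y conjc (Ek l x y (a l)) * Ek l x y (b l)).
  rewrite -(sum_prod_dffun (fun l x => \sum_y conjc (Ek l x y (a l)) * Ek l x y (b l))).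
  apply: eq_bigr => x _.
  rewrite -(sum_prod_dffun (fun l y => conjc (Ek l (x l) y (a l)) * Ek l (x l) y (b l))).
  by apply: eq_bigr => y _; rewrite /adj /kraus_prod conjc_prod -big_split.
transitivity (\prod_l ((a l == b l)%:R : C)); first by apply: eq_bigr => l _; exact: hE.
rewrite /idop; case: eqVneq => [->|ne].
  by rewrite big1 // => l _; rewrite eqxx.
have [i hi] : exists i, a i != b i.
  apply/existsP; rewrite -negb_forall; apply: contra ne => /forallP h.
  by apply/eqP/ffunP => i; apply/eqP.
by rewrite (bigD1 i) //= (negPf hi) mul0r.
Qed.

Definition post (x : Jt X) (be : Jt A' * E) : C := \sum_a kraus_prod Ek x be.1 a * psi (a, be.2).

Lemma psi_nrm2 : nrm2 psi = 1.
Proof.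
apply: (@complexI R); rewrite -inner_nrm2; exact: psi1.
Qed.

Lemma post_nrm2 : \sum_x nrm2 (post x) = 1.
Proof.
rewrite -psi_nrm2.
transitivity (\sum_x \sum_e nrm2 (ap (kraus_prod Ek x) (fun a => psi (a, e)))).
  apply: eq_bigr => x _; rewrite [RHS]exchange_big /nrm2 [RHS]pair_big /=.
  by apply: eq_bigr => -[].
rewrite exchange_big /=.
under eq_bigr do rewrite (instrument_norm _ kraus_prod_complete).
by rewrite [RHS]nrm2_curry /nrm2 exchange_big.
Qed.

Variables (j : 'I_m) (k : nat) (Cc : 'I_m -> finType) (f : forall l, X l -> Cc l).
Local Notation Kt := {ffun 'I_k -> bool}.
Variables (g : Jt X -> Kt) (D : forall i, Jt X -> op R (A' i) (A' i)).
Variable U : forall i, Jt Cc -> Kt -> op R (Jt X * A' i)%type (Jt X * A' i)%type.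
Arguments D : clear implicits.
Arguments U : clear implicits.
Hypothesis hD : forall i L v, \sum_(x | cls i f x == L) nrm2 (ap (D i x) v) <= nrm2 v.
Hypothesis cU : forall i c kap, contr (U i c kap).

(** The hash alone is announced; the outcome itself stays in a register, in superposition. *)
Definition first_kraus (i : 'I_m) (h : Jt Cc) : op R (X i * A' i)%type (A i) :=
  fun xa a => (f xa.1 == h i)%:R * Ek i xa.1 xa.2 a.
Arguments first_kraus : clear implicits.

Lemma first_kraus_contr i (h : Jt Cc) v :
  \sum_(o : Cc i) nrm2 (ap (first_kraus i (setc h o)) v) <= nrm2 v.
Proof.
rewrite -(instrument_norm v (hE (j := i))) le_eqVlt; apply/orP; left; apply/eqP.
under eq_bigr do rewrite nrm2_curry.
rewrite exchange_big /=; apply: eq_bigr => x _.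
rewrite exchange_big /=; apply: eq_bigr => y _.
have e (o : Cc i) : ap (first_kraus i (setc h o)) v (x, y) = (f x == o)%:R * ap (Ek i x) v y.
  rewrite /ap mulr_sumr; apply: eq_bigr => a _.
  by rewrite /first_kraus setc_in /= mulrA.
under eq_bigr do rewrite e sqnM sqn_nat.
rewrite (bigD1 (f x)) //= eqxx expr1n mul1r big1 ?addr0 // => o ho.
by rewrite eq_sym (negPf ho) expr0n mul0r.
Qed.

Lemma first_phase_state c w e :
  \sum_b kron (fun i => first_kraus i c) w b * psi (b, e) = after_first post f c w e.
Proof.
rewrite /after_first /post mulr_sumr; apply: eq_bigr => a _; rewrite mulrA; congr (_ * _).
rewrite /kron /first_kraus big_split /=; congr (_ * _); last first.
  by apply: eq_bigr => i _; rewrite !ffunE.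
case: eqP => [<-|ne].
  by rewrite big1 // => i _; rewrite !ffunE eqxx.
have [i hi] : exists i, f (w i).1 != c i.
  apply/existsP; rewrite -negb_forall; apply/negP => /forallP h; apply: ne.
  by apply/ffunP => i; rewrite !ffunE; apply/eqP.
by rewrite (bigD1 i) //= (negPf hi) mul0r.
Qed.

(** [LOCC_gain] is used twice: for the second round after each announcement [c], with the identity
    as continuation, and for the first round with the protocols so obtained as continuations. *)
Lemma oneshot_ghz (x0 : Jt X) (a0 : Jt A') (eps : R) (delta : 'I_m -> R) :
  (forall i, 1 - delta i <= Re (\sum_x \sum_be
     inner (splitoff post a0 x be) (ap (D i x) (splitoff post a0 x be)))) ->
  1 - eps <= Re (\sum_c \sum_kap \sum_be
     inner (key_target Kt (splitoff post a0 (i := j)) (code f) c be)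
       (ap (U j c kap) (key_state (splitoff post a0 (i := j)) (code f) g c kap be))) ->
  0 <= 1 - eps - \sum_i Num.sqrt (2 * delta i) ->
  exists Lam : chan R A (@qsys m k), LOCC Lam /\
    (1 - eps - \sum_i Num.sqrt (2 * delta i)) ^+ 2 <= expval (@ghz_vec R m k) (Lam (trE psi)).
Proof.
move=> hdel heps hB.
have main := second_phase_value post_nrm2 hD cU hdel heps hB.
pose T2 i : finType := (X i * A' i)%type.
have ph2 c : exists Lam : chan R T2 (@qsys m k), LOCC Lam /\
   \sum_h nrm2 (out_amp j post f g D U c h) <= expval (@ghz_vec R m k) (Lam (gram (after_first post f c))).
  pose h0 : Jt (outc X A') := finfun (fun i => ([ffun => false], (x0, a0 i))).
  pose v0 : Jt (@qsys m k) := finfun (fun _ => [ffun => false]).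
  have [Lam [hL hv]] := LOCC_gain (K := fun i h => final_kraus (i:=i) j f g D U c h)
    (Psi := fun _ rho => rho) h0 v0 (@ghz_vec R m k) (after_first post f c)
    (fun i ij h h' e => final_kraus_adapt f g D U c ij e) (fun i h v => final_kraus_contr j g post_nrm2 hD cU c h v)
    (fun _ => @LOCC_id R m (@qsys m k)).
  exists Lam; split=> //; apply: le_trans hv; rewrite le_eqVlt; apply/orP; left; apply/eqP.
  apply: eq_bigr => h _; rewrite expval_gram -nrm2J; apply: eq_nrm2 => e.
  rewrite /out_amp conjc_sum; apply: eq_bigr => z _.
  by rewrite conjcM conjcK mulrC.
have /choice [Lam hLam] := ph2.
pose v0 : Jt T2 := finfun (fun i => (x0 i, a0 i)).
have hadapt (i : 'I_m) : i != j -> forall h h' : Jt Cc, h i = h' i -> first_kraus i h = first_kraus i h'.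
  by move=> _ h h' e; rewrite /first_kraus e.
have [Lam' [hL hv]] := LOCC_gain (j := j) (K := first_kraus) (Psi := Lam) (code f x0) v0 (@ghz_vec R m k)
   (fun a e => psi (a, e)) hadapt (fun i h v => first_kraus_contr h v) (fun c => (hLam c).1).
exists Lam'; split=> //.
apply: le_trans main (le_trans _ hv); apply: ler_sum => c _.
apply: le_trans (hLam c).2 _.
have -> : (fun a e => \sum_b kron (fun i => first_kraus i c) a b * psi (b, e)) = after_first post f c.
  by apply/funext => w; apply/funext => e; exact: first_phase_state.
exact: lexx.
Qed.
End OneShotGHZ.

Section Protocols.
Variable R : realType.
Local Notation C := R[i].
Local Notation "x %:C" := (real_complex R x).

Lemma fidelity_of_val (m : nat) (T U : 'I_m -> finType) (Lam : chan R T U) (D : finType)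
    (N : Jt T -> D -> C) (G : Jt U -> C) (B : R) :
  LOCC Lam -> B ^+ 2 <= expval G (Lam (gram N)) -> B <= fidelity (proj G) (Lam (gram N)).
Proof.
move=> hL; have [D' [N' ->]] := LOCC_gram hL N => hB.
apply: le_trans (fidelity_ge G N'); apply: le_trans (ler_norm B) _.
by rewrite -sqrtr_sqr ler_wsqrtr.
Qed.

Lemma fidelity_ge0 (m : nat) (T U : 'I_m -> finType) (Lam : chan R T U) (D : finType)
    (N : Jt T -> D -> C) (G : Jt U -> C) :
  LOCC Lam -> 0 <= fidelity (proj G) (Lam (gram N)).
Proof.
move=> hL; apply: fidelity_of_val => //; have [D' [N' ->]] := LOCC_gram hL N.
by rewrite expr0n expval_gram nrm2_ge0.
Qed.

(** A fallback protocol: everybody measures and prepares a fixed string. For [k = 0] the target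
    space is one-dimensional and nothing is lost; for other [k] this supplies a protocol of error
    1. *)
Lemma measure_prepare (m : nat) (j : 'I_m) (T : 'I_m -> finType) (a0 : Jt T) (k : nat) (D : finType)
    (N : Jt T -> D -> C) :
  exists Lam : chan R T (@qsys m k), LOCC Lam /\
    (k = 0%N -> \sum_a nrm2 (N a) <= expval (@ghz_vec R m k) (Lam (gram N))).
Proof.
pose v0 : Jt (@qsys m k) := finfun (fun _ => [ffun => false]).
pose K (i : 'I_m) (h : Jt T) : op R (@qsys m k i) (T i) :=
  fun z a => (z == v0 i)%:R * (a == h i)%:R.
have apK i (h : Jt T) (v : T i -> C) z : ap (K i h) v z = (z == v0 i)%:R * v (h i).
  rewrite /ap (bigD1 (h i)) //= [X in _ + X]big1 ?addr0.
    by rewrite /K eqxx mulr1.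
  by move=> a /negPf ha; rewrite /K ha mulr0 mul0r.
have hK i (h : Jt T) (v : T i -> C) : \sum_(o : T i) nrm2 (ap (K i (setc h o)) v) <= nrm2 v.
  apply: ler_sum => o _; rewrite /nrm2 (bigD1 (v0 i)) //= [X in _ + X]big1 ?addr0.
    by rewrite apK eqxx mul1r setc_in.
  by move=> z /negPf hz; rewrite apK hz mul0r sqn0.
have hadapt (i : 'I_m) : i != j -> forall h h' : Jt T, h i = h' i -> K i h = K i h'.
  by move=> _ h h' e; rewrite /K e.
have [Lam [hL hv]] := LOCC_gain (j := j) (Psi := fun _ rho => rho) a0 v0 (@ghz_vec R m k) N hadapt hK
  (fun _ => @LOCC_id R m (@qsys m k)).
exists Lam; split=> // k0; apply: le_trans hv; rewrite le_eqVlt; apply/orP; left; apply/eqP.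
apply: eq_bigr => h _; rewrite expval_gram; apply: eq_bigr => e _.
have v0E (z : Jt (@qsys m k)) : z = v0.
  by apply/ffunP => i; rewrite ffunE; apply/ffunP => t; have := ltn_ord t; rewrite {2}k0.
rewrite /ap (big_pred1 v0); last by move=> z; rewrite /= (v0E z) eqxx.
have -> : ghz_vec R v0 = 1.
  rewrite /ghz_vec; have -> : [forall t : 'I_k, forall i, forall i', v0 i t == v0 i' t].
    by apply/forallP => t; apply/forallP => i; apply/forallP => i'; rewrite !ffunE.
  by rewrite [X in _ ^+ X]k0 expr0.
rewrite mulr1 /adj sqnJ (bigD1 h) //= [X in _ + X]big1 ?addr0.
  by rewrite /kron big1 ?mul1r // => i _; rewrite /K !eqxx mul1r.
move=> b bh; have [i hi] : exists i, b i != h i.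
  apply/existsP; rewrite -negb_forall; apply: contra bh => /forallP hh.
  by apply/eqP/ffunP => i; apply/eqP.
by rewrite /kron (bigD1 i) //= /K (negPf hi) mulr0 !mul0r.
Qed.
End Protocols.

(** * Independent copies and typical sets *)

Section Copies.
Variable R : realType.
Local Notation C := R[i].
Local Notation "x %:C" := (real_complex R x).

Lemma prod_eq (n : nat) (T : finType) (x y : {ffun 'I_n -> T}) : \prod_t ((x t == y t)%:R : C) = (x == y)%:R.
Proof.
case: eqP => [->|ne]; first by rewrite big1 // => t _; rewrite eqxx.
have [t ht] : exists t, x t != y t.
  apply/existsP; rewrite -negb_forall; apply/negP => /forallP h; apply: ne.
  by apply/ffunP => t; apply/eqP.
by rewrite (bigD1 t) //= (negPf ht) mul0r.
Qed.

Section Tensor.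
Variables (n : nat) (I T : finType).

Definition tensv (u : 'I_n -> I -> T -> C) (c : {ffun 'I_n -> I}) (r : {ffun 'I_n -> T}) : C :=
  \prod_t u t (c t) (r t).

Lemma spectral_tens (A : 'I_n -> op R T T) (u : 'I_n -> I -> T -> C) (l : 'I_n -> I -> R) :
  (forall t, spectral (A t) (u t) (l t)) ->
  spectral (fun r r' : {ffun 'I_n -> T} => \prod_t A t (r t) (r' t)) (tensv u)
    (fun c => \prod_t l t (c t)).
Proof.
move=> h; split=> [c d|r r'].
  transitivity (\prod_t inner (u t (c t)) (u t (d t))).
    rewrite /inner bigA_distr_bigA; apply: eq_bigr => r _ /=.
    by rewrite /tensv conjc_prod -big_split.
  etransitivity; last exact: (prod_eq c d).
  by apply: eq_bigr => t _; exact: (h t).1.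
under eq_bigr do rewrite (h _).2.
rewrite bigA_distr_bigA; apply: eq_bigr => c _ /=.
by rewrite /tensv rc_prod conjc_prod -!big_split.
Qed.
End Tensor.

Lemma spectral_reindex (I T T' : finType) (h : T' -> T) (A : op R T T) (u : I -> T -> C) (l : I -> R) :
  bijective h -> spectral A u l ->
  spectral (fun a b => A (h a) (h b)) (fun c a => u c (h a)) l.
Proof.
move=> hb [ho hA]; split=> [c d|a b]; last exact: hA.
rewrite -ho /inner (reindex h); last exact/onW_bij.
by [].
Qed.

Section Transpose.
Variables (m n : nat) (F : 'I_m -> finType).

Definition copy (x : Jt (nsys F n)) (t : 'I_n) : Jt F := finfun (fun j => x j t).

Definition copies (x : Jt (nsys F n)) : {ffun 'I_n -> Jt F} := [ffun t => copy x t].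

Lemma copies_bij : bijective copies.
Proof.
exists (fun y : {ffun 'I_n -> Jt F} => finfun (fun j => [ffun t => y t j]) : Jt (nsys F n)).
  by move=> x; apply/ffunP => j; apply/ffunP => t; rewrite !ffunE.
by move=> y; apply/ffunP => t; apply/ffunP => j; rewrite !ffunE.
Qed.

Lemma sum_prod_copies (S : comPzSemiRingType) (H : 'I_n -> Jt F -> S) :
  \sum_(x : Jt (nsys F n)) \prod_t H t (copy x t) = \prod_t \sum_(y : Jt F) H t y.
Proof.
rewrite bigA_distr_bigA (reindex copies); last exact/onW_bij/copies_bij.
by apply: eq_bigr => x _; apply: eq_bigr => t _; rewrite ffunE.
Qed.

Lemma copy_setc (x : Jt (nsys F n)) i (v : {ffun 'I_n -> F i}) t :
  copy (setc x (v : nsys F n i)) t = setc (copy x t) (v t).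
Proof.
apply/ffunP => j; rewrite ffunE; case: (eqVneq i j) => [<-|h]; first by rewrite !setc_in.
by rewrite !setc_out // ffunE.
Qed.

Definition const_copies (a : Jt F) : Jt (nsys F n) := finfun (fun j => [ffun _ => a j]).

End Transpose.

Section IIDState.
Variables (m : nat) (A A' X : 'I_m -> finType) (E : finType) (n : nat).
Variables (psi : vec R (Jt A * E)%type) (Ek : forall j : 'I_m, X j -> op R (A' j) (A j)).
Arguments Ek : clear implicits.
Local Notation En := {ffun 'I_n -> E}.

Definition psi_copies : vec R (Jt (nsys A n) * En)%type :=
  fun ae => \prod_t psi (copy ae.1 t, ae.2 t).

Definition kraus_copies (j : 'I_m) (x : nsys X n j) : op R (nsys A' n j) (nsys A n j) :=
  fun b a => \prod_t Ek j (x t) (b t) (a t).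

Lemma psi_copies_unit : unit_vec psi -> unit_vec psi_copies.
Proof.
rewrite /unit_vec => h.
transitivity (\sum_(a : Jt (nsys A n)) \sum_(e : En) \prod_t (conjc (psi (copy a t, e t)) * psi (copy a t, e t))).
  rewrite pair_big /=; apply: eq_bigr => -[a e] _ /=.
  by rewrite /psi_copies conjc_prod big_split.
transitivity (\sum_(a : Jt (nsys A n)) \prod_t \sum_e (conjc (psi (copy a t, e)) * psi (copy a t, e))).
  by apply: eq_bigr => a _; rewrite bigA_distr_bigA.
rewrite (sum_prod_copies (fun _ a => \sum_e (conjc (psi (a, e)) * psi (a, e)))).
rewrite big1 // => t _; rewrite -[RHS]h pair_big /=.
by apply: eq_bigr => -[].
Qed.

Lemma kraus_copies_complete :
  (forall j a b, \sum_(x : X j) opmul (adj (Ek j x)) (Ek j x) a b = @idop R (A j) a b) ->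
  forall j a b, \sum_(x : nsys X n j) opmul (adj (kraus_copies x)) (kraus_copies x) a b
    = @idop R (nsys A n j) a b.
Proof.
move=> h j a b.
transitivity (\prod_t \sum_(x : X j) \sum_y conjc (Ek j x y (a t)) * Ek j x y (b t)).
  rewrite bigA_distr_bigA; apply: eq_bigr => x _; rewrite bigA_distr_bigA /=.
  by apply: eq_bigr => y _; rewrite /adj /kraus_copies conjc_prod big_split.
etransitivity; last exact: (prod_eq a b).
by apply: eq_bigr => t _; exact: h.
Qed.

Lemma ntensor_trE : @ntensor R m A n (trE psi) = trE psi_copies.
Proof.
apply/funext => a; apply/funext => b; rewrite /ntensor /trE bigA_distr_bigA /=.
by apply: eq_bigr => e _; rewrite /psi_copies conjc_prod -big_split.
Qed.

Lemma post_copies (x : Jt (nsys X n)) be :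
  post psi_copies kraus_copies x be = \prod_t post psi Ek (copy x t) (copy be.1 t, be.2 t).
Proof.
rewrite -(sum_prod_copies (fun t a => kraus_prod Ek (copy x t) (copy be.1 t) a * psi (a, be.2 t))).
apply: eq_bigr => a _; rewrite /psi_copies big_split /=; congr (_ * _).
rewrite /kraus_prod /kraus_copies exchange_big /=.
by apply: eq_bigr => t _; apply: eq_bigr => l _; rewrite !ffunE.
Qed.
End IIDState.

Section IIDSplit.
Variables (m n : nat) (X A' : 'I_m -> finType) (E : finType).
Variables (phi : Jt X -> Jt A' * E -> C) (a0 : Jt A') (i : 'I_m).
Local Notation G := (Jt A' * E)%type.
Local Notation Gn := (Jt (nsys A' n) * {ffun 'I_n -> E})%type.
Variable phin : Jt (nsys X n) -> Gn -> C.
Hypothesis phinE : forall x be, phin x be = \prod_t phi (copy x t) (copy be.1 t, be.2 t).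

Definition copyG (be : Gn) (t : 'I_n) : G := (copy be.1 t, be.2 t).

Lemma splitoff_copies (x : Jt (nsys X n)) be (q : nsys A' n i) :
  splitoff phin (const_copies n a0) (i := i) x be q =
  \prod_t splitoff phi a0 (i := i) (copy x t) (copyG be t) (q t).
Proof.
rewrite /splitoff big_split /= phinE; congr (_ * _).
  rewrite -(prod_eq (T := A' i)); apply: eq_bigr => t _; rewrite /copyG /= !ffunE; by [].
by apply: eq_bigr => t _; rewrite copy_setc.
Qed.

Lemma copyG_bij : bijective (fun be : Gn => [ffun t => copyG be t] : {ffun 'I_n -> G}).
Proof.
have [g gK Kg] := @copies_bij m n A'.
exists (fun y : {ffun 'I_n -> G} => (g [ffun t => (y t).1], [ffun t => (y t).2])).
  move=> [b e]; congr (_, _).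
    by rewrite -[RHS]gK; congr g; apply/ffunP => t; rewrite !ffunE.
  by apply/ffunP => t; rewrite !ffunE.
move=> y; apply/ffunP => t; rewrite ffunE /copyG /= ffunE.
have := Kg [ffun t => (y t).1] => /ffunP /(_ t); rewrite !ffunE => ->.
by case: (y t).
Qed.

Definition copyXG (r : Jt (nsys X n) * Gn) (t : 'I_n) : Jt X * G := (copy r.1 t, copyG r.2 t).

Lemma copyXG_bij : bijective (fun r => [ffun t => copyXG r t] : {ffun 'I_n -> Jt X * G}).
Proof.
have [g gK Kg] := @copies_bij m n X; have [g' gK' Kg'] := copyG_bij.
exists (fun y : {ffun 'I_n -> Jt X * G} => (g [ffun t => (y t).1], g' [ffun t => (y t).2])).
  move=> [x be]; congr (_, _).
    by rewrite -[RHS]gK; congr g; apply/ffunP => t; rewrite !ffunE.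
  by rewrite -[RHS]gK'; congr g'; apply/ffunP => t; rewrite !ffunE.
move=> y; apply/ffunP => t; rewrite ffunE /copyXG /=.
have := Kg [ffun t => (y t).1] => /ffunP /(_ t); rewrite !ffunE => ->.
have := Kg' [ffun t => (y t).2] => /ffunP /(_ t); rewrite !ffunE => ->.
by case: (y t).
Qed.

Lemma eqon_copies (S : {set 'I_m}) (x x' : Jt (nsys X n)) :
  ((eqon S x x')%:R : C) = \prod_t (eqon S (copy x t) (copy x' t))%:R.
Proof.
case: (boolP (eqon S x x')) => [/forallP h|].
  rewrite big1 // => t _; have -> // : eqon S (copy x t) (copy x' t).
  apply/forallP => l; have := h l; case: (l \in S) => //= /eqP e.
  by rewrite !ffunE e.
rewrite negb_forall => /existsP [l]; rewrite negb_imply => /andP[lS xl].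
have [t ht] : exists t, x l t != x' l t.
  apply/existsP; rewrite -negb_forall; apply: contra xl => /forallP h.
  by apply/eqP/ffunP => t; apply/eqP.
rewrite (bigD1 t) //=; have -> : eqon S (copy x t) (copy x' t) = false.
  apply/negP => /forallP /(_ l); rewrite lS /= !ffunE; exact/negP.
by rewrite mul0r.
Qed.

Local Notation Phin := (splitoff phin (const_copies n a0) (i := i)).
Local Notation Phi := (splitoff phi a0 (i := i)).

Lemma gram_copies x x' be be' :
  \sum_q Phin x be q * conjc (Phin x' be' q) =
  \prod_t \sum_q Phi (copy x t) (copyG be t) q * conjc (Phi (copy x' t) (copyG be' t) q).
Proof.
rewrite bigA_distr_bigA /=; apply: eq_bigr => q _.
by rewrite !splitoff_copies conjc_prod -big_split.
Qed.

Lemma tau_copies S r r' : tau Phin S r r' = \prod_t tau Phi S (copyXG r t) (copyXG r' t).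
Proof. by rewrite /tau gram_copies eqon_copies -big_split. Qed.

(** After regrouping indices [tau] of the copies is a tensor power, so eigenvalues multiply and
    eigenvectors are labelled by sequences, to which typicality applies. *)
Lemma spectral_tau_copies (I : finType) S (u : I -> Jt X * G -> C) l :
  spectral (tau Phi S) u l ->
  spectral (tau Phin S) (fun (c : {ffun 'I_n -> I}) r => tensv (fun _ => u) c [ffun t => copyXG r t])
    (fun c => \prod_t l (c t)).
Proof.
move=> h; have := spectral_reindex copyXG_bij (spectral_tens (fun _ : 'I_n => h)).
rewrite (_ : (fun a b => _) = tau Phin S) //.
apply/funext => r; apply/funext => r'; rewrite tau_copies; apply: eq_bigr => t _.
by rewrite !ffunE.
Qed.

Lemma spectral_gram_copies (I : finType) (w : Jt X -> I -> G -> C) l (x : Jt (nsys X n)) :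
  (forall x, spectral (gram (Phi x)) (w x) (l x)) ->
  spectral (gram (Phin x))
    (fun (c : {ffun 'I_n -> I}) be => tensv (fun t => w (copy x t)) c [ffun t => copyG be t])
    (fun c => \prod_t l (copy x t) (c t)).
Proof.
move=> h; have := spectral_reindex copyG_bij (spectral_tens (fun t => h (copy x t))).
rewrite (_ : (fun a b => _) = gram (Phin x)) //.
apply/funext => r; apply/funext => r'; rewrite /gram gram_copies; apply: eq_bigr => t _.
by rewrite !ffunE.
Qed.

Lemma spectral_sum_copies (I : finType) (v : I -> G -> C) p :
  spectral (fun b b' => \sum_x gram (Phi x) b b') v p ->
  spectral (fun b b' => \sum_x gram (Phin x) b b')
    (fun (c : {ffun 'I_n -> I}) be => tensv (fun _ => v) c [ffun t => copyG be t])
    (fun c => \prod_t p (c t)).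
Proof.
move=> h; have := spectral_reindex copyG_bij (spectral_tens (fun _ : 'I_n => h)).
rewrite (_ : (fun a b => _) = (fun b b' => \sum_x gram (Phin x) b b')) //.
apply/funext => r; apply/funext => r'.
rewrite -[LHS](sum_prod_copies (fun t x => gram (Phi x) ([ffun t => copyG r t] t) ([ffun t => copyG r' t] t))).
apply: eq_bigr => x _; rewrite /gram gram_copies; apply: eq_bigr => t _.
by rewrite !ffunE.
Qed.
End IIDSplit.
End Copies.

(** * Typical sets of an i.i.d. spectrum *)

Section Typicality.
Variable R : realType.

Definition exp2 (x : R) : R := expR (x * ln 2).

Lemma ln2_gt0 : 0 < ln 2 :> R.
Proof. by rewrite ln_gt0 // ltr1n. Qed.

Lemma exp2_gt0 x : 0 < exp2 x.
Proof. exact: expR_gt0. Qed.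

Lemma exp2D x y : exp2 (x + y) = exp2 x * exp2 y.
Proof. by rewrite /exp2 mulrDl expRD. Qed.

Lemma exp2_0 : exp2 0 = 1.
Proof. by rewrite /exp2 mul0r expR0. Qed.

Lemma exp2N x : exp2 (- x) = (exp2 x)^-1.
Proof. by rewrite /exp2 mulNr expRN. Qed.

Lemma exp2_nat k : exp2 k%:R = 2 ^+ k.
Proof. by rewrite /exp2 expRM_natl lnK // posrE ltr0n. Qed.

Lemma le_exp2 x y : (exp2 x <= exp2 y) = (x <= y).
Proof. by rewrite /exp2 ler_expR ler_pM2r // ln2_gt0. Qed.

Lemma exp2_sum (I : Type) (s : seq I) (P : pred I) (F : I -> R) :
  exp2 (\sum_(i <- s | P i) F i) = \prod_(i <- s | P i) exp2 (F i).
Proof. by rewrite /exp2 mulr_suml expR_sum. Qed.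

Lemma exp2_log2 x : 0 < x -> exp2 (log2 x) = x.
Proof. by move=> x0; rewrite /exp2 /log2 divfK ?gt_eqF ?ln2_gt0 // lnK. Qed.

Variables (I : finType) (l : I -> R).
Hypothesis l0 : forall c, 0 <= l c.
Hypothesis l1 : \sum_c l c = 1.

Definition shannon : R := - \sum_c l c * log2 (l c).

Local Notation surprise c := (- log2 (l c) - shannon).
Local Notation variance := (\sum_c l c * surprise c ^+ 2).

Lemma surprise_mean : \sum_c l c * surprise c = 0.
Proof.
under eq_bigr do rewrite mulrBr mulrN.
by rewrite sumrB sumrN -mulr_suml l1 mul1r subrr.
Qed.

Lemma iid_ge0 n (c : {ffun 'I_n -> I}) : 0 <= \prod_t l (c t).
Proof. by apply: prodr_ge0 => t _. Qed.

Lemma iid_total n : \sum_(c : {ffun 'I_n -> I}) \prod_t l (c t) = 1.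
Proof. by rewrite -(bigA_distr_bigA (fun (t : 'I_n) c => l c)) big1. Qed.

Lemma iid_covariance n (s t : 'I_n) :
  \sum_(c : {ffun 'I_n -> I}) (\prod_r l (c r)) * (surprise (c s) * surprise (c t)) =
  (s == t)%:R * variance.
Proof.
pose Z (s r : 'I_n) c := if r == s then surprise c else 1.
have Zp s' (c : {ffun 'I_n -> I}) : \prod_r Z s' r (c r) = surprise (c s').
  by rewrite (bigD1 s') //= {1}/Z eqxx big1 ?mulr1 // => r /negPf h; rewrite /Z h.
transitivity (\prod_r \sum_c l c * (Z s r c * Z t r c)).
  rewrite bigA_distr_bigA; apply: eq_bigr => c _ /=.
  by rewrite -(Zp s c) -(Zp t c) -!big_split.
rewrite (bigD1 s) //=; case: (eqVneq s t) => [<-|st].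
  rewrite mul1r [\prod_(r < n | _) _]big1 ?mulr1.
    by apply: eq_bigr => c _; rewrite /Z eqxx.
  move=> r /negPf rs; rewrite -[RHS]l1; apply: eq_bigr => c _.
  by rewrite /Z rs !mulr1.
rewrite mul0r [X in X * _](_ : _ = 0) ?mul0r // -[RHS]surprise_mean.
by apply: eq_bigr => c _; rewrite /Z eqxx (negPf st) mulr1.
Qed.

Lemma iid_variance n :
  \sum_(c : {ffun 'I_n -> I}) (\prod_r l (c r)) * (\sum_t surprise (c t)) ^+ 2 =
  n%:R * variance.
Proof.
transitivity (\sum_(s < n) \sum_(t < n) (s == t)%:R * variance).
  under [RHS]eq_bigr do under eq_bigr do rewrite -iid_covariance.
  under [RHS]eq_bigr do rewrite exchange_big /=.
  rewrite [RHS]exchange_big /=; apply: eq_bigr => c _.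
  rewrite expr2 mulr_suml mulr_sumr; apply: eq_bigr => s _.
  by rewrite mulr_sumr mulr_sumr.
transitivity (\sum_(s < n) variance); last by rewrite sumr_const card_ord -[LHS]mulr_natl.
apply: eq_bigr => s _; rewrite (bigD1 s) //= eqxx mul1r [\sum_(t < n | _) _]big1 ?addr0 // => t.
by rewrite eq_sym => /negPf ->; rewrite mul0r.
Qed.

Lemma typical_set (d eta : R) : 0 < d -> 0 < eta -> exists N, forall n, (N <= n)%N ->
  exists S : pred {ffun 'I_n -> I},
    [/\ 1 - eta <= \sum_(c | S c) \prod_t l (c t),
        #|S|%:R <= exp2 (n%:R * (shannon + d)) &
        forall c, S c -> \prod_t l (c t) <= exp2 (- (n%:R * (shannon - d)))].
Proof.
move=> d0 eta0.
have V0 : 0 <= variance by apply: sumr_ge0 => c _; rewrite mulr_ge0 ?sqr_ge0.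
have q0 : 0 <= variance / (d ^+ 2 * eta).
  by rewrite divr_ge0 // mulr_ge0 ?sqr_ge0 // ltW.
(* Chebyshev: the mass of large deviations is at most variance / (n d^2), which is at most [eta]
   from here on. *)
exists (Num.Def.archi_bound (variance / (d ^+ 2 * eta))) => n hn.
have n0 : variance / (d ^+ 2 * eta) < n%:R.
  by apply: lt_le_trans (archi_boundP q0) _; rewrite ler_nat.
have npos : 0 < n%:R :> R by apply: le_lt_trans n0.
pose Y (c : {ffun 'I_n -> I}) := \sum_t surprise (c t).
(* Letters of weight 0 are excluded explicitly: their logarithm is a default value, so the bound on
   [Y] says nothing about them. *)
pose S : pred {ffun 'I_n -> I} := fun c => [forall t, 0 < l (c t)] && (`|Y c| <= n%:R * d).
exists S.
have SE c : S c -> \prod_t l (c t) = exp2 (- Y c - n%:R * shannon).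
  move=> /andP[/forallP h _]; transitivity (\prod_t exp2 (log2 (l (c t)))).
    by apply: eq_bigr => t _; rewrite exp2_log2.
  rewrite -exp2_sum; congr exp2; rewrite /Y sumrB sumr_const card_ord -[shannon *+ n]mulr_natl.
  by rewrite sumrN; ring.
have bad : \sum_(c | ~~ (`|Y c| <= n%:R * d)) \prod_t l (c t) <= eta.
  have nd : 0 < n%:R * d by rewrite mulr_gt0.
  rewrite -(ler_pM2l (exprn_gt0 2 nd)).
  apply: (@le_trans _ _ (n%:R * variance)).
    rewrite -iid_variance mulr_sumr [leRHS](bigID (fun c => ~~ (`|Y c| <= n%:R * d))) /=.
    rewrite -[leLHS]addr0 lerD //; last first.
      by apply: sumr_ge0 => c _; rewrite mulr_ge0 ?sqr_ge0 ?iid_ge0.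
    apply: ler_sum => c; rewrite -ltNge => hc; rewrite mulrC ler_wpM2l ?iid_ge0 //.
    rewrite -[leRHS]ger0_norm ?sqr_ge0 // normrX lerXn2r ?nnegrE ?normr_ge0 //; exact: ltW.
  rewrite (_ : _ * eta = n%:R * (n%:R * (d ^+ 2 * eta))); last by ring.
  by rewrite ler_pM2l // ltW // -ltr_pdivrMr // mulr_gt0 ?exprn_gt0.
split.
- have tot : \sum_(c | S c) \prod_t l (c t) + \sum_(c | ~~ S c) \prod_t l (c t) = 1.
    by rewrite -[RHS](iid_total n) [RHS](bigID S).
  rewrite lerBlDr -[leLHS]tot lerD2l; apply: le_trans bad.
  rewrite [leRHS]big_mkcond [leLHS]big_mkcond /=; apply: ler_sum => c _.
  rewrite /S negb_and; case: (`|Y c| <= n%:R * d) => /=; rewrite ?orbT ?orbF //.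
  case: ifP => //; rewrite negb_forall => /existsP [t ht].
  rewrite (bigD1 t) //= [l (c t)](_ : _ = 0) ?mul0r //.
  by apply/eqP; rewrite eq_le l0 andbT leNgt.
- rewrite -[leRHS]mulr1.
  have e0 := exp2_gt0 (- (n%:R * (shannon + d))).
  rewrite -(ler_pM2l e0) mulrA -exp2D addNr exp2_0 mul1r -[leRHS](iid_total n).
  rewrite [leRHS](bigID S) /= -[leLHS]addr0 lerD //; last by apply: sumr_ge0 => c _; exact: iid_ge0.
  have -> : exp2 (- (n%:R * (shannon + d))) * #|S|%:R = \sum_(c | S c) exp2 (- (n%:R * (shannon + d))).
    by rewrite (eq_bigl (mem S)) // sumr_const mulr_natr.
  apply: ler_sum => c hc; rewrite (SE c hc) le_exp2.
  move: hc => /andP[_]; rewrite ler_norml => /andP[_ h]; rewrite mulrDr; lra.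
- move=> c hc; rewrite (SE c hc) le_exp2.
  move: hc => /andP[_]; rewrite ler_norml => /andP[h _]; rewrite mulrBr; lra.
Qed.
End Typicality.

(** * Entropies *)

Section Marginals.
Variable R : realType.
Local Notation C := R[i].
Variables (S : finType) (F : S -> finType) (P : {set S}).
Implicit Types (u v w d : Jt F).

Definition restr w : subsys F P := finfun (fun s => w (val s)).
Definition mix u w : Jt F := finfun (fun s => if s \in P then u s else w s).
Definition agree u w := [forall s, (s \in P) ==> (u s == w s)].

(* [d] is a junk value outside [P]. *)
Definition ext d (a : subsys F P) : Jt F :=
  finfun (fun s => if pselect (s \in P) is left h then a (exist _ s h) else d s).

Lemma extK d a : restr (ext d a) = a.
Proof.
apply/ffunP => -[s h]; rewrite !ffunE /=; case: pselect => [h'|//].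
by congr (a (exist _ s _)); exact: bool_irrelevance.
Qed.

Lemma agreeP u w : reflect (forall s, s \in P -> u s = w s) (agree u w).
Proof.
apply: (iffP forallP) => h s; last by apply/implyP => /h /eqP.
by move=> sP; have := h s; rewrite sP => /eqP.
Qed.

Lemma restr_eq u w : agree u w -> restr u = restr w.
Proof. by move=> /agreeP h; apply/ffunP => s; rewrite !ffunE h // (valP s). Qed.

Lemma restr_inj u w : restr u = restr w -> agree u w.
Proof.
move=> h; apply/agreeP => s sP.
by have := congr1 (fun a : subsys F P => a (exist _ s sP)) h; rewrite !ffunE.
Qed.

Lemma agree_sub w u : [forall s : {s : S | s \in P}, w (val s) == restr u s] = agree w u.
Proof.
apply/forallP/agreeP => [h s sP|h s].
  by have := h (exist _ s sP); rewrite ffunE => /eqP.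
by rewrite ffunE h // (valP s).
Qed.

Lemma mix_agree u w : agree u w -> mix u w = w.
Proof. by move=> /agreeP h; apply/ffunP => s; rewrite ffunE; case: ifP => // /h. Qed.

Lemma agree_mix u w : agree (mix u w) u.
Proof. by apply/agreeP => s sP; rewrite ffunE sP. Qed.

Lemma agreeC u w : agree u w = agree w u.
Proof. by apply: eq_forallb => s; rewrite eq_sym. Qed.

Lemma mix_mix u v w : mix u (mix v w) = mix u w.
Proof. by apply/ffunP => s; rewrite !ffunE; case: (s \in P). Qed.

(** Partial configurations are represented by total ones through [restr], and the traced coordinates
    are enumerated by the [w] agreeing with a fixed [d] on [P]. The double sum of [marg] thus
    becomes a single one. *)
Lemma margE (A : op R (Jt F) (Jt F)) d u v :
  @marg R S F P A (restr u) (restr v) = \sum_(w | agree w d) A (mix u w) (mix v w).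
Proof.
rewrite /marg (eq_bigl (fun w => agree w u)); last by move=> w; rewrite agree_sub.
rewrite (reindex_onto (mix u) (mix d)) /=; last first.
  by move=> w h; rewrite mix_mix mix_agree // agreeC.
apply: eq_big => [w|w _].
  rewrite agree_mix mix_mix /=; apply/eqP/idP => [<-|h]; first exact: agree_mix.
  by rewrite mix_agree // agreeC.
rewrite (big_pred1 (mix v w)) // => y; rewrite agree_sub /=.
apply/andP/eqP => [[/agreeP h1 /forallP h2]|->].
  apply/ffunP => s; rewrite ffunE; have := h2 s; rewrite ffunE.
  by case: ifP => [/h1 //|_ /= /eqP].
split; first exact: agree_mix.
by apply/forallP => s; rewrite !ffunE; case: ifP => //= _; rewrite eqxx.
Qed.
End Marginals.

Section EntropyRestrict.
Variable R : realType.
Local Notation C := R[i].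

(** Vanishing rows of [N] do not affect the reduced state on [U], and both sides are compared with
    its entropy. This relates indices with a pinned coordinate to genuine subsystems. *)
Lemma entropy_restrict (I T T' U : finType) (N : T -> U -> C) (h : T' -> T) (u : I -> T -> C) l :
  injective h -> (forall r e, r \notin codom h -> N r e = 0) -> spectral (gram N) u l ->
  entropy (fun a b => gram N (h a) (h b)) = - \sum_c l c * log2 (l c).
Proof.
move=> hi h0 hu; pose N3 e a := N (h a) e.
have [v [l' [hl' e']]] := fcalcP (gram_herm N3) (fun x => if x == 0 then 0 else x * log2 x).
transitivity (- \sum_c l' c * log2 (l' c)); first exact: (entropy_gram hl').
rewrite -(entropy_gram hu).
have -> : (fun a b => \sum_r N r a * conjc (N r b)) = gram N3.
  apply/funext => a; apply/funext => b; rewrite /gram.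
  rewrite (bigID (fun r => r \in codom h)) /= [X in _ + X]big1 ?addr0; last first.
    by move=> r hr; rewrite h0 ?mul0r.
  rewrite (eq_bigl (fun r => r \in h @: [set: T'])); last first.
    move=> r; apply/codomP/imsetP => [[a' ->]|[a' _ ->]]; by exists a'; rewrite ?inE.
  rewrite big_imset /=; last by move=> x y _ _; exact: hi.
  by apply: eq_bigl => x; rewrite inE.
rewrite /entropy e' tr_spectral; last exact: hl'.1.
rewrite ReC; congr (- _); apply: eq_bigr => c _.
by case: eqVneq => [->|//]; rewrite mul0r.
Qed.
End EntropyRestrict.

Section Entropies.
Variable R : realType.
Local Notation C := R[i].
Variables (m : nat) (A A' X : 'I_m -> finType) (E : finType).
Variables (psi : vec R (Jt A * E)%type) (Ek : forall j : 'I_m, X j -> op R (A' j) (A j)).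
Local Notation F := (omF X A' E).
Local Notation phi := (post psi Ek).
Local Notation G := (Jt A' * E)%type.
Implicit Types (w u v : Jt F).

Definition xpart w : Jt X := finfun (fun j => w (inl (inl j))).
Definition apart w : Jt A' := finfun (fun j => w (inl (inr j))).
Definition glue (x : Jt X) (b : Jt A') (e : E) : Jt F :=
  finfun (fun s => match s as s0 return omF X A' E s0 with
                   | inl (inl j) => x j | inl (inr j) => b j | inr _ => e end).

Lemma xpart_glue x b e : xpart (glue x b e) = x.
Proof. by apply/ffunP => j; rewrite !ffunE. Qed.
Lemma apart_glue x b e : apart (glue x b e) = b.
Proof. by apply/ffunP => j; rewrite !ffunE. Qed.
Lemma epart_glue x b e : glue x b e (inr tt) = e.
Proof. by rewrite ffunE. Qed.
Lemma glueK w : glue (xpart w) (apart w) (w (inr tt)) = w.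
Proof. by apply/ffunP => -[[j|j]|[]]; rewrite !ffunE. Qed.

Lemma sum_glue (W : nmodType) (H : Jt F -> W) :
  \sum_w H w = \sum_x \sum_b \sum_e H (glue x b e).
Proof.
have -> : \sum_x \sum_b \sum_e H (glue x b e) =
  \sum_(p : Jt X * (Jt A' * E)) H (glue p.1 p.2.1 p.2.2).
  rewrite -(pair_bigA _ (fun x p => H (glue x p.1 p.2))) /=; apply: eq_bigr => x _.
  by rewrite -(pair_bigA _ (fun b e => H (glue x b e))).
rewrite (reindex (fun p : Jt X * (Jt A' * E) => glue p.1 p.2.1 p.2.2)) //.
exists (fun w => (xpart w, (apart w, w (inr tt)))) => [[x [b e]]|w] _ /=.
  by rewrite xpart_glue apart_glue epart_glue.
exact: glueK.
Qed.

Lemma omegaE w w' : omega Ek psi w w' = (xpart w == xpart w')%:R *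
  (phi (xpart w) (apart w, w (inr tt)) * conjc (phi (xpart w') (apart w', w' (inr tt)))).
Proof. by []. Qed.

Variables (x0 : Jt X) (a0 : Jt A') (e0 : E) (i : 'I_m).
Local Notation Phi := (splitoff phi a0 (i := i)).

Section Receiver.
Variable S : {set 'I_m}.
Local Notation P := (Xslots S :|: Aslots [set i]).
Local Notation w0 := (glue x0 a0 e0).

Let Q u : A' i := u (inl (inr i)).

Let Nq (r : Jt X * G) (a : subsys F P) : C :=
  (eqon S r.1 (xpart (ext w0 a)))%:R * Phi r.1 r.2 (Q (ext w0 a)).

Lemma agree_receiver u w : agree P u w = eqon S (xpart u) (xpart w) && (Q u == Q w).
Proof.
apply/agreeP/andP => [h|[/forallP h1 /eqP h2] [[j|j]|[]]]; rewrite ?inE //.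
- split; last by rewrite /Q h // !inE eqxx orbT.
  by apply/forallP => j; apply/implyP => jS; rewrite !ffunE h // !inE jS.
- by rewrite orbF => jS; have := h1 j; rewrite jS !ffunE => /eqP.
- by move=> /eqP ->.
Qed.

Lemma eqonC (x y : Jt X) : eqon S x y = eqon S y x.
Proof. by apply: eq_forallb => l; rewrite eq_sym. Qed.

Lemma eqon_trans (x y z : Jt X) : eqon S x y -> eqon S x z = eqon S y z.
Proof.
move=> /forallP h; apply: eq_forallb => l; have := h l.
by case: (l \in S) => //= /eqP ->.
Qed.

Lemma sum_receiver (x : Jt X) (H : A' i -> C) :
  \sum_(a : subsys F P | eqon S x (xpart (ext w0 a))) H (Q (ext w0 a)) = \sum_q H q.
Proof.
pose g (q : A' i) : Jt F := glue x (setc a0 q) e0.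
have gq (q : A' i) : eqon S x (xpart (ext w0 (restr P (g q)))) && (Q (ext w0 (restr P (g q))) == q).
  have := restr_inj (extK w0 (restr P (g q))); rewrite agree_receiver xpart_glue eqonC.
  have -> : Q (g q) = q by rewrite /Q /g ffunE setc_in.
  by [].
rewrite (reindex_onto (fun q : A' i => restr P (g q)) (fun a => Q (ext w0 a))) /=.
  by apply: eq_big => [q|q _]; have /andP[h1 /eqP ->] := gq q; rewrite ?h1 ?eqxx.
move=> a ha; rewrite -[RHS](extK w0 a); apply: restr_eq.
by rewrite agree_receiver xpart_glue ha /= /Q /g ffunE setc_in.
Qed.

(** [tau Phi S] and the state of X_S and A'_i are the two sides of the bipartite vector [Nq]: a
    coherent record of all outcomes, with the other systems, purifies the receiver. *)
Lemma entropy_receiver (I : finType) (u : I -> Jt X * G -> C) l :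
  spectral (tau Phi S) u l -> sent P (omega Ek psi) = - \sum_c l c * log2 (l c).
Proof.
move=> hu.
have eN : tau Phi S = gram Nq.
  apply/funext => r; apply/funext => r'; rewrite /tau /gram.
  case: (boolP (eqon S r.1 r'.1)) => [h|h].
    rewrite mul1r -(sum_receiver r.1 (fun q => Phi r.1 r.2 q * conjc (Phi r'.1 r'.2 q))).
    rewrite big_mkcond; apply: eq_bigr => a _; rewrite /Nq -(eqon_trans _ h).
    by case: ifP; rewrite ?mul1r // !mul0r.
  rewrite mul0r big1 // => a _; rewrite /Nq.
  case: (boolP (eqon S r.1 _)) => [h1|_]; last by rewrite !mul0r.
  rewrite (eqon_trans _ h1) in h.
  case: (boolP (eqon S r'.1 _)) => [h2|_]; last by rewrite mul0r conjc0 mulr0.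
  by case/negP: h; rewrite eqonC.
rewrite eN in hu; rewrite -(entropy_gram hu) /sent; congr entropy.
apply/funext => a; apply/funext => b.
rewrite -(extK w0 a) -(extK w0 b); set ua := ext w0 a; set ub := ext w0 b.
rewrite (margE _ _ (glue (xpart ua) a0 e0)) big_mkcond sum_glue /=.
rewrite !extK.
transitivity (\sum_x \sum_(be : G) Nq (x, be) a * conjc (Nq (x, be) b)); last first.
  by rewrite pair_big; apply: eq_bigr => -[].
apply: eq_bigr => x _; rewrite pair_big /=; apply: eq_bigr => -[b' e'] _ /=.
rewrite agree_receiver !xpart_glue /Nq /= -/ua -/ub.
clearbody ua ub; rewrite /splitoff /=.
have -> : Q (glue x b' e') = b' i by rewrite /Q ffunE.
have -> : Q (glue (xpart ua) a0 e0) = a0 i by rewrite /Q ffunE.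
case: (boolP (eqon S x (xpart ua))) => [h1|_]; last by rewrite !mul0r.
case: (b' i == a0 i); last by rewrite !mul0r mulr0 mul0r.
rewrite omegaE.
have mixE (z : Jt F) : eqon S x (xpart z) ->
    xpart (mix P z (glue x b' e')) = x.
  move=> /forallP h; apply/ffunP => j; have := h j; rewrite !ffunE !inE orbF.
  by case: (j \in S) => //= /eqP ->.
have apE (z : Jt F) : apart (mix P z (glue x b' e')) = setc b' (Q z).
  apply/ffunP => j; rewrite !ffunE !inE /=.
  case: (eqVneq j i) => [->|ji]; first by rewrite dfwith_in.
  by rewrite dfwith_out // eq_sym.
have epE (z : Jt F) : mix P z (glue x b' e') (inr tt) = e' by rewrite !ffunE !inE.
rewrite (mixE ua h1) !apE !epE !mul1r.
case: (boolP (eqon S x (xpart ub))) => [h2|h2].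
  by rewrite (mixE ub h2) eqxx !mul1r.
rewrite mul0r conjc0 mulr0; case: eqP => [e|_]; last by rewrite mul0r.
case/negP: h2; apply/forallP => j; apply/implyP => jS; by rewrite {1}e !ffunE !inE jS /=.
Qed.
End Receiver.

Section Complement.
Local Notation EA := (Eslot m :|: Aslots (~: [set i])).
Local Notation XEA := (Xslots [set: 'I_m] :|: EA).
Local Notation w0 := (glue x0 a0 e0).

Definition rest_part u : G := (setc (apart u) (a0 i), u (inr tt)).

Lemma agree_rest u v : rest_part u = rest_part v -> agree EA u v.
Proof.
move=> [h1 h2]; apply/agreeP => -[[j|j]|[]]; rewrite !inE //= => ji.
by have := congr1 (fun b : Jt A' => b j) h1; rewrite !setc_out 1?eq_sym // !ffunE.
Qed.

Lemma agree_xrest u v : xpart u = xpart v -> rest_part u = rest_part v -> agree XEA u v.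
Proof.
move=> h1 /agree_rest/agreeP h2; apply/agreeP => -[[j|j]|[]]; rewrite finset.in_setU => h.
- by have := congr1 (fun x : Jt X => x j) h1; rewrite !ffunE.
- by apply: h2; move: h; rewrite [X in X || _]inE.
- by apply: h2; rewrite !inE.
Qed.

Lemma rest_part_agree u v : agree EA u v -> rest_part u = rest_part v.
Proof.
move=> /agreeP h; congr (_, _); last by have := h (inr tt); rewrite !inE; exact.
apply/ffunP => j; case: (eqVneq i j) => [<-|ji]; first by rewrite !setc_in.
by rewrite !setc_out // !ffunE h // !inE /= eq_sym ji.
Qed.

Lemma agree_XEA_EA u v : agree XEA u v -> agree EA u v.
Proof. by move=> /agreeP h; apply/agreeP => s hs; apply: h; rewrite finset.in_setU hs orbT. Qed.

Lemma xpart_agree u v : agree XEA u v -> xpart u = xpart v.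
Proof. by move=> /agreeP h; apply/ffunP => j; rewrite !ffunE h // !inE. Qed.

Lemma rest_part_glue (x : Jt X) (b : Jt A') (e : E) : b i = a0 i -> rest_part (glue x b e) = (b, e).
Proof. by move=> h; rewrite /rest_part apart_glue -h setc_id epart_glue. Qed.

Lemma apart_mixEA (P : {set slot m}) u x b e q : P = EA \/ P = XEA ->
  apart (mix P u (glue x (setc b (q : A' i)) e)) = setc (apart u) q.
Proof.
move=> hP; apply/ffunP => j; rewrite ffunE; case: (eqVneq i j) => [<-|ji].
  rewrite setc_in ffunE; case: hP => ->; by rewrite !inE eqxx /= ffunE setc_in.
rewrite setc_out // !ffunE; by case: hP => ->; rewrite !inE /= ?[j == i]eq_sym ?ji ?orbT.
Qed.

Lemma epart_mixEA (P : {set slot m}) u w : P = EA \/ P = XEA -> mix P u w (inr tt) = u (inr tt).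
Proof. by case=> ->; rewrite ffunE !inE. Qed.

Lemma apart_agree u v : agree EA u v -> setc (apart u) (v (inl (inr i))) = apart v.
Proof.
move=> /agreeP h; apply/ffunP => j; case: (eqVneq i j) => [<-|ji].
  by rewrite setc_in ffunE.
by rewrite setc_out // !ffunE h // !inE /= eq_sym ji.
Qed.

Lemma epart_agree u v : agree EA u v -> u (inr tt) = v (inr tt).
Proof. by move=> /agreeP /(_ (inr tt)); rewrite !inE; exact. Qed.

Lemma sum_agreeEA d (H : Jt F -> C) :
  \sum_(w | agree EA w d) H w =
  \sum_(p : Jt X * A' i) H (glue p.1 (setc (apart d) p.2) (d (inr tt))).
Proof.
rewrite (reindex_onto (fun p : Jt X * A' i => glue p.1 (setc (apart d) p.2) (d (inr tt)))
  (fun w => (xpart w, w (inl (inr i))))) /=.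
  apply: eq_bigl => -[x q] /=; rewrite xpart_glue ffunE setc_in eqxx andbT.
  apply: agree_rest; by rewrite /rest_part apart_glue setcC epart_glue.
move=> w hw; rewrite -[RHS]glueK apart_agree; last by rewrite agreeC.
by rewrite (epart_agree hw).
Qed.

Lemma sum_agreeXEA d (H : Jt F -> C) :
  \sum_(w | agree XEA w d) H w = \sum_q H (glue (xpart d) (setc (apart d) (q : A' i)) (d (inr tt))).
Proof.
rewrite (reindex_onto (fun q : A' i => glue (xpart d) (setc (apart d) q) (d (inr tt)))
  (fun w => w (inl (inr i)))) /=.
  apply: eq_bigl => q; rewrite ffunE setc_in eqxx andbT.
  by apply: agree_xrest; rewrite ?xpart_glue // /rest_part apart_glue setcC epart_glue.
move=> w hw; have hw' := agree_XEA_EA hw.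
rewrite -[RHS]glueK -(xpart_agree hw) apart_agree; last by rewrite agreeC.
by rewrite (epart_agree hw').
Qed.

Lemma splitoff_rest x u q : Phi x (rest_part u) q = phi x (setc (apart u) q, u (inr tt)).
Proof. by rewrite /splitoff /= setc_in eqxx mul1r setcC. Qed.

Lemma entropy_rest (I : finType) (v : I -> G -> C) p :
  spectral (fun b b' => \sum_x gram (Phi x) b b') v p ->
  sent EA (omega Ek psi) = - \sum_c p c * log2 (p c).
Proof.
pose N (be : G) (y : Jt X * A' i) := Phi y.1 be y.2.
have -> : (fun b b' => \sum_x gram (Phi x) b b') = gram N.
  by apply/funext => b; apply/funext => b'; rewrite /gram pair_big.
move=> hv; rewrite -(entropy_restrict (h := fun a : subsys F EA => rest_part (ext w0 a)) _ _ hv).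
- rewrite /sent; congr entropy; apply/funext => a; apply/funext => b.
  rewrite -{1}(extK w0 a) -{1}(extK w0 b); set ua := ext w0 a; set ub := ext w0 b.
  rewrite (margE _ _ ua) sum_agreeEA; apply: eq_bigr => -[x q] _ /=.
  rewrite omegaE !apart_mixEA ?epart_mixEA; try by left.
  rewrite /N /= !splitoff_rest.
  have e z w : xpart (mix EA z w) = xpart w by apply/ffunP => j; rewrite !ffunE !inE.
  by rewrite !e xpart_glue eqxx mul1r.
- by move=> a b h; rewrite -(extK w0 a) -(extK w0 b); apply/restr_eq/agree_rest.
- move=> [b e] [x q] hr; rewrite /N /splitoff /=; case: eqP => [ba|_]; last by rewrite mul0r.
  case/negP: hr; apply/codomP; exists (restr EA (glue x0 b e)).
  rewrite -(rest_part_glue x0 e ba); apply: rest_part_agree.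
  by apply/restr_inj; rewrite extK.
Qed.

(** [tau Phi [set: 'I_m]] is the block-diagonal state of the outcomes and the rest itself. Through
    [entropy_receiver] the same spectrum also gives the entropy of X_[m] A'_i. *)
Lemma entropy_keyed_rest (I : finType) (v : I -> Jt X * G -> C) p :
  spectral (tau Phi [set: 'I_m]) v p -> sent XEA (omega Ek psi) = - \sum_c p c * log2 (p c).
Proof.
pose N (r : Jt X * G) (y : Jt X * A' i) : C := (r.1 == y.1)%:R * Phi r.1 r.2 y.2.
have -> : tau Phi [set: 'I_m] = gram N.
  apply/funext => r; apply/funext => r'; rewrite /tau /gram.
  transitivity (\sum_y \sum_q N r (y, q) * conjc (N r' (y, q))); last first.
    by rewrite pair_big; apply: eq_bigr => -[].
  rewrite (bigD1 r.1) //= [X in _ + X]big1 ?addr0; last first.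
    by move=> y hy; rewrite big1 // => q _; rewrite /N /= eq_sym (negPf hy) !mul0r.
  have -> : eqon [set: 'I_m] r.1 r'.1 = (r'.1 == r.1).
    apply/forallP/eqP => [h|-> l]; last by rewrite eqxx implybT.
    by apply/ffunP => l; have := h l; rewrite inE => /eqP.
  rewrite mulr_sumr; apply: eq_bigr => q _; rewrite /N /= eqxx !mul1r.
  by case: eqP => [->|_]; rewrite ?mul1r ?mul0r ?conjc0 ?mulr0.
move=> hv; rewrite -(entropy_restrict (h := fun a : subsys F XEA => (xpart (ext w0 a), rest_part (ext w0 a))) _ _ hv).
- rewrite /sent; congr entropy; apply/funext => a; apply/funext => b.
  rewrite -{1}(extK w0 a) -{1}(extK w0 b); set ua := ext w0 a; set ub := ext w0 b.
  rewrite (margE _ _ ua) sum_agreeXEA.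
  transitivity (\sum_y \sum_q N (xpart ua, rest_part ua) (y, q) *
     conjc (N (xpart ub, rest_part ub) (y, q))); last by rewrite pair_big; apply: eq_bigr => -[].
  rewrite (bigD1 (xpart ua)) //= [X in _ + X]big1 ?addr0; last first.
    by move=> y hy; rewrite big1 // => q _; rewrite /N /= eq_sym (negPf hy) !mul0r.
  apply: eq_bigr => q _; rewrite omegaE !apart_mixEA ?epart_mixEA; try by right.
  have e z w : xpart (mix XEA z w) = xpart z by apply/ffunP => j; rewrite !ffunE !inE.
  rewrite !e /N /= eqxx mul1r !splitoff_rest eq_sym.
  by case: eqP => [->|_]; rewrite ?mul1r ?mul0r ?conjc0 ?mulr0.
- move=> a b h; have h1 := congr1 fst h; have h2 := congr1 snd h.
  by rewrite -(extK w0 a) -(extK w0 b); exact/restr_eq/agree_xrest.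
- move=> [x' [b e]] [x q] hr; rewrite /N /splitoff /=; case: eqP => [_|_]; last by rewrite mul0r.
  case: eqP => [ba|_]; last by rewrite mul0r mulr0.
  case/negP: hr; apply/codomP; exists (restr XEA (glue x' b e)).
  have ag : agree XEA (glue x' b e) (ext w0 (restr XEA (glue x' b e))).
    by apply/restr_inj; rewrite extK.
  by rewrite -(xpart_agree ag) -(rest_part_agree (agree_XEA_EA ag)) xpart_glue rest_part_glue.
Qed.
End Complement.
End Entropies.

(** * Entropy under doubly substochastic mixing *)

Section Mixing.
Variable R : realType.

Lemma ln_tangent (a b : R) : 0 < a -> 0 < b -> a * ln b + a - b <= a * ln a.
Proof.
move=> a0 b0; have h : ln (b / a) <= b / a - 1.
  have := @le_ln1Dx R (b / a - 1); rewrite [1 + _]addrC subrK; apply.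
  by rewrite ltrBrDr addNr divr_gt0.
rewrite lnM ?posrE ?invr_gt0 // lnV ?posrE // in h.
have := ler_wpM2l (ltW a0) h; rewrite mulrBr mulrBr [a * (b / a)]mulrCA mulfV ?gt_eqF //; lra.
Qed.

Variables (I K : finType) (l : I -> R) (l' : K -> R) (p : K -> I -> R).
Hypotheses (p0 : forall k c, 0 <= p k c) (pK : forall c, \sum_k p k c <= 1)
  (pI : forall k, \sum_c p k c <= 1) (mixed : forall k, l' k = \sum_c p k c * l c).
Hypotheses (l0 : forall c, 0 <= l c) (l1 : \sum_c l c = 1) (l'1 : \sum_k l' k = 1).

(** The tangent inequality at [l c] and [l' k] is weighted by [p k c] and summed; the linear terms
    leave a nonnegative remainder because the row sums are at most 1. *)
Lemma mixing_ln : \sum_k l' k * ln (l' k) <= \sum_c l c * ln (l c).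
Proof.
(* Both spectra have mass 1, so the column sum of [p] must be exactly 1 wherever [l c] is
   nonzero. *)
have full c : l c * (1 - \sum_k p k c) = 0.
  have s0 : \sum_c l c * (1 - \sum_k p k c) = 0.
    under eq_bigr do rewrite mulrBr mulr1 mulr_sumr.
    rewrite sumrB l1 exchange_big /= -[X in X - _]l'1 -sumrB big1 // => k _.
    by rewrite mixed; under [X in X - _]eq_bigr do rewrite mulrC; rewrite subrr.
  apply: (psumr_eq0P _ s0) => // c' _; by rewrite mulr_ge0 // subr_ge0.
have l'0 k : 0 <= l' k by rewrite mixed; apply: sumr_ge0 => c _; rewrite mulr_ge0.
have le k c : p k c * (l c * ln (l' k)) + p k c * l c - p k c * l' k <= p k c * (l c * ln (l c)).
  case: (eqVneq (l c) 0) => [->|lc].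
    by rewrite !mul0r !mulr0 !add0r oppr_le0 mulr_ge0.
  have [pkc|pkc] := eqVneq (p k c) 0; first by rewrite pkc !mul0r addr0 subrr.
  have k0 : 0 < l' k.
    rewrite mixed (bigD1 c) //= ltr_wpDr ?mulr_gt0 ?lt_neqAle ?l0 ?p0 1?eq_sym ?lc ?pkc //.
    by apply: sumr_ge0 => c' _; rewrite mulr_ge0.
  have c0 : 0 < l c by rewrite lt_neqAle l0 eq_sym lc.
  have := ler_wpM2l (p0 k c) (ln_tangent c0 k0); rewrite mulrBr mulrDr; exact: le_trans.
have fullp c : \sum_k p k c * (l c * ln (l c)) = l c * ln (l c).
  rewrite -mulr_suml mulrA [_ * l c]mulrC; congr (_ * _).
  by have := full c; rewrite mulrBr mulr1 => /eqP; rewrite subr_eq0 => /eqP.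
under [leRHS]eq_bigr do rewrite -fullp.
rewrite [leRHS]exchange_big /=.
have := ler_sum (P := xpredT) (index_enum K) (fun k _ => ler_sum (P := xpredT) (index_enum I) (fun c _ => le k c)).
apply: le_trans; under [leRHS]eq_bigr do rewrite sumrB big_split /= -mulr_suml.
rewrite sumrB big_split /=.
have -> : \sum_k \sum_c p k c * l c = 1 by rewrite -l'1; apply: eq_bigr => k _; rewrite mixed.
have -> : \sum_k \sum_c p k c * (l c * ln (l' k)) = \sum_k l' k * ln (l' k).
  by apply: eq_bigr => k _; rewrite mixed mulr_suml; apply: eq_bigr => c _; rewrite mulrA.
rewrite -addrA lerDl subr_ge0 -[leRHS]l'1; apply: ler_sum => k _.
by rewrite -[leRHS]mul1r ler_wpM2r.
Qed.

Lemma shannon_mixing : shannon l <= shannon l'.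
Proof.
have e (J : finType) (q : J -> R) : \sum_c q c * log2 (q c) = (\sum_c q c * ln (q c)) / ln 2.
  by rewrite mulr_suml; apply: eq_bigr => c _; rewrite /log2 mulrA.
by rewrite lerN2 !e ler_pM2r ?invr_gt0 ?ln2_gt0 ?mixing_ln.
Qed.
End Mixing.

Section BlockSpectra.
Variable R : realType.
Local Notation C := R[i].
Local Notation "x %:C" := (real_complex R x).
Variables (m : nat) (X : 'I_m -> finType) (G Q : finType).
Variables (Phi : Jt X -> G -> Q -> C) (x0 : Jt X).
Local Notation T := (Jt X * G)%type.

Lemma tau_gram S : exists N : T -> Jt X * Q -> C, tau Phi S = gram N.
Proof.
(* Coordinates outside [S] are overwritten by those of [x0], so that equal keys mean agreement on
   [S]. *)
pose key (x : Jt X) : Jt X := finfun (fun l => if l \in S then x l else x0 l).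
exists (fun r yq => (key r.1 == yq.1)%:R * Phi r.1 r.2 yq.2).
apply/funext => r; apply/funext => r'; rewrite /tau /gram.
transitivity (\sum_y \sum_q ((key r.1 == y)%:R * Phi r.1 r.2 q) * conjc ((key r'.1 == y)%:R * Phi r'.1 r'.2 q)); last first.
  by rewrite pair_big; apply: eq_bigr => -[].
rewrite (bigD1 (key r.1)) //= [X in _ + X]big1 ?addr0; last first.
  by move=> y hy; rewrite big1 // => q _; rewrite eq_sym (negPf hy) !mul0r.
have -> : eqon S r.1 r'.1 = (key r'.1 == key r.1).
  apply/forallP/eqP => [h|h l].
    by apply/ffunP => l; rewrite !ffunE; have := h l; case: (l \in S) => //= /eqP.
  have := congr1 (fun z : Jt X => z l) h; rewrite !ffunE; case: (l \in S) => //= ->.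
  by rewrite eqxx.
rewrite mulr_sumr; apply: eq_bigr => q _; rewrite eqxx !mul1r.
by case: eqP => [_|_]; rewrite ?mul1r ?mul0r ?conjc0 ?mulr0.
Qed.

Lemma tau_spectral S : exists (u : T -> T -> C) l, spectral (tau Phi S) u l.
Proof. by have [N ->] := tau_gram S; exact/hermitian_spectral/gram_herm. Qed.

Lemma tau_ge0 (I : finType) S (u : I -> T -> C) l c : spectral (tau Phi S) u l -> 0 <= l c.
Proof. by have [N ->] := tau_gram S; exact: spectral_gram_ge0. Qed.

Lemma tau_total (I : finType) S (u : I -> T -> C) l :
  spectral (tau Phi S) u l -> \sum_c l c = \sum_x hs2 (Phi x).
Proof.
move=> h; apply: (@complexI R); rewrite -(tr_spectral l h.1).
rewrite (_ : (fun a b => _) = tau Phi S); last first.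
  by apply/funext => a; apply/funext => b; rewrite h.2.
rewrite /tr rc_sum; transitivity (\sum_x \sum_g tau Phi S (x, g) (x, g)).
  by rewrite pair_big; apply: eq_bigr => -[].
apply: eq_bigr => x _; rewrite /hs2 rc_sum; apply: eq_bigr => g _.
rewrite /tau /= -inner_nrm2.
have -> : eqon S x x by apply/forallP => l'; rewrite eqxx implybT.
by rewrite mul1r; apply: eq_bigr => q _; rewrite mulrC.
Qed.

Variables (K : finType) (w : Jt X -> K -> G -> C) (l' : Jt X -> K -> R).
Hypothesis hw : forall x, spectral (gram (Phi x)) (w x) (l' x).

Lemma block_spectral :
  spectral (tau Phi [set: 'I_m]) (block_basis w) (fun xk => l' xk.1 xk.2).
Proof.
split=> [|r r']; first exact: block_orthonormal hw.
transitivity (\sum_y \sum_k block_basis w (y, k) r * (l' y k)%:C * conjc (block_basis w (y, k) r')); last first.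
  by rewrite pair_big; apply: eq_bigr => -[].
rewrite (bigD1 r.1) //= [X in _ + X]big1 ?addr0; last first.
  by move=> y hy; rewrite big1 // => k _; rewrite /block_basis /= eq_sym (negPf hy) !mul0r.
have -> : tau Phi [set: 'I_m] r r' = (r'.1 == r.1)%:R * gram (Phi r.1) r.2 r'.2.
  rewrite /tau /gram.
  have -> : eqon [set: 'I_m] r.1 r'.1 = (r'.1 == r.1).
    apply/forallP/eqP => [h|-> l]; last by rewrite eqxx implybT.
    by apply/ffunP => l; have := h l; rewrite inE => /eqP.
  by case: eqP => [->|_]; rewrite ?mul1r ?mul0r.
rewrite (hw r.1).2 mulr_sumr; apply: eq_bigr => k _; rewrite /block_basis /= eqxx mul1r.
by case: eqP => [_|_]; rewrite ?mul1r ?mul0r ?conjc0 ?mulr0.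
Qed.

Lemma block_total : \sum_xk l' xk.1 xk.2 = \sum_x hs2 (Phi x).
Proof. exact: tau_total block_spectral. Qed.

(* Pinching does not decrease the entropy; this is what makes the conditional entropies
   S(X_J | X_(~: J) A'_i) nonnegative. *)
Lemma block_entropy_ge (I : finType) S (u : I -> T -> C) l :
  \sum_x hs2 (Phi x) = 1 -> spectral (tau Phi S) u l ->
  shannon l <= shannon (fun xk : Jt X * K => l' xk.1 xk.2).
Proof.
move=> tot h; have ob := block_orthonormal hw.
have norm1 (J V : finType) (z : J -> V -> C) c : orthonormal z -> nrm2 (z c) = 1.
  by move=> oz; apply: (@complexI R); rewrite -inner_nrm2 oz eqxx.
apply: (@shannon_mixing _ _ _ _ _ (fun xk c => sqn (inner (block_basis w xk) (u c)))).
- by move=> k c; exact: sqn_ge0.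
- by move=> c; rewrite -(norm1 _ _ _ c h.1); exact: bessel.
- move=> k; rewrite -(norm1 _ _ _ k ob).
  under eq_bigr do rewrite -sqnJ innerJ.
  exact: bessel h.1.
- move=> [x k] /=; apply: (@complexI R); rewrite rc_sum -(tau_eigenvalue hw S x k).
  rewrite (inner_spectral _ _ h); apply: eq_bigr => c _.
  by rewrite rcM -sqnE innerJ; ring.
- by move=> c; exact: tau_ge0 h.
- by rewrite (tau_total h).
- by rewrite block_total.
Qed.
End BlockSpectra.

(** * Random codes *)

Section RandomCodes.
Variable R : realType.
Local Notation C := R[i].

Lemma le_average (I : finType) (W : I -> R) (t : R) : (0 < #|I|)%N ->
  \sum_i W i <= #|I|%:R * t -> exists i, W i <= t.
Proof.
move=> I0 h; case: (pselect (exists i, W i <= t)) => // hn; exfalso.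
have lt i : t < W i by rewrite ltNge; apply/negP => hi; apply: hn; exists i.
have [i0 _] := card_gt0P I0.
have : \sum_(i : I) t < \sum_i W i.
  apply: ltr_sum => [|i _]; last exact: lt.
  by apply/hasP; exists i0; rewrite ?mem_index_enum.
rewrite sumr_const -[X in X < _]mulr_natl => h'; by have := lt_le_trans h' h; rewrite ltxx.
Qed.

Variables (m : nat) (A A' X : 'I_m -> finType) (E : finType).
Variables (psi : vec R (Jt A * E)%type) (Ek : forall j : 'I_m, X j -> op R (A' j) (A j)).
Arguments Ek : clear implicits.
Hypothesis psi1 : unit_vec psi.
Hypothesis hE : forall j a b, \sum_(x : X j) opmul (adj (Ek j x)) (Ek j x) a b = @idop R (A j) a b.
Variables (x0 : Jt X) (a0 : Jt A') (j : 'I_m) (k : nat) (Cc : 'I_m -> finType).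
Hypothesis Cc0 : forall l, (0 < #|Cc l|)%N.
Local Notation Kt := {ffun 'I_k -> bool}.
Local Notation G := (Jt A' * E)%type.
Local Notation Phi i := (splitoff (post psi Ek) a0 (i := i)).

Variables (I K L : finType).
Variables (w : 'I_m -> Jt X -> K -> G -> C) (l' : 'I_m -> Jt X -> K -> R).
Variables (u : 'I_m -> {set 'I_m} -> I -> Jt X * G -> C) (l : 'I_m -> {set 'I_m} -> I -> R).
Variables (v : L -> G -> C) (p : L -> R).
Hypothesis hw : forall i x, spectral (gram (Phi i x)) (w i x) (l' i x).
Hypothesis hu : forall i J, spectral (tau (Phi i) (~: J)) (u i J) (l i J).
Hypothesis hv : spectral (fun b b' => \sum_x gram (Phi j x) b b') v p.
Variables (Sz : 'I_m -> pred (Jt X * K)) (SJ : 'I_m -> {set 'I_m} -> pred I) (SB : pred L).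
Variables (eta : R) (lam : 'I_m -> {set 'I_m} -> R) (lamB : R).
Hypothesis eta_z : forall i, 1 - eta <= \sum_(xk | Sz i xk) l' i xk.1 xk.2.
Hypothesis eta_J : forall i J, 1 - eta <= \sum_(c | SJ i J c) l i J c.
Hypothesis eta_B : 1 - eta <= \sum_(c | SB c) p c.
Hypothesis le_lam : forall i J c, SJ i J c -> l i J c <= lam i J.
Hypothesis lam0 : forall i J, 0 <= lam i J.
Hypothesis le_lamB : forall xk, Sz j xk -> l' j xk.1 xk.2 <= lamB.
Hypothesis lamB0 : 0 <= lamB.

Definition collision_cost : R :=
  \sum_i \sum_(J : {set 'I_m} | (i \notin J) && (J != finset.set0))
     #|Sz i|%:R * (\prod_(l in J) #|Cc l|%:R^-1 * lam i J).

Definition leakage_cost : R := #|SB|%:R * (#|{: Jt Cc}| * #|{: Kt}|)%:R * lamB.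

Lemma total_split i : \sum_x hs2 (Phi i x) = 1.
Proof.
by rewrite -(post_nrm2 psi1 hE); apply: eq_bigr => x _; rewrite hs2_splitoff.
Qed.

Definition collision f i J : R := #|Sz i|%:R *
  hs2 (fun r r' => real_complex R (mask R (fun l => (f : codes X Cc) l) J r.1 r'.1) *
    smoothed (w i) (Sz i) (u i J) (l i J) (SJ i J) r r').

Definition leakage (f : codes X Cc) (g : {ffun Jt X -> Kt}) : R :=
  #|SB|%:R * (#|{: Jt Cc}| * #|{: Kt}|)%:R * \sum_c \sum_kap
    hs2 (key_dev (w j) (l' j) (Sz j) v SB (code (fun l => f l)) g c kap).

Lemma Kt_gt0 : (0 < #|{: Kt}|)%N.
Proof. by rewrite card_ffun_gt0 // card_bool. Qed.

Lemma collision_avg i J :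
  \sum_f collision f i J <= #|codes X Cc|%:R *
    (#|Sz i|%:R * (\prod_(l in J) #|Cc l|%:R^-1 * lam i J)).
Proof.
rewrite -mulr_sumr mulrCA ler_wpM2l ?ler0n //.
apply: le_trans (avg_hs2_mask Cc0 J _) _; rewrite -mulrA ler_wpM2l ?ler0n //.
apply: ler_wpM2l; first by apply: prodr_ge0 => c _; rewrite invr_ge0 ler0n.
apply: le_trans (hs2_trunc_prj (lam := lam i J) _ (hu i J).1 _ _ _) _.
- exact: block_orthonormal (hw i).
- by move=> c; exact: (tau_ge0 x0 _ (hu i J)).
- exact: le_lam.
rewrite -[leRHS]mulr1 ler_wpM2l // -(total_split i) -(tau_total (hu i J)).
rewrite [leRHS](bigID (SJ i J)) /= lerDl.
by apply: sumr_ge0 => c _; exact: (tau_ge0 x0 _ (hu i J)).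
Qed.

Lemma leakage_avg f : \sum_g leakage f g <= #|{ffun Jt X -> Kt}|%:R * leakage_cost.
Proof.
rewrite -mulr_sumr /leakage_cost mulrCA ler_wpM2l ?mulr_ge0 ?ler0n //.
apply: le_trans (avg_key_dev _ Kt_gt0 _) _; rewrite ler_wpM2l ?ler0n //.
have l'0 x c : 0 <= l' j x c by exact: spectral_gram_ge0 (hw j x).
apply: (@le_trans _ _ (\sum_x lamB * \sum_(c | Sz j (x, c)) l' j x c)).
  apply: ler_sum => x _; apply: hs2_trunc_prj => //.
  - exact: (hw j x).1.
  - exact: hv.1.
  - by move=> c /le_lamB.
rewrite -mulr_sumr -[leRHS]mulr1 ler_wpM2l // -(total_split j) -(block_total (hw j)).
rewrite -(pair_bigA _ (fun x c => l' j x c)) /=; apply: ler_sum => x _.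
by rewrite [leRHS](bigID (fun c => Sz j (x, c))) /= lerDl sumr_ge0.
Qed.

(** All error terms are nonnegative and enter one sum, so a single pair (f, g) with a sum below
    average controls every receiver, every [J] and the key at once. *)
Lemma exists_code : exists f g,
  \sum_i \sum_(J : {set 'I_m} | (i \notin J) && (J != finset.set0)) collision f i J + leakage f g
    <= collision_cost + leakage_cost.
Proof.
pose W f g := \sum_i \sum_(J : {set 'I_m} | (i \notin J) && (J != finset.set0)) collision f i J + leakage f g.
have g0 : (0 < #|{ffun Jt X -> Kt}|)%N by rewrite card_ffun_gt0 // Kt_gt0.
have f0 := codes_gt0 X Cc0.
have [[f g] h] : exists fg, W fg.1 fg.2 <= collision_cost + leakage_cost; last by exists f, g.
apply: le_average; first by rewrite card_prod muln_gt0 f0.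
rewrite -(pair_bigA _ (fun f g => W f g)) /= card_prod natrM.
apply: (@le_trans _ _ (\sum_f (#|{ffun Jt X -> Kt}|%:R *
   (\sum_i \sum_(J : {set 'I_m} | (i \notin J) && (J != finset.set0)) collision f i J) +
   #|{ffun Jt X -> Kt}|%:R * leakage_cost))).
  apply: ler_sum => f _; rewrite /W big_split /= sumr_const -[X in X + _]mulr_natl.
  by rewrite lerD2l leakage_avg.
rewrite big_split /= sumr_const -[X in _ + X <= _]mulr_natl -mulr_sumr.
have hS : \sum_(f : codes X Cc) \sum_i \sum_(J : {set 'I_m} | (i \notin J) && (J != finset.set0)) collision f i J
    <= #|codes X Cc|%:R * collision_cost.
  rewrite exchange_big /= /collision_cost mulr_sumr; apply: ler_sum => i _.
  rewrite exchange_big /= mulr_sumr; apply: ler_sum => J _; exact: collision_avg.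
have n0 : 0 <= #|{ffun Jt X -> Kt}|%:R :> R by rewrite ler0n.
have := ler_wpM2l n0 hS.
rewrite -(lerD2r (#|codes X Cc|%:R * (#|{ffun Jt X -> Kt}|%:R * leakage_cost))).
move=> h; apply: le_trans h _; rewrite le_eqVlt; apply/orP; left; apply/eqP; ring.
Qed.

Local Notation s := (Num.sqrt (2 * eta) + Num.sqrt (collision_cost + leakage_cost)).

(** In the decoding error one factor [2 ^+ m] counts the sets [J], the other is the norm of the
    mask. *)
Lemma random_code_ghz :
  0 <= 1 - 2 * s - \sum_(i < m) Num.sqrt (2 * (2 ^+ m * 2 ^+ m * s)) ->
  exists Lam : chan R A (@qsys m k), LOCC Lam /\
    (1 - 2 * s - \sum_(i < m) Num.sqrt (2 * (2 ^+ m * 2 ^+ m * s))) ^+ 2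
      <= expval (@ghz_vec R m k) (Lam (trE psi)).
Proof.
have [f [g hfg]] := exists_code; set tot := _ + leakage_cost in hfg *.
have col0 (i : 'I_m) (J : {set 'I_m}) : 0 <= collision f i J by rewrite mulr_ge0 ?ler0n ?hs2_ge0.
have colS0 : 0 <= \sum_i \sum_(J : {set 'I_m} | (i \notin J) && (J != finset.set0)) collision f i J.
  by apply: sumr_ge0 => i _; apply: sumr_ge0.
have leak0 : 0 <= leakage f g.
  rewrite mulr_ge0 ?mulr_ge0 ?ler0n //; apply: sumr_ge0 => c _; apply: sumr_ge0 => kap _; exact: hs2_ge0.
have leak_le : leakage f g <= tot by apply: le_trans hfg; rewrite lerDr.
have col_le (i : 'I_m) (J : {set 'I_m}) : i \notin J -> J != finset.set0 -> collision f i J <= tot.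
  move=> h1 h2; apply: le_trans hfg; rewrite -[leLHS]addr0 lerD //.
  rewrite (bigD1 i) //= (bigD1 J) /= ?h1 ?h2 // -addrA lerDl addr_ge0 //.
    by apply: sumr_ge0.
  by apply: sumr_ge0 => i' _; apply: sumr_ge0.
have sq_eta (a b : R) : 1 - eta <= a -> 1 - eta <= b -> Num.sqrt (1 - a + (1 - b)) <= Num.sqrt (2 * eta).
  by move=> ha hb; rewrite ler_wsqrtr //; lra.
have s1 : 0 <= Num.sqrt (2 * eta) by rewrite sqrtr_ge0.
have s2 : 0 <= Num.sqrt tot by rewrite sqrtr_ge0.
have tm : 1 <= 2 ^+ m :> R by rewrite exprn_ege1 // ler1n.
have [D hD] : exists D : forall i, Jt X -> op R (A' i) (A' i), forall i,
    (forall L v, \sum_(x | cls i (fun l => f l) x == L) nrm2 (ap (D i x) v) <= nrm2 v) /\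
    1 - 2 ^+ m * 2 ^+ m * s <= complex.Re (\sum_x \sum_be inner (Phi i x be) (ap (D i x) (Phi i x be))).
  suff h i : exists D : Jt X -> op R (A' i) (A' i),
    (forall L v, \sum_(x | cls i (fun l => f l) x == L) nrm2 (ap (D x) v) <= nrm2 v) /\
    1 - 2 ^+ m * 2 ^+ m * s <= complex.Re (\sum_x \sum_be inner (Phi i x be) (ap (D x) (Phi i x be))).
    by exists (fun i => projT1 (cid (h i))) => i; exact: projT2 (cid (h i)).
  have [Di [h1 h2]] := decode_oneshot (i0 := i) (Sz i) (hw i) (fun l => f l) (SJ i)
    (fun J _ => hu i J) (fun J c => tau_ge0 x0 c (hu i J))
    (fun J => etrans (tau_total (hu i J)) (total_split i)).
  exists Di; split=> //; apply: le_trans h2; rewrite total_split lerD2l lerN2.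
  rewrite ler_pdivrMr //.
  apply: (@le_trans _ _ (\sum_(J : {set 'I_m}) 2 * (2 ^+ m * s))).
    rewrite [leLHS]big_mkcond; apply: ler_sum => J _; case: ifP => [/andP[iJ J0]|_]; last first.
      by rewrite mulr_ge0 // mulr_ge0 ?addr_ge0 // exprn_ge0.
    rewrite mulrA mulrDr lerD //.
      by rewrite ler_wpM2l ?mulr_ge0 ?exprn_ge0 // sq_eta.
    apply: (@le_trans _ _ (Num.sqrt tot)); first by rewrite ler_wsqrtr // (col_le i J iJ J0).
    by rewrite ler_peMl //; lra.
  rewrite sumr_const -[leLHS]mulr_natl.
  have -> : #|{: {set 'I_m}}| = (2 ^ m)%N by rewrite -cardsT -powersetT card_powerset cardsT card_ord.
  by rewrite natrX le_eqVlt; apply/orP; left; apply/eqP; ring.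
have [U [cU hU]] := privacy_oneshot (Sz j) (hw j) (etrans (block_total (hw j)) (total_split j))
  SB hv Kt_gt0 (code (fun l => f l)) g.
(* [oneshot_ghz] takes contractions for all parties, which keeps its types uniform in [i]; those of
   parties other than [j] are set to 0. *)
have [Ua [cUa UaE]] : exists Ua : forall i, Jt Cc -> Kt -> op R (Jt X * A' i)%type (Jt X * A' i)%type,
    (forall i c kap, contr (Ua i c kap)) /\ Ua j = U.
  exists (@eqtype.dfwith 'I_m (fun i => Jt Cc -> Kt -> op R (Jt X * A' i)%type (Jt X * A' i)%type)
    (fun i c kap a b => 0) j U); split=> [i c kap|]; last by rewrite dfwith_in.
  case: (eqVneq j i) => [<-|ji]; first by rewrite dfwith_in.
  move=> z; rewrite dfwith_out //; rewrite [leLHS]big1 ?nrm2_ge0 // => t _.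
  by rewrite /ap big1 ?sqn0 // => q _; rewrite mul0r.
have h2 : 1 - 2 * s <= complex.Re (\sum_c \sum_kap \sum_b
    inner (key_target Kt (Phi j) (code (fun l => f l)) c b)
      (ap (Ua j c kap) (key_state (Phi j) (code (fun l => f l)) g c kap b))).
  rewrite UaE; apply: le_trans hU; rewrite lerD2l lerN2 ler_pdivrMr //.
  rewrite (_ : 2 * _ * 2 = 4 * Num.sqrt (2 * eta) + 4 * Num.sqrt tot); last by ring.
  rewrite lerD //.
    by rewrite ler_wpM2l // sq_eta.
  apply: (@le_trans _ _ (Num.sqrt tot)); first by rewrite ler_wsqrtr.
  by rewrite ler_peMl //; lra.
exact: (oneshot_ghz psi1 hE (fun i => (hD i).1) cUa x0 (fun i => (hD i).2) h2).
Qed.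
End RandomCodes.

(** * Rates and capacity *)

Section Rates.
Variable R : realType.
Variables (m : nat) (F : slot m -> finType) (om : op R (Jt F) (Jt F)).
Local Notation gain J i := (cent (Xslots J) (Xslots (~: J) :|: Aslots [set i]) om).

Lemma gain_set0 (i : 'I_m) (J : {set 'I_m}) : J = finset.set0 -> gain J i = 0.
Proof.
move=> ->; rewrite /cent; have -> : Xslots (finset.set0 : {set 'I_m}) = finset.set0.
  by apply/setP => -[[l|l]|[]]; rewrite !inE.
by rewrite finset.set0U subrr.
Qed.

(* When [m = 1] every rate tuple is admissible, and [RCO] is the junk value 0 of an
   infimum over an unbounded set. *)
Lemma exists_rates (j : 'I_m) (d : R) : 0 < d ->
  (forall (i : 'I_m) (J : {set 'I_m}), i \notin J -> 0 <= gain J i) ->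
  exists r : 'I_m -> R, [/\ forall l, 0 <= r l, Rcq om r & \sum_l r l <= RCO om + d].
Proof.
move=> d0 gain0.
case: (pselect (exists i : 'I_m, i != j)) => [[i ij]|hj].
  (* Some party other than [l] has to learn x_l, and its constraint for the singleton bounds the
     rate. *)
  have pos r : Rcq om r -> forall l, 0 <= r l.
    move=> hr l; have [i' hi'] : exists i', i' \notin [set l].
      case: (eqVneq l j) => [->|lj]; first by exists i; rewrite inE.
      by exists j; rewrite inE eq_sym.
    by apply: le_trans (gain0 _ _ hi') _; apply: le_trans (hr _ _ hi') _; rewrite big_set1.
  (* A constant above all constraints makes the set of sum rates nonempty, as the infimum
     requires. *)
  pose M := \sum_(i : 'I_m) \sum_(J : {set 'I_m}) `|gain J i|.
  have M0 : 0 <= M by apply: sumr_ge0 => ? _; apply: sumr_ge0.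
  have hM : Rcq om (fun _ => M).
    move=> i' J iJ; case: (eqVneq J finset.set0) => [e|/set0Pn [l lJ]].
      by rewrite gain_set0 // e big_set0.
    apply: (@le_trans _ _ M).
      apply: le_trans (ler_norm _) _; rewrite /M (bigD1 i') //= (bigD1 J) //= -addrA lerDl.
      by rewrite addr_ge0 //; apply: sumr_ge0 => // ? _; apply: sumr_ge0.
    by rewrite (bigD1 l) //= lerDl sumr_ge0.
  have hi : has_inf [set \sum_(i < m) r i | r in Rcq om]%classic.
    split; first by exists (\sum_(i < m) M), (fun _ => M).
    by exists 0 => _ [r hr <-]; apply: sumr_ge0 => l _; exact: pos.
  have [_ [r hr <-] lt] := inf_adherent d0 hi.
  by exists r; split=> //; [exact: pos | exact: ltW].
have allj l : l = j by apply/eqP; apply/negP => /negP h; apply: hj; exists l.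
have hR r : Rcq om r.
  move=> i J iJ; have e : J = finset.set0.
    apply/setP => l; rewrite inE; apply/negbTE; rewrite (allj l) -(allj i); exact: iJ.
  by rewrite gain_set0 // e big_set0.
exists (fun _ => 0); split=> //.
rewrite big1 // /RCO inf_out ?add0r ?ltW // => -[_ [b hb]].
have := hb _ (ex_intro2 _ _ (fun _ => b - 1) (hR _) erefl).
rewrite (bigD1 j) //= big1 ?addr0; last by move=> l; rewrite (allj l) eqxx.
by rewrite leNgt ltrBlDr ltrDl ltr01.
Qed.
End Rates.

Section SmallErrors.
Variable R : realType.

Lemma exp2_decay (c d t : R) : 0 <= c -> 0 < d -> 0 < t ->
  exists N, forall n, (N <= n)%N -> c * exp2 (- (n%:R * d)) <= t.
Proof.
move=> c0 d0 t0; pose q := c / (t * (d * ln 2)).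
have q0 : 0 <= q by rewrite divr_ge0 // ltW // !mulr_gt0 ?ln2_gt0.
exists (Num.Def.archi_bound q) => n hn.
have hq : q <= n%:R by apply/ltW/(lt_le_trans (archi_boundP q0)); rewrite ler_nat.
have h : 1 + n%:R * d * ln 2 <= exp2 (n%:R * d) by exact: expR_ge1Dx.
rewrite exp2N ler_pdivrMr ?exp2_gt0 //.
apply: le_trans (ler_wpM2l (ltW t0) h); rewrite mulrDr mulr1.
have : c <= n%:R * (t * (d * ln 2)) by rewrite -ler_pdivrMr // !mulr_gt0 ?ln2_gt0.
by rewrite (_ : n%:R * (t * (d * ln 2)) = t * (n%:R * d * ln 2)); [move=> h'; rewrite ler_wpDl // ltW | ring].
Qed.

Lemma small_error (m : nat) (eps : R) : 0 < eps -> exists2 s : R, 0 < s &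
  forall s', s' <= s -> 1 - eps <= 1 - 2 * s' - \sum_(i < m) Num.sqrt (2 * (2 ^+ m * 2 ^+ m * s')).
Proof.
move=> e0; pose K : R := 2 * (2 ^+ m * 2 ^+ m).
have K0 : 0 < K by rewrite !mulr_gt0 ?exprn_gt0.
(* Half of [eps] is shared among [m + 1] terms instead of [m], which covers [m = 0]. *)
pose b := eps / (2 * m.+1%:R).
have b0 : 0 < b by rewrite divr_gt0 ?mulr_gt0 ?ltr0n.
exists (Num.min (eps / 4) (b ^+ 2 / K)) => [|s' hs].
  by rewrite lt_min !divr_gt0 ?exprn_gt0.
rewrite le_min in hs; case/andP: hs => h1 h2.
have hb : Num.sqrt (2 * (2 ^+ m * 2 ^+ m * s')) <= b.
  have -> : b = Num.sqrt (b ^+ 2) by rewrite sqrtr_sqr ger0_norm // ltW.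
  by rewrite ler_wsqrtr // mulrA -/K mulrC -ler_pdivlMr.
have : \sum_(i < m) Num.sqrt (2 * (2 ^+ m * 2 ^+ m * s')) <= eps / 2.
  apply: (@le_trans _ _ (\sum_(i < m) b)); first exact: ler_sum.
  rewrite sumr_const card_ord -[leLHS]mulr_natl.
  have e : m.+1%:R * b = eps / 2.
    have : m.+1%:R != 0 :> R by rewrite pnatr_eq0.
    by rewrite /b; move: (m.+1%:R) => M hM; field.
  by rewrite -e ler_wpM2r ?ler_nat // ltW.
lra.
Qed.
End SmallErrors.

(** * Rates and exponents for n copies *)

Section ManyCopies.
Variable R : realType.
Local Notation C := R[i].
Variables (m : nat) (A A' X : 'I_m -> finType) (E : finType).
Variables (psi : vec R (Jt A * E)%type) (Ek : forall j : 'I_m, X j -> op R (A' j) (A j)).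
Arguments Ek : clear implicits.
Hypothesis psi1 : unit_vec psi.
Hypothesis hE : forall j a b, \sum_(x : X j) opmul (adj (Ek j x)) (Ek j x) a b = @idop R (A j) a b.
Variables (x0 : Jt X) (a0 : Jt A') (j : 'I_m).
Local Notation G := (Jt A' * E)%type.
Local Notation Phi i := (splitoff (post psi Ek) a0 (i := i)).

Variables (I K L : finType).
Variables (w : 'I_m -> Jt X -> K -> G -> C) (l' : 'I_m -> Jt X -> K -> R).
Variables (u : 'I_m -> {set 'I_m} -> I -> Jt X * G -> C) (l : 'I_m -> {set 'I_m} -> I -> R).
Variables (v : L -> G -> C) (p : L -> R).
Hypothesis hw : forall i x, spectral (gram (Phi i x)) (w i x) (l' i x).
Hypothesis hu : forall i J, spectral (tau (Phi i) (~: J)) (u i J) (l i J).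
Hypothesis hv : spectral (fun b b' => \sum_x gram (Phi j x) b b') v p.
Local Notation lz i := (fun xk : Jt X * K => l' i xk.1 xk.2).

Variables (r : 'I_m -> R) (dt R0 : R).
Hypotheses (r0 : forall i, 0 <= r i) (dt0 : 0 < dt).
Hypothesis decodable : forall (i : 'I_m) (J : {set 'I_m}), i \notin J ->
  shannon (lz i) - shannon (l i J) <= \sum_(i in J) r i.
Hypothesis private : shannon p - shannon (lz j) + \sum_i (r i + 3 * dt) + R0 + 3 * dt <= 0.

(** Each hash exceeds its rate by [3 * dt]: the size of a typical set and the typical eigenvalue
    cost one [dt] each, and one is left as exponent of decay. Rounding up costs at most one bit. *)
Definition code_bits (n : nat) (i : 'I_m) : nat := (Num.Def.trunc (n%:R * (r i + 3 * dt))).+1.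
Definition codebook (n : nat) (i : 'I_m) : finType := {ffun 'I_(code_bits n i) -> bool}.

Lemma card_bits b : #|{: {ffun 'I_b -> bool}}|%:R = exp2 b%:R :> R.
Proof. by rewrite card_ffun card_bool card_ord exp2_nat natrX. Qed.

Lemma codebook_bounds n i : exp2 (n%:R * (r i + 3 * dt)) <= #|codebook n i|%:R
  /\ #|codebook n i|%:R <= exp2 (n%:R * (r i + 3 * dt) + 1) :> R.
Proof.
have x0' : 0 <= n%:R * (r i + 3 * dt) by rewrite mulr_ge0 ?ler0n // addr_ge0 // mulr_ge0 // ltW.
have /andP[h1 h2] := truncn_itv x0'.
rewrite card_bits !le_exp2 /code_bits; split; first exact: ltW.
by rewrite -addn1 natrD lerD2r.
Qed.

Section Pairing.
Variable n : nat.
Definition pairing (xk : Jt (nsys X n) * {ffun 'I_n -> K}) : {ffun 'I_n -> Jt X * K} :=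
  [ffun t => (copy xk.1 t, xk.2 t)].

Lemma pairing_bij : bijective pairing.
Proof.
have [g gK Kg] := @copies_bij m n X.
exists (fun y : {ffun 'I_n -> Jt X * K} => (g [ffun t => (y t).1], [ffun t => (y t).2])).
  move=> [x c]; congr (_, _); last by apply/ffunP => t; rewrite !ffunE.
  by rewrite -[RHS]gK; congr g; apply/ffunP => t; rewrite !ffunE.
move=> y; apply/ffunP => t; rewrite ffunE /= ffunE.
have := Kg [ffun t => (y t).1] => /ffunP /(_ t); rewrite !ffunE => ->.
by case: (y t).
Qed.

Lemma card_pairing (S : pred {ffun 'I_n -> Jt X * K}) : #|[pred xk | S (pairing xk)]| = #|S|.
Proof.
rewrite -!sum1_card [RHS](reindex pairing); last exact/onW_bij/pairing_bij.
by apply: eq_bigl => xk.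
Qed.

Lemma sum_pairing (S : pred {ffun 'I_n -> Jt X * K}) (q : Jt X -> K -> R) :
  \sum_(xk | S (pairing xk)) \prod_t q (copy xk.1 t) (xk.2 t) =
  \sum_(c | S c) \prod_t q (c t).1 (c t).2.
Proof.
rewrite [RHS](reindex pairing); last exact/onW_bij/pairing_bij.
by apply: eq_bigr => xk _; apply: eq_bigr => t _; rewrite ffunE.
Qed.
End Pairing.

Local Notation typical n S q eta := [/\ 1 - eta <= \sum_(c | S c) \prod_t q (c t),
        #|S|%:R <= exp2 (n%:R * (shannon q + dt)) &
        forall c, S c -> \prod_t q (c t) <= exp2 (- (n%:R * (shannon q - dt)))].

(** A nonempty [J] brings at least one surplus [3 * dt], against [2 * dt] lost to typicality;
    [private] leaves the same margin for the leakage. There are at most m 2^m pairs (i, J), and the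
    last [2 ^+ m] comes from rounding [m] hash lengths. *)
Lemma cost_bound n k (Sz : 'I_m -> nat) (SB : nat) :
  k%:R <= n%:R * R0 ->
  (forall i, (Sz i)%:R <= exp2 (n%:R * (shannon (lz i) + dt))) ->
  SB%:R <= exp2 (n%:R * (shannon p + dt)) ->
  \sum_i \sum_(J : {set 'I_m} | (i \notin J) && (J != finset.set0))
     (Sz i)%:R * (\prod_(l in J) #|codebook n l|%:R^-1 * exp2 (- (n%:R * (shannon (l i J) - dt))))
  + SB%:R * (#|{: Jt (codebook n)}| * #|{: {ffun 'I_k -> bool}}|)%:R * exp2 (- (n%:R * (shannon (lz j) - dt)))
  <= (m%:R * 2 ^+ m + 2 ^+ m) * exp2 (- (n%:R * dt)).
Proof.
move=> hk hz hB; have n0 : 0 <= n%:R :> R by rewrite ler0n.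
rewrite mulrDl lerD //.
  apply: (@le_trans _ _ (\sum_(i < m) \sum_(J : {set 'I_m}) exp2 (- (n%:R * dt)))); last first.
    rewrite !sumr_const card_ord.
    have -> : #|{: {set 'I_m}}| = (2 ^ m)%N by rewrite -cardsT -powersetT card_powerset cardsT card_ord.
    by rewrite -mulrnA -[leLHS]mulr_natl natrM natrX [_ * m%:R]mulrC.
  apply: ler_sum => i _; rewrite [leLHS]big_mkcond; apply: ler_sum => J _.
  case: ifP => [/andP[iJ J0]|_]; last exact/ltW/exp2_gt0.
  have hprod : \prod_(l in J) (#|codebook n l|%:R^-1 : R) <= exp2 (- \sum_(l in J) (n%:R * (r l + 3 * dt))).
    rewrite -sumrN exp2_sum; apply: ler_prod => i' _; rewrite invr_ge0 ler0n /= exp2N.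
    have [h _] := codebook_bounds n i'.
    by rewrite lef_pV2 ?posrE ?exp2_gt0 //; apply: lt_le_trans h; exact: exp2_gt0.
  have p0 : 0 <= \prod_(l in J) (#|codebook n l|%:R^-1 : R).
    by apply: prodr_ge0 => i' _; rewrite invr_ge0 ler0n.
  apply: (@le_trans _ _ (exp2 (n%:R * (shannon (lz i) + dt)) *
    (exp2 (- \sum_(l in J) (n%:R * (r l + 3 * dt))) * exp2 (- (n%:R * (shannon (l i J) - dt)))))).
    apply: ler_pM; rewrite ?ler0n ?hz ?mulr_ge0 //; first exact/ltW/exp2_gt0.
    by rewrite ler_wpM2r //; exact/ltW/exp2_gt0.
  rewrite -!exp2D le_exp2 -mulr_sumr -!mulrN -!mulrDr ler_wpM2l //.
  have /set0Pn [i' i'J] := J0.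
  have := decodable iJ.
  have : \sum_(l in J) r l + 3 * dt <= \sum_(l in J) (r l + 3 * dt).
    rewrite big_split /= lerD2l (bigD1 i') //= lerDl; apply: sumr_ge0 => l'' _.
    by rewrite mulr_ge0 // ltW.
  lra.
have hJt : #|{: Jt (codebook n)}|%:R <= exp2 (\sum_i (n%:R * (r i + 3 * dt) + 1)) :> R.
  rewrite card_Jt natr_prod exp2_sum; apply: ler_prod => i _; rewrite ler0n /=.
  by have [_] := codebook_bounds n i.
have hK : #|{: {ffun 'I_k -> bool}}|%:R <= exp2 (n%:R * R0) :> R by rewrite card_bits le_exp2.
rewrite -[X in _ <= X * _]exp2_nat -exp2D natrM.
apply: (@le_trans _ _ (exp2 (n%:R * (shannon p + dt)) *
   (exp2 (\sum_i (n%:R * (r i + 3 * dt) + 1)) * exp2 (n%:R * R0)) * exp2 (- (n%:R * (shannon (lz j) - dt))))).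
  rewrite ler_wpM2r //; first exact/ltW/exp2_gt0.
  by apply: ler_pM; rewrite ?mulr_ge0 ?ler0n //; apply: ler_pM; rewrite ?ler0n.
rewrite -!exp2D le_exp2 big_split /= sumr_const card_ord -mulr_sumr.
have := ler_wpM2l n0 private; rewrite mulr0; lra.
Qed.

Lemma iid_ghz (eps : R) : 0 < eps -> eps <= 1 -> exists N, forall n, (N <= n)%N ->
  forall k, k%:R <= n%:R * R0 ->
  exists Lam : chan R (nsys A n) (@qsys m k), LOCC Lam /\
    (1 - eps) ^+ 2 <= expval (@ghz_vec R m k) (Lam (trE (psi_copies (n := n) psi))).
Proof.
move=> e0 e1; have [s s0 hs] := small_error m e0.
(* Chosen, with [t] below, so that [2 * eta = t] and each of the two roots is at most [s / 2]. *)
pose eta := s ^+ 2 / 8.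
have eta0 : 0 < eta by rewrite divr_gt0 ?exprn_gt0.
pose t := s ^+ 2 / 4.
have t0 : 0 < t by rewrite divr_gt0 ?exprn_gt0.
have c0 : 0 <= m%:R * 2 ^+ m + 2 ^+ m :> R by rewrite addr_ge0 ?mulr_ge0 ?ler0n ?exprn_ge0.
have [N0 hN0] := exp2_decay c0 dt0 t0.
have tot i : \sum_x hs2 (Phi i x) = 1 by exact: total_split psi1 hE a0 i.
have l0 i J c : 0 <= l i J c by exact: (tau_ge0 x0 _ (hu i J)).
have l1 i J : \sum_c l i J c = 1 by rewrite (tau_total (hu i J)).
have lz0 i xk : 0 <= lz i xk by exact: spectral_gram_ge0 (hw i xk.1).
have lz1 i : \sum_xk lz i xk = 1 by rewrite (block_total (hw i)).
pose pN (be : G) (y : Jt X * A' j) := Phi j y.1 be y.2.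
have pNE : (fun b b' => \sum_x gram (Phi j x) b b') = gram pN.
  by apply/funext => b; apply/funext => b'; rewrite /gram pair_big.
have hv' := hv; rewrite pNE in hv'.
have p0 c : 0 <= p c by exact: spectral_gram_ge0 hv'.
have p1 : \sum_c p c = 1.
  rewrite (spectral_trace hv') -(tot j) [RHS]exchange_big /=; apply: eq_bigr => be _.
  exact: nrm2_curry.
have /choice [NJ hNJ] : forall iJ : 'I_m * {set 'I_m}, exists N, forall n, (N <= n)%N ->
    exists S : pred {ffun 'I_n -> I}, typical n S (l iJ.1 iJ.2) eta.
  by move=> iJ; exact: typical_set.
have /choice [Nz hNz] : forall i : 'I_m, exists N, forall n, (N <= n)%N ->
    exists S : pred {ffun 'I_n -> Jt X * K}, typical n S (lz i) eta.
  by move=> i; exact: typical_set.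
have [NB hNB] := typical_set p0 p1 dt0 eta0.
exists (maxn (\max_iJ NJ iJ) (maxn (\max_i Nz i) (maxn NB N0))) => n.
rewrite !geq_max => /andP[/bigmax_leqP nJ /andP[/bigmax_leqP nz /andP[nB n0]]] k hk.
have /choice [SJ hSJ] := fun iJ => hNJ iJ n (nJ iJ isT).
have /choice [Sz hSz] := fun i => hNz i n (nz i isT).
have [SB [hB1 hB2 hB3]] := hNB n nB.
have hpost := post_copies (n := n) psi Ek.
pose Szn i : pred (Jt (nsys X n) * {ffun 'I_n -> K}) := fun xk => Sz i (pairing xk).
have cC i : (0 < #|codebook n i|)%N by rewrite card_ffun_gt0 // card_bool.
have ghz := random_code_ghz (psi_copies_unit n psi1) (kraus_copies_complete (n := n) hE)
  (const_copies n x0) (k := k) cC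
  (fun i x => spectral_gram_copies hpost x (hw i))
  (fun i J => spectral_tau_copies hpost (hu i J))
  (spectral_sum_copies hpost hv) (Sz := Szn) (SJ := fun i J => SJ (i, J)) (SB := SB) (eta := eta)
  (lam := fun i J => exp2 (- (n%:R * (shannon (l i J) - dt))))
  (lamB := exp2 (- (n%:R * (shannon (lz j) - dt)))).
have czE xk i : l' i xk.1 xk.2 = lz i xk by [].
have eta_z i : 1 - eta <= \sum_(xk | Szn i xk) \prod_t l' i (copy xk.1 t) (xk.2 t).
  by rewrite sum_pairing; case: (hSz i).
have lamB_le xk : Szn j xk ->
    \prod_t l' j (copy xk.1 t) (xk.2 t) <= exp2 (- (n%:R * (shannon (lz j) - dt))).
  have [_ _ h] := hSz j => /h; apply: le_trans; rewrite le_eqVlt; apply/orP; left; apply/eqP.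
  by apply: eq_bigr => t' _; rewrite ffunE.
have cost : collision_cost (codebook n) Szn (fun i J => exp2 (- (n%:R * (shannon (l i J) - dt)))) +
    leakage_cost k (codebook n) SB (exp2 (- (n%:R * (shannon (lz j) - dt)))) <= t.
  apply: le_trans (hN0 n n0); apply: cost_bound => // i.
  by have [_ h _] := hSz i; rewrite card_pairing.
have s2 : Num.sqrt (2 * eta) + Num.sqrt (collision_cost (codebook n) Szn (fun i J => exp2 (- (n%:R * (shannon (l i J) - dt)))) +
    leakage_cost k (codebook n) SB (exp2 (- (n%:R * (shannon (lz j) - dt))))) <= s.
  have e : Num.sqrt t = s / 2.
    rewrite (_ : t = (s / 2) ^+ 2) ?sqrtr_sqr ?ger0_norm //; first by rewrite divr_ge0 // ltW.
    by rewrite /t; field.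
  have -> : 2 * eta = t by rewrite /t /eta; field.
  have := ler_wsqrtr cost; rewrite e => h; lra.
have hB := hs _ s2.
have eps1 : 0 <= 1 - eps by rewrite subr_ge0.
have etaJ i J : 1 - eta <= \sum_(c | SJ (i, J) c) \prod_t l i J (c t) by case: (hSJ (i, J)).
have leJ i J c : SJ (i, J) c -> \prod_t l i J (c t) <= exp2 (- (n%:R * (shannon (l i J) - dt))).
  by case: (hSJ (i, J)) => _ _; apply.
have [Lam [hL hv2]] := ghz eta_z etaJ hB1 leJ (fun _ _ => ltW (exp2_gt0 _)) lamB_le
  (ltW (exp2_gt0 _)) (le_trans eps1 hB).
exists Lam; split=> //; apply: le_trans hv2.
by rewrite lerXn2r ?nnegrE //; exact: le_trans hB.
Qed.
End ManyCopies.

(** * From protocols to the capacity *)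

Section Capacity.
Variable R : realType.
Local Notation C := R[i].
Variables (m : nat) (A : 'I_m -> finType) (E : finType) (psi : vec R (Jt A * E)%type).
Hypothesis psi1 : unit_vec psi.

Lemma unit_vec_total (D : finType) (T : 'I_m -> finType) (z : vec R (Jt T * D)%type) :
  unit_vec z -> \sum_a nrm2 (fun e => z (a, e)) = 1.
Proof. by move=> z1; rewrite -nrm2_curry psi_nrm2. Qed.

Lemma unit_vec_point : exists a : Jt A, True.
Proof.
case: (pickP (fun _ : Jt A => true)) => [a _|h]; first by exists a.
by have /eqP := unit_vec_total psi1; rewrite big_pred0 // eq_sym oner_eq0.
Qed.

Lemma protocol_mono n k (e e' : R) : e <= e' ->
  protocol (trE psi) n k e -> protocol (trE psi) n k e'.
Proof.
by move=> he [Lam [hL h]]; exists Lam; split=> //; apply: le_trans h; rewrite lerD2l lerN2.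
Qed.

Lemma protocol_of_expval n k (e : R) (Lam : chan R (nsys A n) (@qsys m k)) : LOCC Lam ->
  (1 - e) ^+ 2 <= expval (@ghz_vec R m k) (Lam (trE (psi_copies (n := n) psi))) ->
  protocol (trE psi) n k e.
Proof.
move=> hL h; exists Lam; split=> //; rewrite ntensor_trE.
exact: (fidelity_of_val (N := fun a e => psi_copies (n := n) psi (a, e)) hL h).
Qed.

Lemma protocol_one (j : 'I_m) n k : protocol (trE psi) n k 1.
Proof.
have [a _] := unit_vec_point.
have [Lam [hL _]] := measure_prepare j (const_copies n a) k
  (fun a e => psi_copies (n := n) psi (a, e)).
exists Lam; split=> //; rewrite ntensor_trE subrr.
exact: (fidelity_ge0 (fun a e => psi_copies (n := n) psi (a, e)) _ hL).
Qed.

Lemma protocol_zero (j : 'I_m) n : protocol (trE psi) n 0 0.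
Proof.
have [a _] := unit_vec_point.
have [Lam [hL h]] := measure_prepare j (const_copies n a) 0
  (fun a e => psi_copies (n := n) psi (a, e)).
apply: (protocol_of_expval hL); rewrite subr0 expr1n.
by have := h erefl; rewrite (unit_vec_total (psi_copies_unit n psi1)).
Qed.

(** The error at [n] is the infimum of the feasible errors plus 1 / (n + 1), as the infimum may not
    be attained; this replaces a diagonal choice. [protocol_one] keeps the feasible set nonempty for
    small [n]. *)
Lemma achievable_of_protocols (j : 'I_m) (r : R) : 0 <= r ->
  (forall eps, 0 < eps -> eps <= 1 -> exists N, forall n, (N <= n)%N ->
     forall k, k%:R <= n%:R * r -> protocol (trE psi) n k eps) ->
  achievable (trE psi) r.
Proof.
move=> r0 hp; pose k n := Num.Def.trunc (n%:R * r).
have hk n : (k n)%:R <= n%:R * r < (k n).+1%:R.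
  by apply: truncn_itv; rewrite mulr_ge0 ?ler0n.
pose feasible n := [set e : R | 0 <= e /\ protocol (trE psi) n (k n) e]%classic.
have finf n : has_inf (feasible n).
  split; first by exists 1; split=> //; exact: protocol_one.
  by exists 0 => e [].
exists k, (fun n => inf (feasible n) + n.+1%:R^-1); split=> [n _|].
  have ip : 0 < n.+1%:R^-1 :> R by rewrite invr_gt0 ltr0n.
  have [e [_ he] le] := inf_adherent ip (finf n).
  exact: protocol_mono (ltW le) he.
split.
- apply/cvgrPdist_lt => eps e0.
  have e1 : 0 < Num.min (eps / 2) 1 by rewrite lt_min divr_gt0 //= ltr01.
  have [|N hN] := hp _ e1; first by rewrite ge_min lexx orbT.
  have q0 : 0 <= 2 / eps by rewrite divr_ge0 // ltW.
  exists (maxn N (Num.Def.archi_bound (2 / eps))) => // n /=.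
  rewrite geq_max => /andP[nN nb]; have [h1 _] := andP (hk n).
  have f0 : 0 <= inf (feasible n).
    apply: lb_le_inf; first by have [] := finf n.
    by move=> e [].
  have f1 : inf (feasible n) <= eps / 2.
    apply: (@le_trans _ _ (Num.min (eps / 2) 1)); last by rewrite ge_min lexx.
    apply: ge_inf; first by have [] := finf n.
    by split; [exact: ltW | exact: hN].
  have n1 : n.+1%:R^-1 < eps / 2.
    rewrite -[eps / 2]invrK ltf_pV2 ?posrE ?invr_gt0 ?divr_gt0 ?ltr0n // invfM invrK mulrC.
    apply: lt_le_trans (archi_boundP q0) _; rewrite ler_nat; exact: leqW.
  rewrite sub0r normrN ger0_norm ?addr_ge0 ?invr_ge0 ?ler0n //.
  by rewrite [ltRHS]splitr ler_ltD.
- apply/cvgrPdist_lt => eps e0.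
  have q0 : 0 <= 1 / eps by rewrite divr_ge0 // ltW.
  exists (Num.Def.archi_bound (1 / eps)) => // n /= nb.
  have nq : 1 / eps < n%:R by apply: lt_le_trans (archi_boundP q0) _; rewrite ler_nat.
  have n0 : 0 < n%:R :> R by apply: le_lt_trans nq.
  have [h1 h2] := andP (hk n).
  have -> : r - (k n)%:R / n%:R = (n%:R * r - (k n)%:R) / n%:R.
    by rewrite mulrBl [_ * r]mulrC mulfK ?gt_eqF.
  rewrite ger0_norm ?divr_ge0 ?subr_ge0 ?ler0n // ltr_pdivrMr //.
  apply: (@lt_trans _ _ 1); last by rewrite mulrC -ltr_pdivrMr.
  by rewrite ltrBlDr -natr1 addrC in h2 *.
Qed.
End Capacity.

Theorem theorem5 (R : realType) (m : nat) (A A' X : 'I_m -> finType) (E : finType)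
    (psi : vec R (Jt A * E)%type) (Ek : forall j : 'I_m, X j -> op R (A' j) (A j)) :
  unit_vec psi ->
  (forall (j : 'I_m) (a b : A j),
      \sum_(x : X j) opmul (adj (Ek j x)) (Ek j x) a b = @idop R (A j) a b) ->
  forall j : 'I_m,
    ((cent (Xslots [set: 'I_m]) (Eslot m :|: Aslots (~: [set j])) (omega Ek psi)
       - RCO (omega Ek psi))%:E
     <= ghz_capacity (trE psi))%E.
Proof.
move=> psi1 hE j; set om := omega Ek psi; set target := _ - RCO om.
(* Were one of these types empty, the state after the instruments would have norm 0. The points
   serve as pinned and default values. *)
have [x0 [a0 [e0 _]]] : exists x0 : Jt X, exists a0 : Jt A', exists e0 : E, True.
  case: (pselect (exists y : Jt X * (Jt A' * E), True)) => [[[x [a e]] _]|hn].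
    by exists x, a, e.
  have /eqP := post_nrm2 psi1 hE; rewrite big1 1?eq_sym ?oner_eq0 // => x _.
  by rewrite /nrm2 big1 // => be _; case: hn; exists (x, be).
pose T := (Jt X * (Jt A' * E))%type.
pose Phi i := splitoff (post psi Ek) a0 (i := i).
have /choice [ul hul] : forall iJ : 'I_m * {set 'I_m}, exists ul : (T -> T -> R[i]) * (T -> R),
    spectral (tau (Phi iJ.1) (~: iJ.2)) ul.1 ul.2.
  by move=> [i J]; have [u [l h]] := tau_spectral (Phi i) x0 (~: J); exists (u, l).
pose u i J := (ul (i, J)).1; pose l i J := (ul (i, J)).2.
have hu i J : spectral (tau (Phi i) (~: J)) (u i J) (l i J) by exact: hul (i, J).
have /choice [wl hwl] : forall ix : 'I_m * Jt X,
    exists wl : ((Jt A' * E) -> (Jt A' * E) -> R[i]) * ((Jt A' * E) -> R),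
    spectral (gram (Phi ix.1 ix.2)) wl.1 wl.2.
  move=> [i x]; have [w [l' h]] := hermitian_spectral (gram_herm (Phi i x)); by exists (w, l').
pose w i x := (wl (i, x)).1; pose l' i x := (wl (i, x)).2.
have hw i x : spectral (gram (Phi i x)) (w i x) (l' i x) by exact: hwl (i, x).
have [v [p hv]] : exists v p, spectral (I := (Jt A' * E)%type) (fun b b' => \sum_x gram (Phi j x) b b') v p.
  have -> : (fun b b' => \sum_x gram (Phi j x) b b') = gram (fun be (y : Jt X * A' j) => Phi j y.1 be y.2).
    by apply/funext => b; apply/funext => b'; rewrite /gram pair_big.
  exact/hermitian_spectral/gram_herm.
pose lz i (xk : Jt X * (Jt A' * E)) := l' i xk.1 xk.2.
have sJ i J : sent (Xslots (~: J) :|: Aslots [set i]) om = shannon (l i J).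
  exact: (entropy_receiver x0 e0 (hu i J)).
have sZ i : sent (Xslots [set: 'I_m] :|: Aslots [set i]) om = shannon (lz i).
  exact: (entropy_receiver x0 e0 (block_spectral (hw i))).
have sB : sent (Eslot m :|: Aslots (~: [set j])) om = shannon p.
  exact: (entropy_rest x0 e0 hv).
have sXB : sent (Xslots [set: 'I_m] :|: (Eslot m :|: Aslots (~: [set j]))) om = shannon (lz j).
  exact: (entropy_keyed_rest x0 e0 (block_spectral (hw j))).
have gainE (i : 'I_m) (J : {set 'I_m}) :
    cent (Xslots J) (Xslots (~: J) :|: Aslots [set i]) om = shannon (lz i) - shannon (l i J).
  rewrite /cent sJ -sZ; congr (sent _ om - _).
  by apply/setP => -[[s|s]|[]]; rewrite !inE ?orbF //=; case: (s \in J).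
have tot i : \sum_x hs2 (Phi i x) = 1 by exact: total_split psi1 hE a0 i.
have gain0 (i : 'I_m) (J : {set 'I_m}) : i \notin J ->
    0 <= cent (Xslots J) (Xslots (~: J) :|: Aslots [set i]) om.
  by move=> _; rewrite gainE subr_ge0; exact: (block_entropy_ge x0 (hw i) (tot i) (hu i J)).
(* The target may be negative, unlike a rate; if [target - e] is nonpositive, rate 0 is reached by
   the protocols with [k = 0]. *)
apply/lee_addgt0Pr => e epos; pose r0 := Num.max 0 (target - e).
have hr0 : achievable (trE psi) r0.
  have r00 : 0 <= r0 by rewrite le_max lexx.
  apply: (achievable_of_protocols psi1 j r00) => eps eps0 eps1.
  rewrite /r0; case: (lerP (target - e) 0) => hte.
    exists 0%N => n _ k; rewrite mulr0 => hk; apply: (protocol_mono (ltW eps0)).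
    have -> : k = 0%N by apply/eqP; rewrite -leqn0 -(ler_nat R).
    exact: protocol_zero.
  have e20 : 0 < e / 2 by rewrite divr_gt0.
  have [r [rpos hr hsum]] := exists_rates j e20 gain0.
  (* Half of [e] pays [3 * dt] for each of the [m] hashes and [3 * dt] for the leakage; the other
     half is the gap between the chosen sum rate and [RCO]. *)
  pose dt := e / (2 * (3 * m.+1%:R)).
  have dt0 : 0 < dt by rewrite divr_gt0 // !mulr_gt0 ?ltr0n.
  have dec (i : 'I_m) (J : {set 'I_m}) : i \notin J -> shannon (lz i) - shannon (l i J) <= \sum_(i in J) r i.
    by move=> iJ; rewrite -gainE; exact: hr.
  have priv : shannon p - shannon (lz j) + \sum_i (r i + 3 * dt) + (target - e) + 3 * dt <= 0.
    have dtE : (3 * m.+1%:R) * dt = e / 2.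
      have : m.+1%:R != 0 :> R by rewrite pnatr_eq0.
      by rewrite /dt; move: (m.+1%:R) => M hM; field.
    rewrite big_split /= sumr_const card_ord -[_ *+ m]mulr_natl /target /cent sB sXB.
    have : 3 * dt + m%:R * (3 * dt) = e / 2 by rewrite -dtE -natr1; ring.
    lra.
  have [N hN] := iid_ghz psi1 hE x0 hw hu hv rpos dt0 dec priv eps0 eps1.
  exists N => n nN k hk; have [Lam [hL h]] := hN n nN k hk.
  exact: protocol_of_expval hL h.
apply: (@le_trans _ _ (r0 + e)%:E).
  by rewrite lee_fin -lerBlDr le_max lexx orbT.
by rewrite EFinD leeD2r // ereal_sup_ubound //; exists r0.
Qed.
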